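(* Let $k$ be an infinite field, let $n\ge 1$ and let $d>2$ be an integer. Then, for any positive integer $r$, there is an ideal $I$ generated by $r$ forms of degree $d$ in $R=k[x_1,\dots,x_n]$ such that $R/I$ has the Hilbert series conjectured by Fröberg up to degree $d+2$; that is, for every $0\le i\le d+2$, $\dim_k (R/I)_i$ equals the coefficient of $t^i$ in $\left[\frac{(1-t^d)^r}{(1-t)^n}\right]$.
   Context: $R=k[x_1,\dots,x_n]$ is the standard graded polynomial ring and $R_i$ denotes its degree $i$ part; a form of degree $d$ is an element of $R_d$. For a power series $\sum_i a_i t^i$ with integer coefficients, $\left[\sum_i a_it^i\right]$ denotes its truncation at the first non-positive coefficient, i.e. $\sum_i b_it^i$ where $b_i=a_i$ if $a_0,\dots,a_i>0$ and $b_i=0$ otherwise. The Hilbert series conjectured by Fröberg for an ideal generated by $r$ generic forms of degree $d$ in $n$ variables is $\left[\frac{(1-t^d)^r}{(1-t)^n}\right]$. *)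

(* Defs.v *)
From mathcomp Require Import all_boot all_order all_algebra.
From mathcomp.multinomials Require Export mpoly.

Set Implicit Arguments.
Unset Strict Implicit.
Unset Printing Implicit Defensive.

Import Order.TTheory GRing.Theory Num.Theory.
Local Open Scope ring_scope.

Definition infinite_type (T : eqType) : Prop :=
  ~ exists s : seq T, forall x : T, x \in s.

Definition ideal_gen (k : fieldType) (n r : nat) (f : 'I_r -> {mpoly k[n]})
    (g : {mpoly k[n]}) : Prop :=
  exists h : 'I_r -> {mpoly k[n]}, g = \sum_(j < r) h j * f j.

(* [dim_quot_deg I i m] says that dim_k (R/I)_i = m, where (R/I)_i is the image
   of R_i in R/I: the classes modulo I of the m forms [e j] of degree i are
   a k-basis of (R/I)_i.  This determines m, see [dim_quot_deg_uniq]. *)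
Definition dim_quot_deg (k : fieldType) (n : nat) (I : {mpoly k[n]} -> Prop)
    (i m : nat) : Prop :=
  exists e : 'I_m -> {mpoly k[n]},
    [/\ forall j, e j \is i.-homog,
        forall c : 'I_m -> k, I (\sum_(j < m) c j *: e j) -> forall j, c j = 0
      & forall g, g \is i.-homog ->
          exists c : 'I_m -> k, I (g - \sum_(j < m) c j *: e j)].

Lemma ideal_genD (k : fieldType) (n r : nat) (f : 'I_r -> {mpoly k[n]}) g1 g2 :
  ideal_gen f g1 -> ideal_gen f g2 -> ideal_gen f (g1 + g2).
Proof.
move=> [h1 ->] [h2 ->]; exists (fun j => h1 j + h2 j).
by rewrite -big_split; apply: eq_bigr => j _; rewrite mulrDl.
Qed.

Lemma ideal_genM (k : fieldType) (n r : nat) (f : 'I_r -> {mpoly k[n]}) a g :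
  ideal_gen f g -> ideal_gen f (a * g).
Proof.
move=> [h ->]; exists (fun j => a * h j).
by rewrite mulr_sumr; apply: eq_bigr => j _; rewrite mulrA.
Qed.

Lemma dim_quot_deg_le (k : fieldType) (n r : nat) (f : 'I_r -> {mpoly k[n]})
    (i m m' : nat) :
  dim_quot_deg (ideal_gen f) i m -> dim_quot_deg (ideal_gen f) i m' ->
  (m <= m')%N.
Proof.
move=> [e [eh efree _]] [e' [_ _ egen']].
have [A HA] : exists A : 'M[k]_(m, m'),
    forall a, ideal_gen f (e a - \sum_(j < m') A a j *: e' j).
  have := fin_all_exists (fun a => egen' _ (eh a)) => -[c Hc].
  exists (\matrix_(a, j) c a j) => a.
  by under eq_bigr => j _ do rewrite mxE.
rewrite leqNgt; apply/negP => lt_m'm.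
have : kermx A != 0.
  rewrite kermx_eq0 /row_free; apply/eqP => rA.
  by have := rank_leq_col A; rewrite rA leqNgt lt_m'm.
case/rowV0Pn => v /sub_kermxP vA /negP[]; apply/eqP/rowP => j; rewrite mxE.
apply: (efree (fun j => v 0 j)).
have -> : \sum_(a < m) v 0 a *: e a =
    \sum_(a < m) (v 0 a)%:MP * (e a - \sum_(j < m') A a j *: e' j).
  under [RHS]eq_bigr => a _ do rewrite mul_mpolyC scalerBr scaler_sumr.
  rewrite sumrB exchange_big /= [X in _ - X]big1 ?subr0 // => b _.
  under eq_bigr => a _ do rewrite scalerA.
  rewrite -scaler_suml.
  by have := congr1 (fun M : 'rV_m' => M 0 b) vA; rewrite !mxE => ->; rewrite scale0r.
elim/big_ind: _ => [||a _]; last by apply/ideal_genM/HA.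
- by exists (fun=> 0); rewrite big1 // => b _; rewrite mul0r.
- exact: ideal_genD.
Qed.

Lemma dim_quot_deg_uniq (k : fieldType) (n r : nat) (f : 'I_r -> {mpoly k[n]})
    (i m m' : nat) :
  dim_quot_deg (ideal_gen f) i m -> dim_quot_deg (ideal_gen f) i m' -> m = m'.
Proof.
move=> Hm Hm'; apply/eqP.
by rewrite eqn_leq (dim_quot_deg_le Hm Hm') (dim_quot_deg_le Hm' Hm).
Qed.

(* A power series over int is its coefficient function nat -> int.  For q with
   constant coefficient 1, [series_div p q] is the power series p / q, obtained
   by long division; [series_divP] is its defining equation q * (p / q) = p. *)
Fixpoint series_div_prefix (p q : {poly int}) (i : nat) : seq int :=
  if i is i'.+1 then
    let s := series_div_prefix p q i' in
    rcons s (p`_i' - \sum_(j < i') q`_(i' - j) * s`_j)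
  else [::].

Definition series_div (p q : {poly int}) (i : nat) : int :=
  (series_div_prefix p q i.+1)`_i.

Lemma size_series_div_prefix p q i : size (series_div_prefix p q i) = i.
Proof. by elim: i => //= i IHi; rewrite size_rcons IHi. Qed.

Lemma nth_series_div_prefix p q i j :
  (j < i)%N -> (series_div_prefix p q i)`_j = series_div p q j.
Proof.
elim: i => // i IHi; rewrite ltnS leq_eqVlt => /predU1P[-> //|lt_ji].
by rewrite /= nth_rcons size_series_div_prefix lt_ji IHi.
Qed.

Lemma series_divP (p q : {poly int}) : q`_0 = 1 ->
  forall i, \sum_(j < i.+1) q`_(i - j) * series_div p q j = p`_i.
Proof.
move=> q0 i; rewrite big_ord_recr /= subnn q0 mul1r {2}/series_div /=.
rewrite nth_rcons size_series_div_prefix ltnn eqxx addrC.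
under [X in _ - X + _]eq_bigr => j _ do
  rewrite nth_series_div_prefix ?ltn_ord //.
by rewrite subrK.
Qed.

Lemma coef0_expr_1subX (n : nat) : ((1 - 'X : {poly int}) ^+ n)`_0 = 1.
Proof. by rewrite -horner_coef0 !hornerE expr1n. Qed.

Definition trunc_pos (a : nat -> int) (i : nat) : int :=
  if [forall j : 'I_i.+1, 0 < a j] then a i else 0.

Definition froberg_series (n d r : nat) : nat -> int :=
  trunc_pos (series_div ((1 - 'X^d) ^+ r) ((1 - 'X) ^+ n)).

(* Main.v *)
(** Let [A_j] be the matrix of [(h_i)_i |-> sum_i h_i f_i] on forms [h_i] of
    degree [j], for forms [f_i] of degree [d] with indeterminate coefficients
    [c_(i,mu)].  Since [d + 2 < 2 d], the coefficients of Froberg's series up to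
    degree [d + 2] are [dim R_i - r dim R_(i-d)], so it is enough that [A_0],
    [A_1] and [A_2] have maximal rank.

    Suppose that [A_j] has a right kernel vector [F] and a left kernel vector
    [g], and let [C = (F_(q mu))_(q,mu)], with [q] of degree [j] and [mu] of degree
    [d].  Applying [d/dc_(i,mu)] to [A_j F = 0] and multiplying by [g] gives
    [g_i C = 0], so [m = rank C] satisfies [1 <= m < dim R_j].  The derivatives of
    [F], and [F] itself, are tangent at [C] to the matrices of rank [m]: they are
    killed by [gamma (x) w] for [gamma] in the left and [w] in the right kernel
    of [C].  From [A_j dF = - (dA_j) F] they span at least [r m + 1] dimensions.
    Comparing leading monomials, the tangent space has dimension at most the
    number of monomials [M] such that every divisor [q] of [M] of degree [j] is
    in [B], or has [M / q] in [B'], where [B] and [B'] are the monomials that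
    do not lead an element of the left, resp. right, kernel; these are sets of
    at most [m] monomials.  Counting shows that there are at most [r m] such [M]
    when [r > n] and [(r + 1) dim R_j > dim R_(d+j)], a contradiction.  A smaller
    number of forms is handled by taking part of an independent system, and
    [r <= n] by the powers [x_i ^ d].

    For [j = 2] the count is a weighted double counting, except for finitely
    many pairs [(n, d)]; these follow by induction on [n], after [B] and [B'] have
    been replaced by strongly stable sets. *)

Require Import Defs.
From mathcomp Require Import all_boot all_order all_algebra.
From mathcomp.multinomials Require Import mpoly.
From Stdlib Require Import ZArith Classical.
From mathcomp Require Import eqtype ssrnat zify ring.

Set Implicit Arguments.
Unset Strict Implicit.
Unset Printing Implicit Defensive.

(** * Monomials as exponent sequences *)

(** The list is in increasing lexicographic order, see [mons_pairwise], and its recursion (first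
    variable absent, or divided out once) is Pascal's rule for the dimensions. *)
Fixpoint mons (n : nat) : nat -> seq (seq nat) :=
  if n is n'.+1 then
    fix monsS e := if e is e'.+1
      then map (cons 0) (mons n' e) ++ map (fun m => incr_nth m 0) (monsS e')
      else [:: nseq n 0]
  else fun e => if e is 0 then [:: [::]] else [::].

Fixpoint madd (q m : seq nat) : seq nat :=
  match q, m with
  | a :: q', b :: m' => (a + b) :: madd q' m'
  | _, _ => [::]
  end.

Fixpoint msub (m q : seq nat) : seq nat :=
  match m, q with
  | a :: m', b :: q' => (a - b) :: msub m' q'
  | _, _ => [::]
  end.

Fixpoint mle (q m : seq nat) : bool :=
  match q, m with
  | a :: q', b :: m' => (a <= b) && mle q' m'
  | [::], [::] => true
  | _, _ => false
  end.

Lemma monsS n e :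
  mons n.+1 e.+1 =
  map (cons 0) (mons n e.+1) ++ map (fun m => incr_nth m 0) (mons n.+1 e).
Proof. by []. Qed.

Lemma mem_mons n e m : (m \in mons n e) = (size m == n) && (sumn m == e).
Proof.
elim: n e m => [|n IHn] e m.
  by case: e => [|e]; case: m => [|a m] //=; rewrite inE.
elim: e m => [|e IHe] m.
  rewrite inE; apply/eqP/andP => [->|[/eqP sz /eqP s0]].
    by rewrite size_nseq sumn_nseq mul0n !eqxx.
  apply: (@eq_from_nth _ 0); rewrite ?size_nseq // => i ltis.
  rewrite nth_nseq if_same.
  elim: m i s0 {sz} ltis => [|a m IHm] [|i] //= s0 lt; first by lia.
  by apply: IHm => //; lia.
rewrite monsS mem_cat; apply/orP/andP => [[]|[]].
- case/mapP => m'; rewrite IHn => /andP[/eqP sz /eqP sm] ->.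
  by rewrite /= sz sm add0n !eqxx.
- case/mapP => m'; rewrite IHe => /andP[/eqP sz /eqP sm] ->.
  by case: m' sz sm => [|a m'] //= [->] <-; rewrite addSn !eqxx.
case: m => [|[|a] m] //= sz sm; [left|right].
  by apply/mapP; exists m => //; rewrite IHn; apply/andP.
apply/mapP; exists (a :: m) => //; rewrite IHe; exact/andP.
Qed.

Lemma mons_uniq n e : uniq (mons n e).
Proof.
elim: n e => [|n IHn] e; first by case: e.
elim: e => // e IHe; rewrite monsS cat_uniq map_inj_uniq ?IHn; last first.
  by move=> x y [].
rewrite map_inj_in_uniq ?IHe ?andbT; last first.
  move=> x y; rewrite !mem_mons => /andP[/eqP sx _] /andP[/eqP sy _].
  by case: x y sx sy => [|a x] [|b y] //= _ _ [-> ->].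
apply/hasPn => m /mapP[m']; rewrite mem_mons => /andP[/eqP sz _] ->.
by apply/mapP => -[x _]; case: m' sz.
Qed.

Lemma size_mons n e : size (mons n e) = 'C((n + e).-1, e).
Proof.
elim: n e => [|n IHn] e; first by case: e => [|e] //=; rewrite bin_small.
elim: e => [|e IHe]; first by rewrite /= bin0.
by rewrite monsS size_cat !size_map IHn IHe !addnS !addSn.
Qed.

Lemma mons_ratio n e : (n + e) * size (mons n e) = e.+1 * size (mons n e.+1).
Proof.
rewrite !size_mons addnS; case: n => [|n].
  by case: e => // e; rewrite !bin_small.
by rewrite (mul_bin_diag (n.+1 + e) e).
Qed.

Lemma mons_deg0 n : mons n 0 = [:: nseq n 0].
Proof. by case: n. Qed.

Lemma mons_var0 e : mons 0 e.+1 = [::].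
Proof. by []. Qed.

Arguments mons : simpl never.

Lemma size_madd q m : size q = size m -> size (madd q m) = size m.
Proof. by elim: q m => [|a q IH] [|b m] //= [] /IH ->. Qed.

Lemma sumn_madd q m : size q = size m -> sumn (madd q m) = sumn q + sumn m.
Proof. by elim: q m => [|a q IH] [|b m] //= [] /IH ->; lia. Qed.

Lemma nth_madd q m i : size q = size m ->
  nth 0 (madd q m) i = nth 0 q i + nth 0 m i.
Proof. by elim: q m i => [|a q IH] [|b m] [|i] //= [] /IH ->. Qed.

Lemma maddC q m : madd q m = madd m q.
Proof. by elim: q m => [|a q IH] [|b m] //=; rewrite addnC IH. Qed.

Lemma maddA p q m : madd p (madd q m) = madd (madd p q) m.
Proof. by elim: p q m => [|a p IH] [|b q] [|c m] //=; rewrite addnA IH. Qed.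

Lemma msubK q m : mle q m -> madd q (msub m q) = m.
Proof. by elim: q m => [|a q IH] [|b m] //= /andP[ab /IH->]; rewrite subnKC. Qed.

Lemma maddK q m : size q = size m -> msub (madd q m) q = m.
Proof. by elim: q m => [|a q IH] [|b m] //= [] /IH ->; rewrite addKn. Qed.

Lemma mle_maddr q m : size q = size m -> mle q (madd q m).
Proof. by elim: q m => [|a q IH] [|b m] //= [] /IH ->; rewrite leq_addr. Qed.

Lemma mle_trans p q m : mle p q -> mle q m -> mle p m.
Proof.
elim: p q m => [|a p IH] [|b q] [|c m] //= /andP[ab pq] /andP[bc qm].
by rewrite (leq_trans ab bc) (IH q).
Qed.

Lemma msub_mons n j e q m : q \in mons n j -> m \in mons n (j + e) -> mle q m ->
  msub m q \in mons n e.
Proof.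
rewrite !mem_mons => /andP[/eqP sq /eqP dq] /andP[/eqP sm /eqP dm] lqm.
have sz : size (msub m q) = n.
  rewrite -sq => {dq dm sq sm}; elim: q m lqm => [|a q IH] [|b m] //=.
  by case/andP => _ /IH ->.
have := sumn_madd (etrans sq (esym sz)); rewrite msubK // dm dq => /addnI <-.
by rewrite sz !eqxx.
Qed.

Lemma madd_mons n j e q m : q \in mons n j -> m \in mons n e ->
  madd q m \in mons n (j + e).
Proof.
rewrite !mem_mons => /andP[/eqP sq /eqP dq] /andP[/eqP sm /eqP dm].
by rewrite size_madd ?sumn_madd ?sq ?sm // dq dm !eqxx.
Qed.

Lemma perm_mul_mons n j e q : q \in mons n j ->
  perm_eq [seq madd q m | m <- mons n e] [seq M <- mons n (j + e) | mle q M].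
Proof.
move=> qn; have sq : size q = n by move: qn; rewrite mem_mons => /andP[/eqP].
apply: uniq_perm; rewrite ?filter_uniq ?mons_uniq //.
  rewrite map_inj_in_uniq ?mons_uniq // => x y.
  rewrite !mem_mons => /andP[/eqP sx _] /andP[/eqP sy _] /(congr1 (msub^~ q)).
  by rewrite !maddK ?sq.
move=> M; rewrite mem_filter; apply/mapP/andP => [[m mn ->]|[lqM Mn]].
  split; last exact: madd_mons.
  by apply: mle_maddr; move: mn; rewrite mem_mons sq => /andP[/eqP].
by exists (msub M q); rewrite ?msubK //; apply: msub_mons qn Mn lqM.
Qed.

Lemma big_mul_mons n j e q (F : seq nat -> nat) : q \in mons n j ->
  \sum_(M <- mons n (j + e) | mle q M) F M = \sum_(m <- mons n e) F (madd q m).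
Proof.
by move=> qn; rewrite -big_filter -(perm_big _ (perm_mul_mons e qn)) big_map.
Qed.

Lemma count_mul_mons n j e q (P : pred (seq nat)) : q \in mons n j ->
  count (fun M => mle q M && P M) (mons n (j + e)) =
  count (fun m => P (madd q m)) (mons n e).
Proof.
move=> qn; rewrite -!sum1_count big_mkcondr big_mul_mons //.
by rewrite -big_mkcond.
Qed.

(** * Free monomials *)

Definition free_mon n j (B B' : pred (seq nat)) (M : seq nat) : bool :=
  all (fun q => mle q M ==> B q || B' (msub M q)) (mons n j).

Lemma mons_le n j M : j <= sumn M -> size M = n -> exists2 q, q \in mons n j & mle q M.
Proof.
elim: j => [|j IHj] jM szM.
  exists (nseq n 0); first by rewrite mem_mons size_nseq sumn_nseq mul0n !eqxx.
  by rewrite -szM; elim: M {jM szM} => //= a M ->.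
have [q + lqM] := IHj (ltnW jM) szM.
rewrite mem_mons => /andP[/eqP sq /eqP dq].
have : sumn q < sumn M by rewrite dq.
rewrite -sq -dq; elim: q M lqM {sq dq jM szM IHj} => [|a q IH] [|b M] //=.
case/andP=> ab lqM lt; have [ltab|geab] := ltnP a b.
  by exists (a.+1 :: q); rewrite ?mem_mons /= ?ltab ?lqM ?addSn ?eqxx.
have {geab} eab : a = b by apply/eqP; rewrite eqn_leq ab.
have [|q'] := IH _ lqM; first by lia.
rewrite mem_mons => /andP[/eqP sq /eqP dq] lq'.
by exists (a :: q'); rewrite ?mem_mons /= ?sq ?dq ?addnS ?eqxx ?ab.
Qed.

(** Among the [size (mons n d)] multiples of [q], a free one must have its quotient by [q] in [B'],
    which leaves at most [b] of them. *)
Lemma count_free_le_single n j d (B B' : pred (seq nat)) q b :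
  q \in mons n j -> ~~ B q -> count B' (mons n d) <= b ->
  count (free_mon n j B B') (mons n (j + d)) + size (mons n d)
    <= size (mons n (j + d)) + b.
Proof.
move=> qn Bq cb.
have e1 : count (mle q) (mons n (j + d)) = size (mons n d).
  rewrite -(@eq_count _ (fun M => mle q M && predT M)); last by move=> M /=; rewrite andbT.
  by rewrite (count_mul_mons _ _ qn) count_predT.
have := count_predC (mle q) (mons n (j + d)); rewrite e1 => <-.
have : count (free_mon n j B B') (mons n (j + d)) <=
       b + count (predC (mle q)) (mons n (j + d)); last by lia.
have split_c : count (free_mon n j B B') (mons n (j + d)) <=
   count (fun M => mle q M && B' (msub M q)) (mons n (j + d)) +
   count (predC (mle q)) (mons n (j + d)).
  rewrite -count_predUI; apply: leq_trans (leq_addr _ _).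
  apply: sub_count => M /=; case lqM: (mle q M); rewrite ?orbT //=.
  by move/allP/(_ q qn); rewrite lqM /= (negbTE Bq) /= => ->.
apply: leq_trans split_c _; rewrite leq_add2r (count_mul_mons _ _ qn).
apply: leq_trans cb; rewrite leq_eqVlt; apply/orP; left; apply/eqP.
apply: eq_in_count => m mn /=; rewrite maddK //.
by move: qn mn; rewrite !mem_mons => /andP[/eqP-> _] /andP[/eqP-> _].
Qed.

(** The weight used in the double counting. Unlike the plain number of divisors, it has a closed sum
    both over the divisors of fixed degree of a monomial and over its multiples of fixed degree. *)
Fixpoint binmon (M q : seq nat) : nat :=
  match M, q with
  | a :: M', c :: q' => 'C(a, c) * binmon M' q'
  | _, _ => 1
  end.

Lemma binmon_gt0 M q : mle q M -> 0 < binmon M q.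
Proof. by elim: M q => [|a M IH] [|c q] //= /andP[ca /IH]; rewrite muln_gt0 bin_gt0 ca. Qed.

Lemma binmon_eq0 M q : size q = size M -> ~~ mle q M -> binmon M q = 0.
Proof.
elim: M q => [|a M IH] [|c q] //= [sz]; rewrite negb_and -ltnNge => /orP[/bin_small-> //|].
by move/(IH _ sz)->; rewrite muln0.
Qed.

Lemma leq_binmon M M' q : mle M M' -> binmon M q <= binmon M' q.
Proof.
elim: M M' q => [|a M IH] [|a' M'] [|c q] //= /andP[aa MM].
by rewrite leq_mul ?leq_bin2l ?IH.
Qed.

Lemma binmon_nseq0 M n : binmon M (nseq n 0) = 1.
Proof. by elim: M n => [|a M IH] [|n] //=; rewrite bin0 mul1n IH. Qed.

(** Vandermonde's identity in several variables. *)
Lemma sum_binmon_dvd n j M : size M = n ->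
  \sum_(q <- mons n j) binmon M q = 'C(sumn M, j).
Proof.
elim: n j M => [|n IHn] j M.
  by case: M => //= _; case: j => [|j]; rewrite ?mons_deg0 ?big_seq1 ?mons_var0 ?big_nil ?bin0.
case: M => // a M [szM]; rewrite [sumn _]/=; elim: a j => [|a IHa] [|j].
- by rewrite mons_deg0 big_seq1 binmon_nseq0 bin0.
- rewrite monsS big_cat !big_map /= [X in _ + X]big1_seq ?addn0; last first.
    move=> [|c q] /andP[_]; first by rewrite mem_mons.
    by rewrite /= bin0n mul0n.
  by rewrite -IHn //; apply: eq_bigr => q _; rewrite bin0 mul1n.
- by rewrite mons_deg0 big_seq1 binmon_nseq0 bin0.
rewrite addSn binS -!IHa !monsS !big_cat !big_map /= -addnA; congr addn.
  by apply: eq_bigr => q _; rewrite !bin0.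
rewrite -big_split; apply: eq_big_seq => -[|c q] /=; first by rewrite mem_mons.
by rewrite binS mulnDl.
Qed.

(** The sum is the coefficient of [t^e] in the product of the series [(1 - t)^-(q_i + 1)], which is
    [(1 - t)^-(n + sumn q)]. *)
Lemma sum_binmon_mul n e q : size q = n -> 0 < n ->
  \sum_(m <- mons n e) binmon (madd q m) q = 'C((n + sumn q + e).-1, e).
Proof.
have base m : binmon (madd m (nseq (size m) 0)) m = 1.
  by elim: m => //= c m ->; rewrite addn0 binn.
elim: n q e => [|n IHn] [|c q] e //= [szq] _; elim: c e => [|c IHc].
  elim=> [|e IHe].
    by rewrite mons_deg0 big_seq1 bin0 -szq -(base (0 :: q)).
  rewrite monsS big_cat !big_map /=.
  have -> : \sum_(m <- mons n.+1 e) binmon (madd (0 :: q) (incr_nth m 0)) (0 :: q)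
    = \sum_(m <- mons n.+1 e) binmon (madd (0 :: q) m) (0 :: q).
    by apply: eq_big_seq => -[|a m] /=; rewrite ?mem_mons // !bin0.
  rewrite IHe; case: n szq IHn {IHe} => [|n] szq IHn.
    by case: q szq => //= _; rewrite mons_var0 big_nil add0n !addn0 !addnS !add0n /= !binn.
  under eq_bigr => m _ do rewrite bin0 mul1n.
  by rewrite IHn // !addnS !addSn /= [RHS]binS.
elim=> [|e IHe].
  by rewrite mons_deg0 big_seq1 bin0 -szq -(base (c.+1 :: q)).
rewrite monsS big_cat !big_map /=.
have e1 : \sum_(m <- mons n e.+1) 'C(c.+1 + 0, c.+1) * binmon (madd q m) q =
   \sum_(m <- mons n e.+1) 'C(c + 0, c) * binmon (madd q m) q.
  by rewrite !addn0 !binn.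
have e2 : \sum_(m <- mons n.+1 e) binmon (madd (c.+1 :: q) (incr_nth m 0)) (c.+1 :: q)
  = \sum_(m <- mons n.+1 e) binmon (madd (c :: q) (incr_nth m 0)) (c :: q)
    + \sum_(m <- mons n.+1 e) binmon (madd (c.+1 :: q) m) (c.+1 :: q).
  rewrite -big_split; apply: eq_big_seq => -[|a m] /=; first by rewrite mem_mons.
  by rewrite addSn addnS binS mulnDl addnC addSn.
have := IHc e.+1; rewrite monsS big_cat !big_map /= => IHc'.
rewrite e1 e2 addnA IHc' IHe.
have -> : n + (c.+1 + sumn q) + e = n + (c + sumn q) + e.+1 by lia.
have -> : n + (c.+1 + sumn q) + e.+1 = (n + (c + sumn q) + e.+1).+1 by lia.
by rewrite binS.
Qed.

Lemma sum_cond_const (T : Type) (s : seq T) (P : pred T) (c : nat) :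
  \sum_(x <- s | P x) c = count P s * c.
Proof. by rewrite big_const_seq iter_addn_0 mulnC. Qed.

(* Weighted double counting: a monomial all of whose quadratic divisors lie in
   [B] spends its whole weight ['C(d.+2, 2)] on [B], while a quadratic monomial
   [q'] outside [B] takes away from each [q] in [B] the weight of the
   multiples of [q * q']. *)
Lemma free_direct n d (B B' : pred (seq nat)) b t :
  0 < n -> 1 < d ->
  count B (mons n 2) <= b -> count B' (mons n d) <= b ->
  count (predC B) (mons n 2) = t -> 0 < t ->
  'C(d.+2, 2) * t.+1 <= 'C((n + d).-1, d - 2)
    \/ 'C(d.+2, 2) * t.+1 * 'C(d, 2) <= t * 'C((n + d).-1, d - 2) ->
  'C(d.+2, 2) * count (free_mon n 2 B B') (mons n d.+2)
    + b * 'C(d.+2, 2) <= b * 'C((n + d).+1, d).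
Proof.
set kap := 'C(d.+2, 2); set E1 := 'C(_, d - 2).
move=> n0 d1 cB cB' ct t0 hE.
(* A free monomial has all its quadratic divisors in [B] ([Z1]), or has one outside [B] whose
   cofactor is then in [B'] ([Z2]). At most [t * b] monomials are of the second kind. *)
pose Z1 M := all (fun q => mle q M ==> B q) (mons n 2).
pose Z2 M := has (fun q => [&& ~~ B q, mle q M & B' (msub M q)]) (mons n 2).
have leZ : count (free_mon n 2 B B') (mons n d.+2) <=
    count Z1 (mons n d.+2) + t * b.
  apply: (@leq_trans (count Z1 (mons n d.+2) + count Z2 (mons n d.+2))).
    rewrite -count_predUI; apply: leq_trans (leq_addr _ _).
    apply: sub_count => M /= /allP fM.
    rewrite -implyNb; apply/implyP => /allPn[q qn]; rewrite negb_imply => /andP[lq Bq].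
    by apply/hasP; exists q => //; move: (fM q qn); rewrite Bq lq (negbTE Bq).
  rewrite leq_add2l.
  apply: (@leq_trans (\sum_(q <- mons n 2 | ~~ B q)
    count (fun M => mle q M && B' (msub M q)) (mons n d.+2))).
    under eq_bigr => q _ do rewrite -sum1_count.
    rewrite (exchange_big_dep xpredT) //= -sum1_count big_mkcond leq_sum // => M _.
    case: ifP => // /hasP[q qn /and3P[Bq lq B'q]].
    by rewrite sum1_count -has_count; apply/hasP; exists q; rewrite ?Bq ?lq.
  rewrite -ct -sum_cond_const big_seq_cond [leqRHS]big_seq_cond leq_sum // => q /andP[qn _].
  rewrite -[d.+2]/(2 + d) (count_mul_mons d _ qn); apply: leq_trans cB'.
  rewrite leq_eqVlt; apply/orP; left; apply/eqP; apply: eq_in_count => m mn /=.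
  rewrite maddK //.
  by move: qn mn; rewrite !mem_mons => /andP[/eqP-> _] /andP[/eqP-> _].
have sz e m : m \in mons n e -> size m = n by rewrite mem_mons => /andP[/eqP].
(* For [m] in [D], no multiple [q * m] lies in [Z1]. *)
pose D m := has (fun q => ~~ B q && mle q m) (mons n 2).
have one q q' : q \in mons n 2 -> q' \in mons n 2 ->
    E1 <= \sum_(m <- mons n d | mle q' m) binmon (madd q m) q.
  (* Write [m = q' * m'] and drop [q'] from the first argument of the weight: what remains is a full
     sum over the [m'] of degree [d - 2], equal to [E1]. *)
  move=> qn q'n; rewrite -[in X in _ <= X](subnKC d1) (big_mul_mons _ _ q'n).
  have := @sum_binmon_mul n (d - 2) q; move: (qn); rewrite mem_mons.
  case/andP=> /eqP sq /eqP dq /(_ sq n0).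
  have -> : (n + sumn q + (d - 2)).-1 = (n + d).-1 by rewrite dq; lia.
  rewrite -/E1 => <-; rewrite big_seq_cond [leqRHS]big_seq_cond.
  apply: leq_sum => m /andP[mn _]; apply: leq_binmon.
  move: (sz _ _ mn) (sz _ _ q'n) => sm sq'.
  elim: (n) q q' m sq sq' sm {qn q'n mn dq} => [|k IH] [|a q] [|a' q'] [|c m] //=.
  by move=> [sq] [sq'] [sm]; rewrite leq_add2l leq_addl IH.
have leE q : q \in mons n 2 ->
    kap * t.+1 <= \sum_(m <- mons n d | D m) binmon (madd q m) q.
  (* The first alternative uses a single [q'] outside [B]. The second sums over all [t] of them, and
     a given [m] is then repeated at most ['C(d, 2)] times, once for each quadratic divisor outside
     [B]. *)
  move=> qn; case: hE => hE.
    have /hasP[q' q'n Bq'] : has (predC B) (mons n 2) by rewrite has_count ct.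
    apply: leq_trans hE (leq_trans (one q q' qn q'n) _).
    rewrite big_mkcond [leqRHS]big_mkcond leq_sum // => m _.
    case: ifP => // lq'; case: ifP => // /hasP[].
    by exists q' => //; rewrite lq' andbT.
  have dgt : 0 < 'C(d, 2) by rewrite bin_gt0.
  rewrite -(leq_pmul2r dgt); apply: leq_trans hE _.
  rewrite -ct -sum_cond_const big_distrl /=.
  apply: (@leq_trans (\sum_(q' <- mons n 2 | predC B q')
     \sum_(m <- mons n d | mle q' m) binmon (madd q m) q)).
    by rewrite big_seq_cond [leqRHS]big_seq_cond leq_sum // => q' /andP[? _]; exact: one.
  rewrite (exchange_big_dep xpredT) //=.
  rewrite [leqRHS]big_mkcond big_seq [leqRHS]big_seq leq_sum // => m mn.
  case: ifP => [_|/negbT/hasPn nD]; last first.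
    rewrite big1_seq // => q' /andP[/andP[Bq' lq'] q'n].
    by move: (nD _ q'n); rewrite Bq' lq'.
  rewrite sum_cond_const mulnC leq_mul2l; apply/orP; right.
  move: (mn); rewrite mem_mons => /andP[/eqP sm /eqP <-].
  rewrite -(sum_binmon_dvd 2 sm) -sum1_count big_mkcond leq_sum // => q' _.
  by case: ifP => // /andP[_ /binmon_gt0].
have tot q : q \in mons n 2 ->
    \sum_(m <- mons n d) binmon (madd q m) q = 'C((n + d).+1, d).
  move=> qn; have := qn; rewrite mem_mons => /andP[/eqP sq /eqP dq].
  by rewrite (sum_binmon_mul _ sq n0) dq addnAC addn2.
have leZ1 : kap * count Z1 (mons n d.+2) + count B (mons n 2) * (kap * t.+1) <=
    count B (mons n 2) * 'C((n + d).+1, d).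
  rewrite -!sum_cond_const -[X in _ <= X](@eq_bigr _ _ _ _ _ _ (fun=> 'C((n + d).+1, d))) //.
  rewrite mulnC -sum_cond_const.
  apply: (@leq_trans (\sum_(q <- mons n 2 | B q)
     \sum_(m <- mons n d | ~~ D m) binmon (madd q m) q + \sum_(q <- mons n 2 | B q) kap * t.+1)).
    rewrite leq_add2r.
    apply: (@leq_trans (\sum_(M <- mons n d.+2 | Z1 M) \sum_(q <- mons n 2 | B q)
      (if mle q M then binmon M q else 0))).
      rewrite big_seq_cond [leqRHS]big_seq_cond leq_sum // => M /andP[Mn /allP Z1M].
      have := Mn; rewrite mem_mons => /andP[/eqP sM /eqP dM].
      rewrite /kap -dM -(sum_binmon_dvd 2 sM) [leqRHS]big_mkcond.
      rewrite big_seq [leqRHS]big_seq leq_sum // => q qn.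
      case lq: (mle q M); last by rewrite binmon_eq0 ?lq // sM (sz _ _ qn).
      by move: (Z1M q qn); rewrite lq /= => ->.
    rewrite (exchange_big_dep xpredT) //= big_mkcond [leqRHS]big_mkcond /=.
    rewrite big_seq [leqRHS]big_seq leq_sum // => q qn; case Bq: (B q); last first.
      by rewrite big1 // => M; rewrite andbF.
    under eq_bigl => M do rewrite andbT.
    rewrite -big_mkcondr /= -[d.+2]/(2 + d).
    under eq_bigl => M do rewrite andbC.
    rewrite big_mkcondr (big_mul_mons _ _ qn) [leqRHS]big_mkcond.
    rewrite big_seq [leqRHS]big_seq leq_sum // => m mn.
    case: ifP => // /allP Z1m; case: ifP => // /negbFE /hasP[q' q'n /andP[Bq' lq']].
    have := Z1m q' q'n; rewrite (negbTE Bq') implybF (mle_trans lq') //.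
    by rewrite maddC mle_maddr // (sz _ _ mn) (sz _ _ qn).
  rewrite -big_split /= big_seq_cond [leqRHS]big_seq_cond leq_sum // => q /andP[qn _].
  rewrite -(tot q qn) [in leqRHS](bigID D) /= addnC leq_add2r.
  exact: leE.
(* This inequality allows [count B] to be replaced by its upper bound [b] in [leZ1]. *)
have kapC : kap * t.+1 <= 'C((n + d).+1, d).
  have /hasP[q qn _] : has (predC B) (mons n 2) by rewrite has_count ct.
  apply: leq_trans (leE q qn) _; rewrite -(tot q qn) big_mkcond leq_sum // => m _.
  by case: ifP.
move: cB leZ1 leZ kapC; set a := count B _; set C := 'C(_, d).
set z1 := count Z1 _; set z := count _ _ => cB h1 h2 h3.
have h4 : kap * z1 + b * (kap * t.+1) <= b * C by nia.
have h5 : kap * z <= kap * z1 + kap * (t * b) by rewrite -mulnDr leq_mul2l h2 orbT.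
apply: leq_trans h4; nia.
Qed.

(** * Compression *)

(* Every fibre of [A] over the monomials that agree up to exchanging powers of
   [x_i] and [x_(i+1)] is replaced by the fibre of the same size with the
   smallest exponents of [x_(i+1)]. *)
Fixpoint compress i (A : pred (seq nat)) (m : seq nat) : bool :=
  match i, m with
  | i'.+1, a :: t => compress i' (fun t' => A (a :: t')) t
  | 0, a :: b :: t => b < count (fun j => A [:: a + b - j, j & t]) (iota 0 (a + b).+1)
  | _, _ => A m
  end.

Fixpoint mshift i (m : seq nat) : seq nat :=
  match i, m with
  | i'.+1, a :: t => a :: mshift i' t
  | 0, a :: b :: t => [:: a.+1, b.-1 & t]
  | _, _ => m
  end.

(** The sum of [i * m_i] over the positions [i]. Compression never increases its total over a set,
    so it serves as the termination measure. *)
Fixpoint mweight (m : seq nat) : nat :=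
  if m is a :: t then sumn t + mweight t else 0.

Lemma sum_mons_head n e (F : seq nat -> nat) :
  \sum_(m <- mons n.+1 e) F m =
  \sum_(a < e.+1) \sum_(t <- mons n (e - a)) F (val a :: t).
Proof.
elim: e F => [|e IHe] F.
  by rewrite big_ord_recl big_ord0 !mons_deg0 !big_seq1 addn0.
rewrite monsS big_cat !big_map big_ord_recl /= IHe; congr addn.
Qed.

Lemma sum_mons_head2 n e (F : seq nat -> nat) :
  \sum_(m <- mons n.+2 e) F m =
  \sum_(s < e.+1) \sum_(t <- mons n (e - s)) \sum_(j < s.+1) F [:: s - j, val j & t].
Proof.
elim: e F => [|e IHe] F.
  by rewrite big_ord_recl big_ord0 !mons_deg0 !big_seq1 big_ord_recl big_ord0 !addn0.
rewrite monsS big_cat !big_map /= IHe sum_mons_head big_ord_recl [RHS]big_ord_recl /=.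
rewrite -addnA -big_split /=; congr addn.
  by apply: eq_bigr => t _; rewrite big_ord_recl big_ord0 addn0.
apply: eq_bigr => s _; rewrite !subSS -big_split /=; apply: eq_bigr => t _.
rewrite [RHS]big_ord_recr /= subnn addnC; congr addn.
by apply: eq_bigr => j _; rewrite subSn ?leq_ord.
Qed.

Lemma count_ltn_iota c s : c <= s -> count (fun j => j < c) (iota 0 s) = c.
Proof.
move=> cs; rewrite -(subnKC cs) iotaD count_cat add0n.
rewrite [X in _ + X](_ : _ = 0) ?addn0; last first.
  by apply/eqP; rewrite -leqn0 leqNgt -has_count; apply/hasPn => j; rewrite mem_iota; lia.
rewrite -[RHS](size_iota 0 c); apply/eqP; rewrite -all_count.
by apply/allP => j; rewrite mem_iota; lia.
Qed.

Lemma count_iota_ord (f : nat -> bool) s :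
  count f (iota 0 s) = \sum_(j < s) f j.
Proof.
rewrite -(big_mkord xpredT (fun j => f j : nat)) /index_iota subn0.
by rewrite -sum1_count big_mkcond.
Qed.

Lemma count_le_iota (f : nat -> bool) s : count f (iota 0 s) <= s.
Proof. by rewrite -[leqRHS](size_iota 0 s) count_size. Qed.

Lemma sum_nat_count (T : eqType) (s : seq T) (P : pred T) :
  \sum_(x <- s) (P x : nat) = count P s.
Proof. by rewrite -sum1_count [RHS]big_mkcond. Qed.

Lemma compress_fiber A s j t : j <= s ->
  compress 0 A [:: s - j, j & t] =
  (j < count (fun j => A [:: s - j, j & t]) (iota 0 s.+1)).
Proof. by move=> js; rewrite /= subnK. Qed.

Lemma count_compress i n e A : count (compress i A) (mons n e) = count A (mons n e).
Proof.
rewrite -!sum_nat_count; elim: i n e A => [|i IHi] [|n] e A //.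
- by case: e => [|e]; rewrite ?mons_deg0 ?big_seq1 // mons_var0 !big_nil.
- case: n => [|n]; first by apply: eq_big_seq => -[|a [|b t]]; rewrite ?mem_mons.
  rewrite !sum_mons_head2; apply: eq_bigr => s _; apply: eq_bigr => t _.
  under eq_bigr => j _ do rewrite (compress_fiber _ _ (leq_ord j)).
  set c := count _ _; rewrite -[RHS](count_iota_ord (fun j => A [:: s - j, j & t])).
  rewrite -(count_iota_ord (fun j => j < c)) count_ltn_iota //.
  exact: count_le_iota.
- by case: e => [|e]; rewrite ?mons_deg0 ?big_seq1 // mons_var0 !big_nil.
rewrite !sum_mons_head; apply: eq_bigr => a _.
by have /= := IHi n (e - a) (fun t => A (val a :: t)).
Qed.

Lemma compress_inv i A m : compress i A m ->
  exists m', [/\ A m', size m' = size m & sumn m' = sumn m].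
Proof.
elim: i A m => [|i IHi] A [|a m] /=; try by exists [::].
  case: m => [|b t]; first by exists [:: a].
  move=> lt; have /hasP[j] : has (fun j => A [:: a + b - j, j & t]) (iota 0 (a + b).+1).
    by rewrite has_count (leq_trans _ lt).
  rewrite mem_iota => jab Aj; exists [:: a + b - j, j & t]; split => //=.
  by lia.
by case/IHi => m' [Am' sm' dm']; exists (a :: m'); rewrite /= sm' dm'.
Qed.

(* A form of [|A + B| >= |A| + |B| - 1] for sets of integers; it makes
   compression compatible with products of monomials. *)
Lemma count_sumset (f g h : nat -> bool) s1 s2 b1 b2 :
  (forall j1 j2, j1 <= s1 -> j2 <= s2 -> f j1 -> g j2 -> h (j1 + j2)) ->
  b1 < count f (iota 0 s1.+1) -> b2 < count g (iota 0 s2.+1) ->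
  b1 + b2 < count h (iota 0 (s1 + s2).+1).
Proof.
move=> fgh; rewrite -!size_filter.
set sA := filter f _; set sB := filter g _; set sC := filter h _ => hA hB.
have memA j : (j \in sA) = f j && (j <= s1) by rewrite mem_filter mem_iota.
have memB j : (j \in sB) = g j && (j <= s2) by rewrite mem_filter mem_iota.
have memC j : (j \in sC) = h j && (j <= s1 + s2) by rewrite mem_filter mem_iota.
have exA : exists j, j \in sA by case: (sA) hA => // j ? _; exists j; rewrite mem_head.
have exB : exists j, j \in sB by case: (sB) hB => // j ? _; exists j; rewrite mem_head.
have bA j : j \in sA -> j <= s1 by rewrite memA => /andP[].
case: (ex_maxnP exA bA) => a1 a1A maxA; case: (ex_minnP exB) => b0 b0B minB.
(* With [a1] the maximum of [sA] and [b0] the minimum of [sB], the translates [sA + b0] and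
   [a1 + sB] meet only in [a1 + b0]. Dropping it once leaves [|sA| + |sB| - 1] distinct sums. *)
pose L := [seq a + b0 | a <- sA] ++ [seq a1 + b | b <- rem b0 sB].
have uB : uniq sB by rewrite filter_uniq ?iota_uniq.
have uL : uniq L.
  rewrite cat_uniq !map_inj_uniq ?rem_uniq ?filter_uniq ?iota_uniq //; last first.
  - by move=> x y; lia.
  - by move=> x y; lia.
  rewrite andbT; apply/hasPn => x /mapP[b]; rewrite mem_rem_uniq // inE => /andP[/= bb bB] ->.
  apply/mapP => -[a aA]; have := maxA a aA; have := minB b bB; lia.
have sub : {subset L <= sC}.
  move=> x; rewrite mem_cat => /orP[] /mapP[y].
    rewrite memA => /andP[fy ys] ->; move: b0B; rewrite memB => /andP[gb bs].
    by rewrite memC fgh //=; lia.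
  rewrite mem_rem_uniq // inE => /andP[_]; rewrite memB => /andP[gy ys] ->.
  move: a1A; rewrite memA => /andP[fa as1].
  by rewrite memC fgh //=; lia.
have := uniq_leq_size uL sub; rewrite size_cat !size_map size_rem //.
by move: hA hB; move: (size sA) (size sB) (size sC) => x y z; lia.
Qed.

(** In each pair of fibres, the exponents of [x_(i+1)] occurring in [D] contain the sumset of those
    in [A] and [B], so [count_sumset] compares the initial segments that replace them. *)
Lemma compress_madd i (A B D : pred (seq nat)) q m : size q = size m ->
  (forall q m, size q = size m -> A q -> B m -> D (madd q m)) ->
  compress i A q -> compress i B m -> compress i D (madd q m).
Proof.
move=> + h; elim: i A B D q m h => [|i IHi] A B D [|a q] [|c m] h //;
  try exact: (h [::] [::]).
  case: q m => [|b q] [|b' m] // => [_|[sqm]]; first exact: (h [:: a] [:: c]).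
  rewrite /compress /madd -/madd.
  have -> : a + c + (b + b') = a + b + (c + b') by lia.
  apply: count_sumset => j1 j2 js1 js2 Aj Bj.
  have := h _ _ _ Aj Bj; rewrite /= sqm => /(_ erefl).
  by have -> : a + b - j1 + (c + b' - j2) = a + b + (c + b') - (j1 + j2) by lia.
move=> [sqm]; apply: IHi => // q' m' sz Aq Bm.
by have := h (a :: q') (c :: m'); rewrite /= sz; apply.
Qed.

Lemma sum_ltn_ord c s : c <= s -> \sum_(j < s) (j < c) * j = \sum_(j < c) j.
Proof.
move=> cs; rewrite (big_ord_widen _ (fun j => j) cs) [RHS]big_mkcond.
by apply: eq_bigr => j _; case: ifP; rewrite ?mul1n ?mul0n.
Qed.

Lemma count_iotaS (f : nat -> bool) s :
  count f (iota 0 s.+1) = count f (iota 0 s) + f s.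
Proof. by rewrite -addn1 iotaD count_cat /= addn0. Qed.

(** Among sets of natural numbers of a given size, the initial segment has the smallest sum. The
    next lemma makes this strict when there is a hole just below an element. *)
Lemma sum_prefix_le (f : nat -> bool) s :
  \sum_(j < count f (iota 0 s)) j <= \sum_(j < s) f j * j.
Proof.
elim: s => [|s IHs]; first by rewrite !big_ord0.
rewrite count_iotaS [leqRHS]big_ord_recr /=.
case: (f s); rewrite ?addn0 ?mul0n ?addn0 // addn1 big_ord_recr /= mul1n leq_add //.
exact: count_le_iota.
Qed.

Lemma sum_prefix_lt (f : nat -> bool) s k : k.+1 < s -> ~~ f k -> f k.+1 ->
  \sum_(j < count f (iota 0 s)) j < \sum_(j < s) f j * j.
Proof.
move=> + nfk fk; elim: s => // s IHs; rewrite ltnS leq_eqVlt => /orP[/eqP <-|/IHs lt].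
  have ck : count f (iota 0 k.+1) <= k.
    by rewrite count_iotaS (negbTE nfk) addn0 count_le_iota.
  have lek := sum_prefix_le f k.+1; rewrite count_iotaS.
  move: (count f _) ck lek => c ck lek; rewrite fk addn1 big_ord_recr [ltnRHS]big_ord_recr.
  by rewrite fk mul1n /= -addnS leq_add.
rewrite count_iotaS [ltnRHS]big_ord_recr /=.
case: (f s); rewrite ?addn0 ?mul0n ?addn0 // addn1 big_ord_recr /= mul1n -addSn leq_add //.
exact: count_le_iota.
Qed.

(** Strong stability in degree [e], stated for exchanges of adjacent variables; these are what one
    compression controls. *)
Definition mstable n e i (A : pred (seq nat)) :=
  forall q, q \in mons n e -> i.+1 < n -> A q -> 0 < nth 0 q i.+1 -> A (mshift i q).

Definition mweights n e (A : pred (seq nat)) := \sum_(m <- mons n e) A m * mweight m.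

Lemma mweights_head n e (A : pred (seq nat)) :
  mweights n.+1 e A =
  \sum_(a < e.+1) ((e - a) * count (fun t => A (val a :: t)) (mons n (e - a))
     + mweights n (e - a) (fun t => A (val a :: t))).
Proof.
rewrite /mweights sum_mons_head; apply: eq_bigr => a _.
rewrite -sum_nat_count big_distrr -big_split /=; apply: eq_big_seq => t.
by rewrite mem_mons => /andP[_ /eqP->]; rewrite mulnDr [(e - a) * _]mulnC.
Qed.

Lemma mweights_head2 n e (A : pred (seq nat)) :
  mweights n.+2 e A =
  \sum_(s < e.+1) \sum_(t <- mons n (e - s))
    (count (fun j => A [:: s - j, j & t]) (iota 0 s.+1) * (sumn t + sumn t + mweight t)
      + \sum_(j < s.+1) A [:: s - j, val j & t] * j).
Proof.
rewrite /mweights sum_mons_head2; apply: eq_bigr => s _; apply: eq_bigr => t _.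
rewrite count_iota_ord big_distrl -big_split /=; apply: eq_bigr => j _.
by rewrite -mulnDr; congr (_ * _); lia.
Qed.

Lemma sum_compress_fiber A s t :
  \sum_(j < s.+1) compress 0 A [:: s - j, val j & t] * j =
  \sum_(j < count (fun j => A [:: s - j, j & t]) (iota 0 s.+1)) j.
Proof.
rewrite -[RHS](@sum_ltn_ord _ s.+1) ?count_le_iota //.
by apply: eq_bigr => j _; rewrite (compress_fiber _ _ (leq_ord j)).
Qed.

Lemma count_compress_fiber A s t :
  count (fun j => compress 0 A [:: s - j, j & t]) (iota 0 s.+1) =
  count (fun j => A [:: s - j, j & t]) (iota 0 s.+1).
Proof.
rewrite -[RHS](@count_ltn_iota _ s.+1) ?count_le_iota //.
by apply: eq_in_count => j; rewrite mem_iota => js; rewrite compress_fiber.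
Qed.

Lemma mweights_compress i n e A : mweights n e (compress i A) <= mweights n e A.
Proof.
elim: i n e A => [|i IHi] [|n] e A.
- by rewrite leq_eqVlt; apply/orP; left; apply/eqP; apply: eq_big_seq => -[|a t]; rewrite ?mem_mons.
- case: n => [|n].
    rewrite leq_eqVlt; apply/orP; left; apply/eqP.
    by apply: eq_big_seq => -[|a [|b t]]; rewrite ?mem_mons.
  rewrite !mweights_head2 leq_sum // => s _; rewrite leq_sum // => t _.
  by rewrite count_compress_fiber sum_compress_fiber leq_add2l sum_prefix_le.
- by rewrite leq_eqVlt; apply/orP; left; apply/eqP; apply: eq_big_seq => -[|a t]; rewrite ?mem_mons.
rewrite !mweights_head leq_sum // => a _.
by rewrite (count_compress i _ _ (fun t => A (val a :: t))) leq_add2l IHi.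
Qed.

Lemma ltn_sum_seq (T : eqType) (s : seq T) (F G : T -> nat) x :
  x \in s -> (forall y, F y <= G y) -> F x < G x ->
  \sum_(y <- s) F y < \sum_(y <- s) G y.
Proof.
move=> xs leFG ltx; rewrite (big_rem x xs) [ltnRHS](big_rem x xs) /= -addSn.
by rewrite leq_add // leq_sum.
Qed.

(** A failure of stability at [q] is a hole in the fibre of [q] directly below the exponent of
    [x_(i+1)] in [q], so this fibre is not an initial segment. *)
Lemma mweights_compress_lt i n e (A : pred (seq nat)) q :
  q \in mons n e -> i.+1 < n -> A q -> 0 < nth 0 q i.+1 -> ~~ A (mshift i q) ->
  mweights n e (compress i A) < mweights n e A.
Proof.
elim: i n e A q => [|i IHi] [|n] e A q //.
  case: n => // n; case: q => [|a [|[|b] t]]; rewrite ?mem_mons //= => qn _ Aq _ nA.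
  rewrite !mweights_head2.
  pose s := a + b.+1; have se : s < e.+1 by move: qn => /andP[_ /eqP]; rewrite /s; lia.
  apply: (@ltn_sum_seq _ _ _ _ (Ordinal se)); first exact: mem_index_enum.
    move=> s'; rewrite leq_sum // => t' _.
    by rewrite count_compress_fiber sum_compress_fiber leq_add2l sum_prefix_le.
  apply: (@ltn_sum_seq _ _ _ _ t); cbv beta.
  - rewrite mem_mons /=; move: qn => /andP[/eqP[-> ] /eqP <-].
    by rewrite eqxx /s /=; apply/eqP; lia.
  - move=> t'.
    by rewrite count_compress_fiber sum_compress_fiber leq_add2l sum_prefix_le.
  rewrite count_compress_fiber sum_compress_fiber ltn_add2l.
  apply: (@sum_prefix_lt (fun j => A [:: s - j, j & t]) s.+1 b); first by rewrite /s; lia.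
    by have -> : s - b = a.+1 by rewrite /s; lia.
  by have -> : s - b.+1 = a by rewrite /s; lia.
case: q => [|a t]; rewrite mem_mons //= => /andP[/eqP[st] /eqP dt] ltn At ti nA.
have ae : a < e.+1 by lia.
rewrite !mweights_head; apply: (@ltn_sum_seq _ _ _ _ (Ordinal ae)); first exact: mem_index_enum.
  by move=> b; rewrite (count_compress i _ _ (fun t => A (val b :: t))) leq_add2l mweights_compress.
rewrite (count_compress i _ _ (fun t => A (a :: t))) ltn_add2l /=.
apply: (IHi n (e - a) (fun t => A (a :: t)) t) => //.
by rewrite mem_mons st eqxx /=; apply/eqP; lia.
Qed.

Lemma compress_mons i n e (A : pred (seq nat)) : (forall m, A m -> m \in mons n e) ->
  forall m, compress i A m -> m \in mons n e.
Proof.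
move=> An m /compress_inv[m' [/An]]; rewrite !mem_mons => /andP[sm dm] <- <-.
by rewrite sm dm.
Qed.

Lemma eq_mweights n e (A A' : pred (seq nat)) :
  {in mons n e, A =1 A'} -> mweights n e A = mweights n e A'.
Proof. by move=> eqA; apply: eq_big_seq => m mn; rewrite eqA. Qed.

(** Induction on the total weight of the two complements. Both are compressed at an index where
    stability fails for one of them. The non-free monomials are the products of the two complements,
    so by [compress_madd] the new ones lie in the compression of the old ones and their number does
    not increase. *)
Lemma exists_stable n j d (B B' : pred (seq nat)) :
  exists C C' : pred (seq nat),
  [/\ count C (mons n j) = count B (mons n j),
      count C' (mons n d) = count B' (mons n d),
      count (free_mon n j B B') (mons n (j + d)) <=
        count (free_mon n j C C') (mons n (j + d)),
      (forall i, mstable n j i (predC C)) & (forall i, mstable n d i (predC C'))].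
Proof.
have [w] := ubnP (mweights n j (predC B) + mweights n d (predC B')).
elim: w B B' => // w IHw B B'; rewrite ltnS => lew.
case: (boolP (all (fun i => all (fun q =>
   [&& ~~ B q & 0 < nth 0 q i.+1] ==> ~~ B (mshift i q)) (mons n j)
   && all (fun q => [&& ~~ B' q & 0 < nth 0 q i.+1] ==> ~~ B' (mshift i q)) (mons n d)) (iota 0 n.-1))).
  move=> /allP st; exists B, B'; split=> // i q qn lti Bq qi;
    have /st/andP[/allP s1 /allP s2] : i \in iota 0 n.-1 by rewrite mem_iota; lia.
    by have := s1 q qn; rewrite qi andbT; move: Bq => /= ->.
  by have := s2 q qn; rewrite qi andbT; move: Bq => /= ->.
case/allPn => i; rewrite mem_iota => lti; rewrite negb_and => viol.
pose A := fun q => (q \in mons n j) && ~~ B q.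
pose A' := fun q => (q \in mons n d) && ~~ B' q.
pose D M := ~~ free_mon n j B B' M.
have AD q m : size q = size m -> A q -> A' m -> D (madd q m).
  move=> sz /andP[qn Bq] /andP[mn Bm]; apply/allPn; exists q => //.
  by rewrite mle_maddr // maddK // (negbTE Bq) (negbTE Bm).
pose C := predC (compress i A); pose C' := predC (compress i A').
have Cn m : compress i A m -> m \in mons n j by apply: compress_mons => q /andP[].
have C'n m : compress i A' m -> m \in mons n d by apply: compress_mons => q /andP[].
have cC : count C (mons n j) = count B (mons n j).
  have := count_predC (compress i A) (mons n j); rewrite count_compress.
  rewrite -(count_predC B (mons n j)) addnC => /eqP.
  rewrite (@eq_in_count _ A (predC B)) ?eqn_add2r; first by move/eqP.
  by move=> q qn; rewrite /A qn.
have cC' : count C' (mons n d) = count B' (mons n d).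
  have := count_predC (compress i A') (mons n d); rewrite count_compress.
  rewrite -(count_predC B' (mons n d)) addnC => /eqP.
  rewrite (@eq_in_count _ A' (predC B')) ?eqn_add2r; first by move/eqP.
  by move=> q qn; rewrite /A' qn.
have leF : count (free_mon n j B B') (mons n (j + d)) <=
        count (free_mon n j C C') (mons n (j + d)).
  have : count (predC (free_mon n j C C')) (mons n (j + d)) <=
    count (compress i D) (mons n (j + d)).
    rewrite -!size_filter; apply: uniq_leq_size; rewrite ?filter_uniq ?mons_uniq // => M.
    rewrite !mem_filter /= => /andP[/allPn[q qn +] Mn]; rewrite Mn andbT.
    rewrite negb_imply negb_or !negbK => /andP[lq /andP[Cq C'm]].
    rewrite -(msubK lq); apply: (compress_madd _ AD Cq C'm).
    have := C'n _ C'm; have := Cn _ Cq; rewrite !mem_mons.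
    by move=> /andP[/eqP-> _] /andP[/eqP-> _].
  rewrite count_compress.
  have -> : count D (mons n (j + d)) = count (predC (free_mon n j B B')) (mons n (j + d)) by [].
  have := count_predC (free_mon n j C C') (mons n (j + d)).
  have := count_predC (free_mon n j B B') (mons n (j + d)).
  lia.
have /IHw[E [E' [cE cE' leE sE sE']]] : mweights n j (predC C) + mweights n d (predC C') < w.
  have eqC : mweights n j (predC C) = mweights n j (compress i A).
    by apply: eq_mweights => m mn; rewrite /= negbK.
  have eqC' : mweights n d (predC C') = mweights n d (compress i A').
    by apply: eq_mweights => m mn; rewrite /= negbK.
  have eqA : mweights n j A = mweights n j (predC B).
    by apply: eq_mweights => m mn; rewrite /A /= mn.
  have eqA' : mweights n d A' = mweights n d (predC B').
    by apply: eq_mweights => m mn; rewrite /A' /= mn.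
  rewrite eqC eqC'; apply: leq_trans lew; rewrite -eqA -eqA'.
  case/orP: viol => /allPn[q qn]; rewrite negb_imply negbK => /andP[/andP[Bq qi] Bs].
    have lt : mweights n j (compress i A) < mweights n j A.
      apply: (mweights_compress_lt qn) => //; first by lia.
        by rewrite /A qn.
      by rewrite /A Bs andbF.
    by have := mweights_compress i n d A'; lia.
  have lt : mweights n d (compress i A') < mweights n d A'.
    apply: (mweights_compress_lt qn) => //; first by lia.
      by rewrite /A' qn.
    by rewrite /A' Bs andbF.
  by have := mweights_compress i n j A; lia.
exists E, E'; split=> //; [by rewrite cE | by rewrite cE' | exact: leq_trans leF leE].
Qed.

(** * Removing a variable *)

Definition mvar n i : seq nat := incr_nth (nseq n 0) i.

Definition avoids k (m : seq nat) : bool := sumn (take k m) == 0.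

Lemma size_mvar n i : i < n -> size (mvar n i) = n.
Proof. by move=> lt; rewrite size_incr_nth size_nseq lt. Qed.

Lemma sumn_mvar n i : i < n -> sumn (mvar n i) = 1.
Proof.
elim: n i => // n IH [|i] lti; last by rewrite /mvar /= IH.
by rewrite /mvar /= sumn_nseq mul0n.
Qed.

Lemma mvar_mons n i : i < n -> mvar n i \in mons n 1.
Proof.
by move=> lt; rewrite mem_mons size_mvar // sumn_mvar // !eqxx.
Qed.

Lemma nth_mvar n i w : nth 0 (mvar n i) w = (i == w).
Proof. by rewrite nth_incr_nth nth_nseq if_same addn0. Qed.

Lemma leq_nth_sumn q i : nth 0 q i <= sumn q.
Proof. by elim: q i => [|a q IH] [|i] //=; [rewrite leq_addr|have := IH i; lia]. Qed.

Lemma mons1P n q : q \in mons n 1 -> exists2 i, i < n & q = mvar n i.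
Proof.
rewrite mem_mons => /andP[/eqP sq /eqP dq].
have : exists2 i, i < size q & 0 < nth 0 q i.
  elim: q {sq} dq => //= -[|a] q IH; last by exists 0.
  by rewrite add0n => /IH[i lt qi]; exists i.+1.
rewrite sq => -[i lti qi]; exists i => //.
apply: (@eq_from_nth _ 0); rewrite ?size_mvar // sq => w ltw; rewrite nth_mvar.
rewrite -sq in lti ltw; elim: q i w lti ltw qi dq {sq} => //= a q IH [|i] [|w] //=.
- by case: a => [|[|a]].
- by move=> _ _ a0 dq; have := leq_nth_sumn q w; lia.
- by move=> _ _ qi dq; have := leq_nth_sumn q i; lia.
move=> lti ltw qi dq; rewrite eqSS; apply: (IH i w) => //.
by have := leq_nth_sumn q i; lia.
Qed.

Lemma mle_mvar n i M : size M = n -> i < n -> mle (mvar n i) M = (0 < nth 0 M i).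
Proof.
elim: n i M => [|n IH] [|i] [|a M] //= [sM] lti; last exact: IH.
rewrite /mvar /= andbC; have -> // : mle (nseq n 0) M.
by rewrite -sM; elim: (M) => //= c M' ->.
Qed.

Lemma mshift_mvar n i m : size m = n -> i.+1 < n ->
  mshift i (madd (mvar n i.+1) m) = madd (mvar n i) m.
Proof.
elim: n i m => [|n IH] [|i] [|a m] //= [sm] lti; last by rewrite /mvar /= IH.
by case: n m sm lti {IH} => [|n] [|c m] //= [sm] _; rewrite add0n.
Qed.

Lemma sumn_take_nth k m : sumn (take k m) = \sum_(w < k) nth 0 m w.
Proof.
elim: k m => [|k IH] m; first by rewrite take0 big_ord0.
case: m => [|a m]; last by rewrite big_ord_recl /= IH.
by rewrite big1 // => i _; rewrite nth_nil.
Qed.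

Lemma count_mons_head n e (P : pred (seq nat)) :
  count P (mons n.+1 e) = \sum_(a < e.+1) count (fun t => P (val a :: t)) (mons n (e - a)).
Proof.
rewrite -sum_nat_count sum_mons_head; apply: eq_bigr => a _.
by rewrite sum_nat_count.
Qed.

Lemma count_avoids k n e : k <= n -> count (avoids k) (mons n e) = size (mons (n - k) e).
Proof.
elim: k n => [|k IHk] [|n] //.
- by move=> _; rewrite -count_predT; apply: eq_count => m; rewrite /avoids take0.
- by move=> _; rewrite -count_predT; apply: eq_count => m; rewrite /avoids take0.
move=> kn; rewrite count_mons_head big_ord_recl /= subn0 -IHk // [X in _ + X]big1 ?addn0 //.
by move=> a _; rewrite /avoids /= -[RHS](count_pred0 (mons n (e - a.+1))).
Qed.

Lemma size_mons_sum n e : size (mons n.+1 e) = \sum_(a < e.+1) size (mons n (e - a)).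
Proof. by rewrite -count_predT count_mons_head; apply: eq_bigr => a _; rewrite count_predT. Qed.

Lemma count_drop k n e : k <= n ->
  count (fun m => sumn (drop k m) == 0) (mons n e) = size (mons k e).
Proof.
elim: k n e => [|k IHk] n e.
  move=> _; case: e => [|e].
    by rewrite mons_deg0 /= drop0 sumn_nseq mul0n.
  rewrite mons_var0; apply/eqP; rewrite -leqn0 leqNgt -has_count; apply/hasPn => m.
  by rewrite mem_mons drop0 => /andP[_ /eqP->].
case: n => // n kn; rewrite size_mons_sum count_mons_head.
by apply: eq_bigr => a _; rewrite -(IHk n).
Qed.

(* A free monomial [M] whose degree in the first [k] variables is [h > 0] is
   charged with weight [M_w] to its divisor [M / x_w], for each [w < k]. *)
Lemma star_layer n d k h (B : pred (seq nat)) : k <= n ->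
  h.+1 * count (fun M => (sumn (take k M) == h.+1) && free_mon n 1 (avoids k) B M) (mons n d.+1)
    <= (h + k) * count (fun m => (sumn (take k m) == h) && B m) (mons n d).
Proof.
move=> kn; set S := fun M => _ && free_mon _ _ _ _ _; set T := fun m => _ && B m.
rewrite mulnC -sum_cond_const mulnC -sum_cond_const.
have -> : \sum_(M <- mons n d.+1 | S M) h.+1 =
    \sum_(M <- mons n d.+1 | S M) \sum_(w < k) nth 0 M w.
  by apply: eq_bigr => M /andP[/eqP <- _]; rewrite sumn_take_nth.
rewrite exchange_big /=.
have -> : \sum_(m <- mons n d | T m) (h + k) =
    \sum_(m <- mons n d | T m) \sum_(w < k) (nth 0 m w).+1.
  apply: eq_bigr => m /andP[/eqP <- _].
  under [RHS]eq_bigr => w _ do rewrite -addn1.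
  by rewrite big_split /= -sumn_take_nth sum1_card card_ord.
rewrite [leqRHS]exchange_big leq_sum // => w _.
have wn : w < n := leq_trans (ltn_ord w) kn.
rewrite -[d.+1]/(1 + d) [leqLHS](bigID (mle (mvar n w))) /=.
rewrite [X in _ + X <= _]big1_seq ?addn0; last first.
  move=> M; rewrite mem_mons => /andP[/andP[_ nle] /andP[/eqP sM _]].
  by move: nle; rewrite mle_mvar // lt0n negbK => /eqP.
under eq_bigl => M do rewrite andbC.
rewrite big_mkcondr (big_mul_mons _ _ (mvar_mons wn)) [leqRHS]big_mkcond.
rewrite big_seq [leqRHS]big_seq leq_sum // => m.
rewrite mem_mons => /andP[/eqP sm _]; have sv := size_mvar wn.
rewrite /S; case: ifP => // /andP[/eqP hM fM].
have e1 : sumn (take k (madd (mvar n w) m)) = (sumn (take k m)).+1.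
  rewrite !sumn_take_nth; under eq_bigr => i _ do rewrite nth_madd ?sv ?sm // nth_mvar.
  rewrite big_split /= (bigD1 w) //= eqxx big1 ?addn0 // => i /negbTE.
  by rewrite eq_sym -val_eqE /= => ->.
have Bm : B m.
  move/allP: fM => /(_ _ (mvar_mons wn)); rewrite mle_maddr ?sv // maddK ?sv //=.
  case/orP => //; rewrite /avoids sumn_take_nth (bigD1 w) //= nth_mvar eqxx.
  by [].
rewrite /T Bm andbT; move: hM; rewrite e1 => -[->]; rewrite eqxx.
by rewrite nth_madd ?sv // nth_mvar eqxx.
Qed.

Lemma count_fibers (T : eqType) (s : seq T) (P : pred T) (f : T -> nat) N :
  (forall x, x \in s -> f x < N) ->
  count P s = \sum_(h < N) count (fun x => (f x == h) && P x) s.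
Proof.
move=> fN; under eq_bigr => h _ do rewrite -sum_nat_count.
rewrite exchange_big -sum_nat_count /=; apply: eq_big_seq => x xs.
rewrite (bigD1 (Ordinal (fN x xs))) //= eqxx big1 ?addn0 // => h.
by rewrite -val_eqE /= eq_sym => /negbTE ->.
Qed.

Lemma leq_sumn_take k m : sumn (take k m) <= sumn m.
Proof. by rewrite -{2}(cat_take_drop k m) sumn_cat leq_addr. Qed.

(** The predicate [avoids k] holds of the variables [x_w] with [k <= w], so only quotients by the
    first [k] variables are constrained here. *)
Definition star n d k (B : pred (seq nat)) :=
  count (free_mon n 1 (avoids k) B) (mons n d.+1).

Section Star.
Variables (n d k : nat) (B : pred (seq nat)) (b : nat).
Hypotheses (kn : k <= n) (k0 : 0 < k) (cB : count B (mons n d) <= b).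

Let s h := count (fun M => (sumn (take k M) == h) && free_mon n 1 (avoids k) B M) (mons n d.+1).
Let c h := count (fun m => (sumn (take k m) == h) && B m) (mons n d).

Let layer h : h.+1 * s h.+1 <= (h + k) * c h.
Proof. exact: star_layer. Qed.

Let starE : star n d k B = s 0 + \sum_(h < d.+1) s h.+1.
Proof.
rewrite /star (@count_fibers _ _ _ (fun M => sumn (take k M)) d.+2).
  by rewrite big_ord_recl.
move=> M; rewrite mem_mons => /andP[_ /eqP dM].
by rewrite ltnS -dM leq_sumn_take.
Qed.

Let sum_c : \sum_(h < d.+1) c h <= b.
Proof.
apply: leq_trans cB; rewrite (@count_fibers _ _ B (fun M => sumn (take k M)) d.+1) //.
move=> M; rewrite mem_mons => /andP[_ /eqP dM].
by rewrite ltnS -dM leq_sumn_take.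
Qed.

Let s0_le : s 0 <= size (mons (n - k) d.+1).
Proof. by rewrite -(count_avoids _ kn); apply: sub_count => M /= /andP[]. Qed.

Let c0_le : c 0 <= size (mons (n - k) d).
Proof. by rewrite -(count_avoids _ kn); apply: sub_count => M /= /andP[]. Qed.

(** In every layer the factor [(h + k) / (h + 1)] is at most [k]. *)
Lemma star_le1 : star n d k B <= size (mons (n - k) d.+1) + k * b.
Proof.
rewrite starE leq_add //; apply: (@leq_trans (k * \sum_(h < d.+1) c h)).
  rewrite big_distrr leq_sum // => h _ /=.
  by rewrite -(leq_pmul2l (ltn0Sn h)); apply: leq_trans (layer h) _; nia.
by rewrite leq_mul2l sum_c orbT.
Qed.

(** For [h >= 1] the factor [(h + k) / (h + 1)] is at most [(k + 1) / 2]. The layer [h = 0] has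
    factor [k]; the excess [(k - 1) / 2] is paid for by the bound on [c 0]. *)
Lemma star_le2 : 2 * star n d k B <=
  2 * size (mons (n - k) d.+1) + size (mons (n - k) d) * k.-1 + k.+1 * b.
Proof.
rewrite starE mulnDr -addnA leq_add ?leq_mul2l ?s0_le //.
apply: (@leq_trans (size (mons (n - k) d) * k.-1 + k.+1 * \sum_(h < d.+1) c h)); last first.
  by rewrite leq_add2l leq_mul2l sum_c orbT.
rewrite big_ord_recl [in leqRHS]big_ord_recl !mulnDr addnA leq_add //.
  have := layer 0; have := c0_le; rewrite -[nat_of_ord ord0]/0 add0n mul1n.
  by move: (s 1) (c 0) (size _) => x y z; case: (k) k0 => // p _; nia.
rewrite !big_distrr leq_sum // => h _.
rewrite -(leq_pmul2l (ltn0Sn (lift ord0 h))) /=.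
have := layer (lift ord0 h); rewrite lift0; move: (s _) (c _) => x y.
by rewrite /bump; case: (k) k0 => // p _; nia.
Qed.

(** When [k = n] only the top layer is occupied, with factor [(d + n) / (d + 1)]. *)
Lemma star_le_full : k = n -> d.+1 * star n d k B <= (n + d) * b.
Proof.
move=> kE; have := layer d; rewrite kE addnC => lay.
have -> : star n d n B = s d.+1.
  apply: eq_in_count => M; rewrite mem_mons kE => /andP[/eqP sM /eqP dM].
  by rewrite take_oversize ?sM // dM eqxx.
by apply: leq_trans lay _; rewrite leq_mul2l (leq_trans _ cB) ?orbT // sub_count // => m /andP[].
Qed.

End Star.

Lemma mons2P n q : q \in mons n 2 ->
  exists i j, [/\ i < n, j < n & q = madd (mvar n i) (mvar n j)].
Proof.
move=> qn; have := qn; rewrite mem_mons => /andP[/eqP sq /eqP dq].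
have [|p pn lp] := @mons_le n 1 q _ sq; first by rewrite dq.
have [i lti pE] := mons1P pn; exists i.
have /mons1P[j ltj sE] := @msub_mons n 1 1 p q pn qn lp.
by exists j; split=> //; rewrite -sE -pE msubK.
Qed.

Lemma madd_mvar_mons n i j : i < n -> j < n -> madd (mvar n i) (mvar n j) \in mons n 2.
Proof. by move=> lti ltj; apply: (@madd_mons n 1 1); apply: mvar_mons. Qed.

Lemma sumn_drop_eq0 n k m : size m = n ->
  (forall w, k <= w -> w < n -> nth 0 m w = 0) -> sumn (drop k m) = 0.
Proof.
move=> sm h; suff /all_pred1P -> : all (pred1 0) (drop k m) by rewrite sumn_nseq mul0n.
apply/allP => x /(nthP 0)[i].
by rewrite size_drop sm nth_drop => lt <-; rewrite /= h //; lia.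
Qed.

Section Stable.
Variables (n : nat) (B : pred (seq nat)).
Hypothesis stB : forall i, mstable n.+1 2 i (predC B).

Let shift_down i j : i < n.+1 -> j < n.+1 ->
  ~~ B (madd (mvar n.+1 i) (mvar n.+1 j)) -> ~~ B (madd (mvar n.+1 0) (mvar n.+1 j)).
Proof.
elim: i => // i IH lti ltj nB; apply: IH => //; first by lia.
have := stB (i := i) (madd_mvar_mons lti ltj) lti nB.
rewrite nth_madd ?size_mvar // nth_mvar eqxx add1n => /(_ isT).
by rewrite mshift_mvar ?size_mvar.
Qed.

(* For stable [predC B], the variables [x_w] such that [x_0 * x_w] is outside
   [B] are those with [w < star_size]. *)
Definition star_size := find (fun w => B (madd (mvar n.+1 0) (mvar n.+1 w))) (iota 0 n.+1).

Lemma star_size_le : star_size <= n.+1.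
Proof. by rewrite -[leqRHS](size_iota 0 n.+1) find_size. Qed.

Lemma star_sizeP w : w < star_size -> ~~ B (madd (mvar n.+1 0) (mvar n.+1 w)).
Proof.
move=> lt; have := before_find 0 lt; rewrite nth_iota ?add0n => [->//|].
exact: leq_trans star_size_le.
Qed.

Lemma star_sizeN i j : i < n.+1 -> star_size <= j < n.+1 ->
  B (madd (mvar n.+1 i) (mvar n.+1 j)).
Proof.
move=> lti /andP[lej ltj]; apply: contraT => /(shift_down lti ltj) nB.
have /(nth_find 0) : has (fun w => B (madd (mvar n.+1 0) (mvar n.+1 w))) (iota 0 n.+1).
  by rewrite has_find size_iota (leq_ltn_trans lej).
rewrite nth_iota ?add0n -/star_size; last exact: leq_ltn_trans ltj.
rewrite maddC => Bk; suff: ~~ B (madd (mvar n.+1 star_size) (mvar n.+1 0)) by rewrite Bk.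
have lt0 : 0 < n.+1 by [].
elim: j lej ltj nB => [|j IH] lej ltj nB; first by move: lej; rewrite leqn0 maddC => /eqP->.
move: lej; rewrite leq_eqVlt => /predU1P[->|lej]; first by rewrite maddC.
apply: IH => //; first by lia.
rewrite maddC in nB.
have := stB (i := j) (madd_mvar_mons ltj lt0) ltj nB.
rewrite nth_madd ?size_mvar // nth_mvar eqxx add1n => /(_ isT).
by rewrite mshift_mvar ?size_mvar // maddC.
Qed.

Lemma star_size_gt0 q : q \in mons n.+1 2 -> ~~ B q -> 0 < star_size.
Proof.
move=> qn; have [i [j [lti ltj ->]]] := mons2P qn; rewrite lt0n.
by apply: contra => /eqP k0; apply: star_sizeN => //; rewrite k0.
Qed.

(** By stability, a quadratic monomial outside [B] involves only the first [star_size] variables. *)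
Lemma count_star_size_sqr :
  size (mons n.+1 2) <= count B (mons n.+1 2) + size (mons star_size 2).
Proof.
rewrite -(count_predC B) leq_add2l -(count_drop 2 star_size_le).
rewrite -!size_filter; apply: uniq_leq_size; rewrite ?filter_uniq ?mons_uniq // => q.
rewrite !mem_filter /= => /andP[nB qn]; rewrite qn andbT; apply/eqP.
have := qn; rewrite mem_mons => /andP[/eqP sq _]; apply: (sumn_drop_eq0 sq) => w kw wn.
have [i [j [lti ltj qE]]] := mons2P qn.
rewrite qE nth_madd ?size_mvar // !nth_mvar.
case: eqVneq => [iw|_]; first by move: nB; rewrite qE maddC star_sizeN // iw kw.
case: eqVneq => [jw|_] //; by move: nB; rewrite qE star_sizeN // jw kw.
Qed.

(** Under this hypothesis every quadratic monomial outside [B] is [x_0 * x_w] with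
    [w < star_size]. *)
Lemma count_star_size_lin : (forall t, t \in mons n 2 -> B (0 :: t)) ->
  size (mons n.+1 2) <= count B (mons n.+1 2) + star_size.
Proof.
move=> full; rewrite -(count_predC B) leq_add2l -size_filter.
rewrite -[leqRHS](size_iota 0) -(size_map (fun w => madd (mvar n.+1 0) (mvar n.+1 w))).
apply: uniq_leq_size; rewrite ?filter_uniq ?mons_uniq // => q.
rewrite mem_filter /= => /andP[nB qn]; have [i [j [lti ltj qE]]] := mons2P qn.
have key u v : u < n.+1 -> v < n.+1 -> u = 0 -> q = madd (mvar n.+1 u) (mvar n.+1 v) ->
    q \in [seq madd (mvar n.+1 0) (mvar n.+1 w) | w <- iota 0 star_size].
  move=> ltu ltv -> {}qE; apply/mapP; exists v => //; rewrite mem_iota add0n /=.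
  by rewrite ltnNge; apply: contra nB => kv; rewrite qE star_sizeN // kv.
case: i lti qE => [|i] lti qE; first exact: (key 0 j).
case: j ltj qE => [|j] ltj qE; first by apply: (key 0 i.+1); rewrite // maddC.
case: q qn qE nB {key} => [|[|a] t]; rewrite ?mem_mons // => qn _ nB.
by case/negP: nB; apply: full; move: qn; rewrite mem_mons /= eqSS add0n.
Qed.

Variables (d : nat) (B' : pred (seq nat)).

(* A free monomial divisible by [x_0] is [x_0 * M], where [M / x_w] is in [B'] for
   each divisor [x_w] of [M] with [w < star_size]. *)
Lemma count_free_recl :
  count (free_mon n.+1 2 B B') (mons n.+1 d.+2) <=
  count (free_mon n 2 (fun t => B (0 :: t)) (fun t => B' (0 :: t))) (mons n d.+2)
  + star n.+1 d star_size B'.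
Proof.
rewrite monsS count_cat !count_map leq_add //.
  apply: sub_count => t /= /allP fM; apply/allP => q qn; apply/implyP => lq.
  have := fM (0 :: q); rewrite mem_mons /= lq /= => -> //.
  by move: qn; rewrite mem_mons.
rewrite /star -!size_filter; apply: uniq_leq_size; rewrite ?filter_uniq ?mons_uniq // => M.
rewrite !mem_filter /= => /andP[/allP fM Mn]; rewrite Mn andbT.
apply/allP => q qn; have [w ltw qE] := mons1P qn; apply/implyP => lq.
have [kw|wk] := leqP star_size w.
  rewrite {1}/avoids sumn_take_nth big1 // => i _; rewrite qE nth_mvar.
  by case: eqVneq => // iw; move: (ltn_ord i); rewrite -iw ltnNge kw.
apply/orP; right; have := Mn; rewrite mem_mons => /andP[/eqP sM _].
have eM : incr_nth M 0 = madd (mvar n.+1 0) M.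
  case: M sM {fM lq Mn} => //= a M [<-]; congr cons.
  by elim: M => //= c M <-.
have {}fM := fM _ (madd_mvar_mons (ltn0Sn n) ltw).
have sz : size (msub M q) = n.+1.
  by have := @msub_mons n.+1 1 d _ _ qn Mn lq; rewrite mem_mons => /andP[/eqP].
have E : incr_nth M 0 = madd (madd (mvar n.+1 0) (mvar n.+1 w)) (msub M q).
  by rewrite eM -maddA -qE msubK.
have s2 : size (madd (mvar n.+1 0) (mvar n.+1 w)) = n.+1 by rewrite size_madd ?size_mvar.
by move: fM; rewrite E mle_maddr ?maddK ?s2 ?sz // (negbTE (star_sizeP wk)).
Qed.

End Stable.

(** * Linear bounds by induction on the number of variables *)

Fixpoint zmons (n : Z) (e : nat) : Z :=
  if e is e'.+1 then Z.div (zmons n e' * (n + Z.of_nat e')) (Z.of_nat e) else 1%Z.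

(** Binary integers make the numerical checks below feasible by evaluation. Each division in [zmons]
    is exact by [mons_ratio]. *)
Lemma zmonsE n e : zmons (Z.of_nat n) e = Z.of_nat (size (mons n e)).
Proof.
elim: e => [|e IH]; first by rewrite mons_deg0.
rewrite [LHS]/= IH.
have key := mons_ratio n e.
have -> : (Z.of_nat (size (mons n e)) * (Z.of_nat n + Z.of_nat e))%Z
  = (Z.of_nat (size (mons n e.+1)) * Z.of_nat e.+1)%Z by nia.
by rewrite Z.div_mul //; lia.
Qed.

(* The slopes are numerators over the common denominator 60. *)
Definition slope_bound d n (phi : Z) :=
  forall (B B' : pred (seq nat)) b q, 0 < b -> q \in mons n 2 -> ~~ B q ->
    count B (mons n 2) <= b -> count B' (mons n d) <= b ->
  (60 * Z.of_nat (count (free_mon n 2 B B') (mons n d.+2)) <= phi * Z.of_nat b)%Z.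

(* [a] and [e] are lower bounds for the size of [B] when [k] is the size of the
   star; [e] applies when all quadratic monomials without [x_0] are in [B].
   The alternatives come from [count_free_le_single], [star_le1], [star_le2] and
   [star_le_full]. *)
Definition step_check d (n k phi' phi : Z) : bool :=
  (let l := zmons n 2 in
   let a := Z.max 1 (l - zmons k 2) in
   let e := Z.max 1 (l - k) in
   let T := zmons n d.+2 in
   let T' := zmons (n - 1) d.+2 in
   let P := zmons (n - k) d.+1 in
   let slope x := fun u v w => u * x + v <=? w * x in
   let opt D s c :=
     slope a (D * phi' + 60 * s) (60 * c) (D * phi) &&
       slope e (60 * s) (60 * (D * T' + c)) (D * phi)
     || slope a (60 * s) (60 * (D * T' + c)) (D * phi) in
   [|| 60 * (T + a) <=? phi * a + 60 * zmons n d,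
       opt 1 k P,
       opt 2 (k + 1) (2 * P + zmons (n - k) d * (k - 1))
     | (n =? k) && opt (Z.of_nat d.+1) (n + Z.of_nat d) 0])%Z.

(** Since [v >= 0] and [x > 0], the inequality at [x] forces [u <= w]. Hence a bound that is linear
    in [b] need only be tested at the least possible [b]. *)
Lemma slopeW u v w x y : (0 < x)%Z -> (x <= y)%Z -> (0 <= v)%Z ->
  (u * x + v <= w * x)%Z -> (u * y + v <= w * y)%Z.
Proof. nia. Qed.

(** After stabilization, the free monomials without [x_0] are bounded by the slope for one variable
    less or by the number of all such monomials, and those divisible by [x_0] by the star bounds.
    All resulting inequalities are linear in [b], so [step_check] tests them at the lower bounds for
    [b]. *)
Lemma slope_step d n phi' phi : 0 < n -> (60 <= phi)%Z -> slope_bound d n phi' ->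
  (forall k, 0 < k <= n.+1 -> step_check d (Z.of_nat n.+1) (Z.of_nat k) phi' phi) ->
  slope_bound d n.+1 phi.
Proof.
move=> n0 phi60 IH chk B B' b q b0 qn Bq cB cB'.
have [C [C' [cC cC' le_free stC _]]] := exists_stable n.+1 2 d B B'.
have {qn Bq} [p pn Cp] : exists2 p, p \in mons n.+1 2 & ~~ C p.
  have : ~~ all C (mons n.+1 2).
    by rewrite all_count cC -all_count; apply: contra Bq => /allP; apply.
  by case/allPn => p; exists p.
rewrite -cC in cB; rewrite -cC' in cB'.
apply: (@Z.le_trans _ (60 * Z.of_nat (count (free_mon n.+1 2 C C') (mons n.+1 d.+2)))%Z).
  by move: le_free; rewrite !add2n; move: (count _ _) (count _ _); lia.
have single := count_free_le_single pn Cp cB'.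
have k0 := star_size_gt0 stC pn Cp; have kn := star_size_le n C.
have lk := leq_trans (count_star_size_sqr stC) (leq_add cB (leqnn _)).
have rec := count_free_recl n C d C'.
set k := star_size n C in k0 kn lk rec.
(* Here [y] bounds the part without [x_0]. The induction hypothesis needs a quadratic monomial
   outside the restricted set; if there is none, the complement of [C] is so small that [b + k] is
   at least the number of all quadratic monomials. *)
have {rec} [y leZ hy] : exists2 y,
    count (free_mon n.+1 2 C C') (mons n.+1 d.+2) <= y + star n.+1 d k C' &
    y <= size (mons n d.+2) /\
    ((60 * Z.of_nat y <= phi' * Z.of_nat b)%Z \/ size (mons n.+1 2) <= b + k).
  have cr : count (fun t => C (0 :: t)) (mons n 2) <= b.
    by apply: leq_trans cB; rewrite monsS count_cat !count_map leq_addr.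
  have cr' : count (fun t => C' (0 :: t)) (mons n d) <= b.
    apply: leq_trans cB'; case: (d) => [|d']; first by rewrite !mons_deg0.
    by rewrite monsS count_cat !count_map leq_addr.
  case: (boolP (all (fun t => C (0 :: t)) (mons n 2))) => [/allP full|/allPn[t tn Ct]].
    exists (size (mons n d.+2)).
      by apply: leq_trans rec _; rewrite leq_add2r count_size.
    by split=> //; right; apply: leq_trans (count_star_size_lin stC full) _; rewrite leq_add2r.
  exists (count (free_mon n 2 (fun t => C (0 :: t)) (fun t => C' (0 :: t))) (mons n d.+2)) => //.
  by split; [rewrite count_size|left; exact: (IH _ _ _ t b0 tn Ct cr cr')].
have s1 := star_le1 kn k0 cB'; have s2 := star_le2 kn k0 cB'; have s3 := star_le_full kn cB'.
have /chk : 0 < k <= n.+1 by rewrite k0.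
have zl := zmonsE n.+1 2; have zlk := zmonsE k 2; have zT := zmonsE n.+1 d.+2.
have zT' := zmonsE n d.+2; have zP := zmonsE (n.+1 - k) d.+1; have zD := zmonsE n.+1 d.
have zQ := zmonsE (n.+1 - k) d.
rewrite Nat2Z.inj_sub in zP; last by lia.
rewrite Nat2Z.inj_sub in zQ; last by lia.
rewrite /step_check (_ : Z.of_nat n.+1 - 1 = Z.of_nat n)%Z; last by lia.
rewrite zl zlk zT zT' zP zD zQ {zl zlk zT zT' zP zD zQ}.
rewrite -[2 + d]/(d.+2) in single.
have leb : (60 * Z.of_nat b <= phi * Z.of_nat b)%Z by nia.
move: single leZ hy s1 s2 s3 lk.
move: (count _ _) (star _ _ _ _) => Z S.
move: (size (mons n.+1 2)) (size (mons k 2)) (size (mons n.+1 d.+2)) (size (mons n d.+2))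
  (size (mons n.+1 d)) (size (mons (n.+1 - k) d.+1)) (size (mons (n.+1 - k) d)) => l lk T T' N P Q.
move=> single leZ hy s1 s2 s3 lelk.
set a := Z.max 1 _; set e := Z.max 1 _.
have ab : (a <= Z.of_nat b)%Z by rewrite /a; lia.
have a0 : (0 < a)%Z by rewrite /a; lia.
have e0 : (0 < e)%Z by rewrite /e; lia.
(* A star bound [(c + s * b) / D] is processed uniformly; [D] clears its denominator and is [1], [2]
   or [d + 1]. *)
have opt D s c : (0 < D)%Z -> (0 <= s)%Z -> (0 <= c)%Z ->
  (D * Z.of_nat S <= c + s * Z.of_nat b)%Z ->
  (((D * phi' + 60 * s) * a + 60 * c <=? D * phi * a) &&
       (60 * s * e + (60 * (D * Z.of_nat T' + c)) <=? D * phi * e)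
     || (60 * s * a + 60 * (D * Z.of_nat T' + c) <=? D * phi * a))%Z ->
  (60 * Z.of_nat Z <= phi * Z.of_nat b)%Z.
  move=> D0 s0 c0 hS hc.
  have D1 : (0 <= D)%Z by lia.
  have hZ : (D * Z.of_nat Z <= D * (Z.of_nat y + Z.of_nat S))%Z.
    by apply: Z.mul_le_mono_nonneg_l D1 _; lia.
  apply: (Zmult_lt_0_le_reg_r _ _ D D0).
  case: hy => yT hy; case/orP: hc => [/andP[/Z.leb_le hX /Z.leb_le hY]|/Z.leb_le hY].
    case: hy => [/(Z.mul_le_mono_nonneg_l _ _ _ D1) hy|hy].
      have := slopeW a0 ab _ hX; lia.
    have /(Z.mul_le_mono_nonneg_l _ _ _ D1) hT : (Z.of_nat y <= Z.of_nat T')%Z by lia.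
    have eb : (e <= Z.of_nat b)%Z by rewrite /e; lia.
    have := slopeW e0 eb _ hY; lia.
  have /(Z.mul_le_mono_nonneg_l _ _ _ D1) hT : (Z.of_nat y <= Z.of_nat T')%Z by lia.
  have := slopeW a0 ab _ hY; lia.
case/or4P.
- move/Z.leb_le => h.
  have := @slopeW 60%Z (60 * Z.of_nat T - 60 * Z.of_nat N)%Z phi _ _ a0 ab; lia.
- by apply: opt; lia.
- have -> : (Z.of_nat k - 1 = Z.of_nat k.-1)%Z by lia.
  apply: opt => //; first lia; last by clear -s2; lia.
  by have := Nat2Z.is_nonneg (Q * k.-1); clear; lia.
- case/andP => /Z.eqb_eq nk; apply: opt; lia.
Qed.

(** * The quadratic counting bound *)

(** The exchange opposite to [mshift]. If the complement of a set is stable and [mdown i q] lies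
    outside the set, so does [q]; [closed_sets] prunes its search by this rule. *)
Fixpoint mdown i (m : seq nat) : seq nat :=
  match i, m with
  | i'.+1, a :: t => a :: mdown i' t
  | 0, a :: b :: t => [:: a.-1, b.+1 & t]
  | _, _ => m
  end.

Lemma mdownP n e i q : q \in mons n e -> i.+1 < n -> 0 < nth 0 q i ->
  [/\ mdown i q \in mons n e, 0 < nth 0 (mdown i q) i.+1 & mshift i (mdown i q) = q].
Proof.
rewrite !mem_mons => /andP[/eqP <- /eqP <-]; elim: i q => [|i IH] [|a q] //.
  by case: a q => [|a] [|b q] //= _ _; split=> //; rewrite eqxx /=; apply/eqP; lia.
rewrite /= ltnS => lti qi; have [/andP[/eqP-> /eqP->] -> ->] := IH q lti qi.
by rewrite !eqxx.
Qed.

(* [acc] and [rej] collect the monomials already put inside and outside. *)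
Fixpoint closed_sets (L acc rej : seq (seq nat)) room : seq (seq (seq nat)) :=
  if L is q :: L' then
    closed_sets L' acc (q :: rej) room ++
    (if (0 < room) &&
        all (fun i => (nth 0 q i == 0) || (mdown i q \notin rej)) (iota 0 (size q).-1)
     then closed_sets L' (q :: acc) rej room.-1 else [::])
  else [:: acc].

(** Follow the branch that decides each [q] according to [B]. It is never pruned: a rejected
    [mdown i q] would put [q] outside [B] by stability. *)
Lemma closed_sets_complete n e (B : pred (seq nat)) L acc rej room :
  (forall i, mstable n e i (predC B)) -> {subset L <= mons n e} ->
  (forall x, x \in rej -> ~~ B x) -> count B L <= room ->
  exists2 S, S \in closed_sets L acc rej room &
    size S = size acc + count B L /\ S =i acc ++ filter B L.
Proof.
move=> stB; elim: L acc rej room => [|q L IH] acc rej room sub hrej /= room_le.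
  by exists acc; rewrite ?inE // addn0 cats0.
have subL : {subset L <= mons n e} by move=> x xL; rewrite sub // inE xL orbT.
case Bq: (B q) room_le => /= room_le.
  have le_room : count B L <= room.-1 by lia.
  have [S SL [szS memS]] := IH (q :: acc) rej room.-1 subL hrej le_room.
  exists S; last first.
    split; first by rewrite szS /=; lia.
    by move=> x; rewrite memS !mem_cat !inE orbCA orbA.
  rewrite mem_cat; apply/orP; right; rewrite ifT //; apply/andP; split; first by lia.
  apply/allP => i; rewrite mem_iota add0n /= => lti; rewrite -leqn0 leqNgt -implybE.
  apply/implyP => qi; have qn : q \in mons n e by rewrite sub ?mem_head.
  have sq : size q = n by move: qn; rewrite mem_mons => /andP[/eqP].
  have ltin : i.+1 < n by rewrite sq in lti; lia.
  have [dn di de] := mdownP qn ltin qi.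
  apply/negP => /hrej nB; have := stB i _ dn ltin nB di.
  by rewrite /= de Bq.
have hrej' x : x \in q :: rej -> ~~ B x.
  by rewrite inE => /predU1P[->|/hrej//]; rewrite Bq.
have [S SL [szS memS]] := IH acc (q :: rej) room subL hrej' room_le.
by exists S => //; rewrite mem_cat SL.
Qed.

Lemma eq_in_free_mon n d (B B' C C' : pred (seq nat)) :
  {in mons n 2, B =1 C} -> {in mons n d, B' =1 C'} ->
  {in mons n d.+2, free_mon n 2 B B' =1 free_mon n 2 C C'}.
Proof.
move=> eqB eqB' M Mn; apply: eq_in_all => q qn; case: (boolP (mle q M)) => //= lq.
by rewrite eqB // eqB' //; apply: (@msub_mons n 2 d).
Qed.

Definition base_check (L2 L3 : seq (seq (seq nat))) (L5 : seq (seq nat)) :=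
  all (fun S => all (fun S' =>
    count (free_mon 4 2 (mem S) (mem S')) L5 <= 5 * maxn (size S) (size S')) L3) L2.

Lemma base_check_mem L2 L3 L5 S S' : base_check L2 L3 L5 -> S \in L2 -> S' \in L3 ->
  count (free_mon 4 2 (mem S) (mem S')) L5 <= 5 * maxn (size S) (size S').
Proof. by rewrite /base_check => /allP h SL S'L; have /allP := h S SL; apply. Qed.

Lemma base_checkP :
  base_check (closed_sets (mons 4 2) [::] [::] 8) (closed_sets (mons 4 3) [::] [::] 8)
    (mons 4 5).
Proof. by vm_compute. Qed.

(** For [b >= 9] the bound from a single missing monomial, [36 + b], is at most [5 * b]. For
    [b <= 8] both sets may be taken stable, and then all candidates are enumerated. *)
Lemma slope_bound_4_3 : slope_bound 3 4 300.
Proof.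
move=> B B' b q b0 qn Bq cB cB'.
have [lb|] := leqP 9 b.
  have := count_free_le_single qn Bq cB'; rewrite !size_mons.
  have -> : (4 + 3).-1 = 6 by []. have -> : (4 + (2 + 3)).-1 = 8 by [].
  have -> : 'C(6, 3) = 20 by []. have -> : 'C(8, 2 + 3) = 56 by [].
  by rewrite -[2 + 3]/5; move: (count _ _); lia.
rewrite ltnS => b8.
have [C [C' [cC cC' le_free stC stC']]] := exists_stable 4 2 3 B B'.
rewrite -cC in cB; rewrite -cC' in cB'.
have nil_rej (P : pred (seq nat)) x : x \in [::] -> ~~ P x by [].
have [S SL [szS memS]] :=
  closed_sets_complete [::] stC (fun x => id) (nil_rej C) (leq_trans cB b8).
have [S' S'L [szS' memS']] :=
  closed_sets_complete [::] stC' (fun x => id) (nil_rej C') (leq_trans cB' b8).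
have := base_check_mem base_checkP SL S'L.
rewrite szS szS' -(@eq_in_count _ (free_mon 4 2 C C')); last first.
  apply: eq_in_free_mon => x xn; rewrite [RHS]/= ?memS ?memS' mem_filter xn andbT //.
move: le_free; rewrite -[2 + 3]/5.
move: (count (free_mon _ _ _ _) _) (count (free_mon _ _ _ _) _) => x y.
move: cB cB'; rewrite !add0n; move: (count C _) (count C' _) => u v; lia.
Qed.

(* The slope to be reached is [60 * floor (dim R_(d+2) / dim R_2)]; the other
   values were found by search, so that the recursion on [n] goes through. *)
Definition slope (d n : nat) : Z :=
  match d, n with
  | _, 1 => 60%Z
  | 3, 2 => 135%Z
  | _, 2 => 132%Z
  | 3, 3 => 255%Z
  | 4, 3 => 252%Z
  | 3, 6 => 700%Z
  | _, _ => (60 * (zmons (Z.of_nat n) d.+2 / zmons (Z.of_nat n) 2))%Z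
  end.

Definition slope_check d n :=
  (60 <=? slope d n.+1)%Z &&
  all (fun k => step_check d (Z.of_nat n.+1) (Z.of_nat k) (slope d n) (slope d n.+1))
    (iota 1 n.+1).

Lemma slope_checkP d n : 0 < n -> slope_check d n ->
  slope_bound d n (slope d n) -> slope_bound d n.+1 (slope d n.+1).
Proof.
move=> n0 /andP[/Z.leb_le h1 /allP h2] h; apply: (slope_step n0 h1 h) => k hk.
by apply: h2; rewrite mem_iota; lia.
Qed.

Lemma slope_chain d m k n : 0 < m -> slope_bound d m (slope d m) ->
  all (slope_check d) (iota m k) -> m <= n <= m + k -> slope_bound d n (slope d n).
Proof.
move=> m0 hm /allP chk; elim: n => [|n IH]; first lia.
rewrite leq_eqVlt => /andP[/predU1P[<- //|mn] nk].
apply: slope_checkP; first lia.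
  by apply: chk; rewrite mem_iota; lia.
by apply: IH; lia.
Qed.

Lemma slope_bound_1 d : slope_bound d 1 (slope d 1).
Proof.
move=> B B' b q b0 qn Bq cB cB'.
have -> : slope d 1 = 60%Z by case: (d) => [|[|[|[|[|d']]]]].
have := count_free_le_single qn Bq cB'; rewrite !size_mons !add1n -!pred_Sn !binn -[2 + d]/d.+2.
by move: (count _ _); lia.
Qed.

Lemma slope_check_3_1 : all (slope_check 3) (iota 1 2). Proof. by vm_compute. Qed.
Lemma slope_check_3_4 : all (slope_check 3) (iota 4 53). Proof. by vm_compute. Qed.
Lemma slope_check_4 : all (slope_check 4) (iota 1 15). Proof. by vm_compute. Qed.
Lemma slope_check_5 : all (slope_check 5) (iota 1 9). Proof. by vm_compute. Qed.
Lemma slope_check_6 : all (slope_check 6) (iota 1 7). Proof. by vm_compute. Qed.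
Lemma slope_check_7 : all (slope_check 7) (iota 1 4). Proof. by vm_compute. Qed.
Lemma slope_check_8 : all (slope_check 8) (iota 1 2). Proof. by vm_compute. Qed.

(** With [direct_large] this covers all pairs with [2 < n] and [2 < d]; from [d = 9] on the direct
    count always suffices. *)
Definition slope_range d n :=
  match d with
  | 3 => n <= 57 | 4 => n <= 16 | 5 => n <= 10 | 6 => n <= 8 | 7 => n <= 5 | 8 => n <= 3
  | _ => false
  end.

Lemma slope_bound_range d n : 0 < n -> slope_range d n -> slope_bound d n (slope d n).
Proof.
have s1 := slope_bound_1; have s4 : slope_bound 3 4 (slope 3 4) by exact: slope_bound_4_3.
case: d => [|[|[|[|[|[|[|[|[|d]]]]]]]]] // n0 hn.
(* For [d = 3] the recursion is restarted at [n = 4] from the enumerated case. *)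
- case: (leqP n 3) => n3; first by apply: (slope_chain _ (s1 3) slope_check_3_1); lia.
  by apply: (slope_chain _ s4 slope_check_3_4); move: hn; rewrite /slope_range; lia.
- by apply: (slope_chain _ (s1 4) slope_check_4); move: hn; rewrite /slope_range; lia.
- by apply: (slope_chain _ (s1 5) slope_check_5); move: hn; rewrite /slope_range; lia.
- by apply: (slope_chain _ (s1 6) slope_check_6); move: hn; rewrite /slope_range; lia.
- by apply: (slope_chain _ (s1 7) slope_check_7); move: hn; rewrite /slope_range; lia.
- by apply: (slope_chain _ (s1 8) slope_check_8); move: hn; rewrite /slope_range; lia.
Qed.

(** * Where the direct count suffices, and assembly of the bound *)

(** Both sides are the trinomial coefficient [(n + d + 1)! / (d! 2! (n - 1)!)]. It turns the
    hypothesis on [r] into ['C((n + d).+1, d) < r.+1 * 'C(d.+2, 2)]. *)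
Lemma bin_trinomial n d : 0 < n -> 0 < d ->
  'C(n + d.+1, d.+2) * 'C(d.+2, 2) = 'C((n + d).+1, d) * 'C(n.+1, 2).
Proof.
move=> n0 d0; apply/eqP.
have f0 : 0 < (d`! * n.-1`! * 2) by rewrite !muln_gt0 !fact_gt0.
rewrite -(eqn_pmul2r f0); apply/eqP.
have h1 := @bin_fact (n + d.+1) d.+2; have h2 := @bin_fact (n + d).+1 d.
have h3 := @bin_fact d.+2 2; have h4 := @bin_fact n.+1 2.
have {}h1 : 'C(n + d.+1, d.+2) * (d.+2`! * n.-1`!) = (n + d).+1`!.
  rewrite (_ : n.-1 = n + d.+1 - d.+2); last lia.
  by rewrite h1 ?addnS //; lia.
have {}h2 : 'C((n + d).+1, d) * (d`! * n.+1`!) = (n + d).+1`!.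
  rewrite (_ : n.+1 = (n + d).+1 - d) ?h2 //; lia.
have {}h3 : 'C(d.+2, 2) * (2 * d`!) = d.+2`! by rewrite -h3 // subSS subn1.
have {}h4 : 'C(n.+1, 2) * (2 * n.-1`!) = n.+1`!.
  by rewrite -h4 // subSS subn1.
rewrite -h3 in h1; rewrite -h4 in h2; lia.
Qed.

Lemma free_le_direct n d r m t (B B' : pred (seq nat)) :
  0 < n -> 1 < d -> size (mons n d.+2) < r.+1 * size (mons n 2) ->
  count B (mons n 2) <= m -> count B' (mons n d) <= m ->
  count (predC B) (mons n 2) = t -> 0 < t ->
  'C(d.+2, 2) * t.+1 <= 'C((n + d).-1, d - 2)
    \/ 'C(d.+2, 2) * t.+1 * 'C(d, 2) <= t * 'C((n + d).-1, d - 2) ->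
  count (free_mon n 2 B B') (mons n d.+2) <= r * m.
Proof.
move=> n0 d1 hr cB cB' ct t0 h; have := free_direct n0 d1 cB cB' ct t0 h.
have tri := bin_trinomial n0 (ltnW d1).
move: hr; rewrite !size_mons addnS /= addn2 /=.
have k0 : 0 < 'C(d.+2, 2) by rewrite bin_gt0.
have l0 : 0 < 'C(n.+1, 2) by rewrite bin_gt0.
move: ('C(n + d.+1, d.+2)) ('C(d.+2, 2)) ('C((n + d).+1, d)) ('C(n.+1, 2)) (count _ _) k0 l0 tri.
move=> N k c l z k0 l0 tri hr hz.
have : c < r.+1 * k by rewrite -(ltn_pmul2r l0) -tri -mulnA [k * l]mulnC mulnA ltn_pmul2r.
move=> hc; rewrite -(leq_pmul2l k0).
have : m * c <= m * (r.+1 * k) by rewrite leq_mul2l (ltnW hc) orbT.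
lia.
Qed.

(** Induction on [n]. From [n] to [n + 1] the left side grows by [(n + 2) / n] and the right side by
    [(n + d) / (n + 2)], which is larger here. At [n = 3] the claim reduces to [72 <= d * (d - 1)],
    an equality for [d = 9]. *)
Lemma direct_base n d : 2 < n -> 8 < d ->
  'C(n.+1, 2) * 'C(d.+2, 2) <= 'C((n + d).-1, d - 2).
Proof.
move=> n3 d8; elim: n n3 => // n IH; rewrite ltnS leq_eqVlt => /predU1P[<-|n3].
  have -> : (3 + d).-1 = d.+2 by lia.
  rewrite -(@bin_sub d.+2 (d - 2)); last by lia.
  have -> : d.+2 - (d - 2) = 4 by lia.
  have h4 := bin_ffact d.+2 4; have h2 := bin_ffact d.+2 2.
  rewrite !ffactnS ffactn0 /= in h4 h2.
  have -> : 'C(4, 2) = 6 by [].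
  have c4 : 'C(d.+2, 4) * 24 = 'C(d.+2, 2) * 2 * (d * d.-1).
    by move: h4 h2; rewrite -[4`!]/24 -[2`!]/2 => -> ->; rewrite !muln1 -!mulnA.
  have : 72 <= d * d.-1 by nia.
  by move: c4; move: ('C(_, 4)) ('C(_, 2)) (d * _); nia.
have := IH n3.
have e1 : 'C(n.+2, 2) * n = 'C(n.+1, 2) * n.+2.
  by have := mul_bin_down n.+2 2; rewrite !subSS subn0 /=; lia.
have e2 : 'C((n.+1 + d).-1, d - 2) * n.+2 = 'C((n + d).-1, d - 2) * (n + d).
  have := mul_bin_down (n + d) (d - 2).
  by rewrite addSn /= (_ : n + d - (d - 2) = n.+2); lia.
move: ('C(n.+2, 2)) ('C(n.+1, 2)) ('C(d.+2, 2)) ('C((n.+1 + d).-1, _)) ('C((n + d).-1, _)) e1 e2.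
move=> l' l k E' E e1 e2 h.
have n0 : 0 < n * n.+2 by lia.
rewrite -(leq_pmul2r n0).
have -> : l' * k * (n * n.+2) = l * k * (n.+2 * n.+2).
  by rewrite mulnACA e1; lia.
have -> : E' * (n * n.+2) = E * ((n + d) * n) by rewrite mulnCA [E' * _]e2; lia.
by apply: leq_mul => //; nia.
Qed.

Lemma sub_free_mon n j (B B' C C' : pred (seq nat)) M :
  {subset B <= C} -> {subset B' <= C'} ->
  free_mon n j B B' M -> free_mon n j C C' M.
Proof.
move=> BC BC' /allP fM; apply/allP => q qn; apply/implyP => lq.
have := fM q qn; rewrite lq => /orP[Bq|B'q]; apply/orP; [left; exact: BC|right; exact: BC'].
Qed.

(** The two conditions of [free_le_direct] are freed from [t], by [t + 1 <= 'C(n + 1, 2)] when [B]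
    is non-empty in degree 2, respectively by [t + 1 <= 2 * t]. *)
Lemma free_le_direct_large n d r m (B B' : pred (seq nat)) q :
  1 < n -> 1 < d -> size (mons n d.+2) < r.+1 * size (mons n 2) -> 0 < m ->
  q \in mons n 2 -> ~~ B q ->
  count B (mons n 2) <= m -> count B' (mons n d) <= m ->
  'C(n.+1, 2) * 'C(d.+2, 2) <= 'C((n + d).-1, d - 2)
    \/ 'C(d.+2, 2) * 'C(d, 2) * 2 <= 'C((n + d).-1, d - 2) ->
  count (free_mon n 2 B B') (mons n d.+2) <= r * m.
Proof.
move=> n1 d1 hr m0 qn Bq cB cB' h; have n0 := ltnW n1.
have t0 (C : pred (seq nat)) : ~~ C q -> 0 < count (predC C) (mons n 2).
  by move=> Cq; rewrite -has_count; apply/hasP; exists q.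
case: h => h; last first.
  apply: (free_le_direct n0 d1 hr cB cB' erefl (t0 B Bq)); right.
  by have := t0 B Bq; move: (count _ _) => t; nia.
have sz : size (mons n 2) = 'C(n.+1, 2) by rewrite size_mons addn2.
have main (C : pred (seq nat)) : ~~ C q -> 0 < count C (mons n 2) <= m ->
    count (free_mon n 2 C B') (mons n d.+2) <= r * m.
  move=> Cq /andP[c0 cC]; apply: (free_le_direct n0 d1 hr cC cB' erefl (t0 C Cq)); left.
  apply: leq_trans h; rewrite mulnC leq_mul2r; apply/orP; right.
  by have := count_predC C (mons n 2); rewrite sz; lia.
(* An empty [B] would give [t + 1 > 'C(n + 1, 2)]. It is enlarged by one monomial [p] other than
   [q], which can only add free monomials and is allowed because [0 < m]. *)
have [c0|c0] := posnP (count B (mons n 2)); last by apply: main; rewrite ?c0.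
have [p pn pq] : exists2 p, p \in mons n 2 & p != q.
  have : has (predC (pred1 q)) (mons n 2).
    have := count_predC (pred1 q) (mons n 2); rewrite has_count count_uniq_mem ?mons_uniq //.
    rewrite qn sz; have : 2 < 'C(n.+1, 2).
      by rewrite -[2.+1]/('C(3, 2)) leq_bin2l.
    by move: 'C(_, _) => c; lia.
  by case/hasP => p pn /= pq; exists p.
apply: leq_trans (_ : count (free_mon n 2 (predU1 p (mem B)) B') (mons n d.+2) <= _).
  by apply: sub_count => M; apply: sub_free_mon => // x; rewrite !inE => ->; rewrite orbT.
apply: main; first by rewrite /= negb_or eq_sym pq.
have -> : count (predU1 p (mem B)) (mons n 2) = 1; last by [].
rewrite -[RHS](_ : count (pred1 p) (mons n 2) = 1); last by rewrite count_uniq_mem ?mons_uniq // pn.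
apply: eq_in_count => x xn /=; case: (x == p) => //=.
move/eqP: c0; rewrite -leqn0 leqNgt -has_count => /hasPn /(_ x xn).
by move=> /negbTE; rewrite -topredE.
Qed.

(** The hypothesis on [r] says that the floor of the quotient of the two dimensions is at most [r],
    and [phi / 60] is at most this floor. *)
Lemma slope_le n d r m (B B' : pred (seq nat)) q phi :
  slope_bound d n phi ->
  (phi <= 60 * (zmons (Z.of_nat n) d.+2 / zmons (Z.of_nat n) 2))%Z ->
  0 < n -> size (mons n d.+2) < r.+1 * size (mons n 2) -> 0 < m ->
  q \in mons n 2 -> ~~ B q ->
  count B (mons n 2) <= m -> count B' (mons n d) <= m ->
  count (free_mon n 2 B B') (mons n d.+2) <= r * m.
Proof.
move=> hphi + n0 hr m0 qn Bq cB cB'; rewrite !zmonsE => lephi.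
have := hphi B B' m q m0 qn Bq cB cB'.
have le_r : (Z.of_nat (size (mons n d.+2)) / Z.of_nat (size (mons n 2)) <= Z.of_nat r)%Z.
  apply: Zlt_succ_le; apply: Z.div_lt_upper_bound; last by lia.
  have : 0 < size (mons n 2) by rewrite size_mons addn2 bin_gt0.
  by lia.
move: (Z.div _ _) lephi le_r => f lephi le_r; move: (count _ _) => z; nia.
Qed.

Lemma slope_le_floor d n : 2 < n -> ~~ ((n == 3) && (d <= 4)) ->
  (slope d n <= 60 * (zmons (Z.of_nat n) d.+2 / zmons (Z.of_nat n) 2))%Z.
Proof.
case: n => [|[|[|[|[|[|[|n]]]]]]] // _; case: d => [|[|[|[|[|d]]]]] // _; try exact: Z.le_refl.
Qed.

Lemma direct_large n d : 2 < n -> 2 < d -> ~~ slope_range d n ->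
  'C(n.+1, 2) * 'C(d.+2, 2) <= 'C((n + d).-1, d - 2)
    \/ 'C(d.+2, 2) * 'C(d, 2) * 2 <= 'C((n + d).-1, d - 2).
Proof.
move=> n2 d2 hs; have [d8|d9] := leqP 9 d; first by left; apply: direct_base.
have big k : k <= n -> 'C(d.+2, 2) * 'C(d, 2) * 2 <= 'C((k + d).-1, d - 2) ->
   'C(d.+2, 2) * 'C(d, 2) * 2 <= 'C((n + d).-1, d - 2).
  by move=> kn /leq_trans; apply; rewrite leq_bin2l; lia.
case: d d2 d9 hs big => [|[|[|[|[|[|[|[|[|d]]]]]]]]] // _ _; rewrite /slope_range -ltnNge => hs big.
- by right; apply: (big 58).
- by right; apply: (big 17).
- by right; apply: (big 11).
- by right; apply: (big 9).
- case: (leqP 8 n) => n8; first by right; apply: (big 8).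
  by left; case: n n2 hs n8 {big} => [|[|[|[|[|[|[|[|n]]]]]]]].
- case: (leqP 7 n) => n8; first by right; apply: (big 7).
  by left; case: n n2 hs n8 {big} => [|[|[|[|[|[|[|n]]]]]]].
Qed.

Lemma free_le2 n d r m (B B' : pred (seq nat)) q :
  2 < d -> n < r -> size (mons n d.+2) < r.+1 * size (mons n 2) -> 0 < m ->
  q \in mons n 2 -> ~~ B q ->
  count B (mons n 2) <= m -> count B' (mons n d) <= m ->
  count (free_mon n 2 B B') (mons n d.+2) <= r * m.
Proof.
move=> d2 nr hr m0 qn Bq cB cB'.
have single := count_free_le_single qn Bq cB'; rewrite -[2 + d]/d.+2 in single.
have [n2|n3] := leqP n 2.
  (* For [n = 2] the bound from a single missing monomial is [m + 2], at most [3 * m] and hence at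
     most [r * m]; for [n = 1] it is [m]. *)
  move: n2 single nr qn; rewrite leq_eqVlt => /predU1P[->|].
    by rewrite !size_mons -[(2 + d).-1]/d.+1 -[(2 + d.+2).-1]/d.+3 !binSn; nia.
  case: n {hr cB cB'} => [|[|n]] // _; rewrite !size_mons !add1n -!pred_Sn !binn; nia.
case: (boolP (slope_range d n)) => hs; last first.
  by apply: (free_le_direct_large _ _ hr m0 qn) => //; [lia|lia|exact: direct_large].
have sl := slope_bound_range (ltnW (ltnW n3)) hs.
case: (boolP ((n == 3) && (d <= 4))) => [/andP[/eqP n3E d4]|/(slope_le_floor n3) fl]; last first.
  by apply: (slope_le sl fl _ hr m0 qn) => //; lia.
(* In these two cases the slopes [255/60] and [252/60] exceed the floor, but [r >= 4]. For [m <= 3],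
   respectively [m <= 4], rounding down the slope bound gives [4 * m]; for larger [m] the bounds
   [11 + m] and [13 + m] from a single missing monomial suffice. *)
have := sl B B' m q m0 qn Bq cB cB'; move: single nr; rewrite n3E !size_mons.
have /orP[/eqP->|/eqP->] : (d == 3) || (d == 4) by lia.
  rewrite -[slope _ _]/255%Z -[(3 + 3).-1]/5 -[(3 + 5).-1]/7 -['C(5, 3)]/10 -['C(7, 5)]/21.
  move: (count _ _); nia.
rewrite -[slope _ _]/252%Z -[(3 + 4).-1]/6 -[(3 + 6).-1]/8 -['C(6, 4)]/15 -['C(8, 6)]/28.
move: (count _ _); nia.
Qed.

(** * The linear counting bound *)

(** Each additional variable adds ['C(n + d, d - 1)], which is at least [d + 1]. *)
Lemma bin_gap p n d : 1 < d -> 0 < p <= n ->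
  'C(p + d, d) + d.+1 * (n - p) <= 'C(n + d, d).
Proof.
move=> d1; elim: n => [|n IH]; first lia.
case/andP => p0; rewrite leq_eqVlt => /predU1P[->|pn]; first by rewrite subnn muln0 addn0.
have {}IH : 'C(p + d, d) + d.+1 * (n - p) <= 'C(n + d, d) by apply: IH; lia.
case: d d1 IH => [|[|d]] // _ IH.
rewrite addSn binS; have : d.+3 <= 'C(n + d.+2, d.+1).
  have : 'C(d.+3, d.+1) <= 'C(n + d.+2, d.+1) by rewrite leq_bin2l; lia.
  apply: leq_trans; rewrite -(@bin_sub d.+3 d.+1); last lia.
  have -> : d.+3 - d.+1 = 2 by lia.
  by have := binS d.+2 1; have := binS d.+1 1; rewrite !bin1; lia.
rewrite subSn; lia.
Qed.

Lemma mul_mons_deg p d : p * 'C(p + d, d) = d.+1 * size (mons p d.+1).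
Proof.
case: p => [|p]; first by rewrite mul0n size_mons bin_small ?muln0.
have := mul_bin_left (p.+1 + d) d; rewrite size_mons addnS /= => ->.
by congr (_ * _); rewrite addnK.
Qed.

(** A stable complement in degree 1 consists of the first [k] variables, so [star_le1] applies. As
    [n - k <= m], it remains to bound the monomials of degree [d + 1] in [n - k] variables by
    [(r - k) * (n - k)]. *)
Lemma free_le1 n d r m (B B' : pred (seq nat)) q :
  2 < d -> n < r -> size (mons n d.+1) < r.+1 * size (mons n 1) -> 0 < m ->
  q \in mons n 1 -> ~~ B q ->
  count B (mons n 1) <= m -> count B' (mons n d) <= m ->
  count (free_mon n 1 B B') (mons n d.+1) <= r * m.
Proof.
move=> d2 nr hr m0 qn Bq cB cB'.
have [C [C' [cC cC' le_free stC _]]] := exists_stable n 1 d B B'.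
have {qn Bq} [i ltin Ci] : exists2 i, i < n & ~~ C (mvar n i).
  have : ~~ all C (mons n 1).
    by rewrite all_count cC -all_count; apply: contra Bq => /allP; apply.
  by case/allPn => p /mons1P[i ltin ->]; exists i.
rewrite -cC in cB; rewrite -cC' in cB'.
apply: leq_trans le_free _; rewrite -[1 + d]/d.+1.
pose k := find (fun w => C (mvar n w)) (iota 0 n).
have kn : k <= n by rewrite -[leqRHS](size_iota 0 n) find_size.
have kP w : w < k -> ~~ C (mvar n w).
  by move=> lt; have := before_find 0 lt; rewrite nth_iota ?add0n => [->//|]; apply: leq_trans kn.
have kN w : k <= w < n -> C (mvar n w).
  case/andP => kw wn; have lt_kn := leq_ltn_trans kw wn.
  have := @nth_find _ 0 (fun w => C (mvar n w)) (iota 0 n).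
  rewrite has_find size_iota -/k lt_kn nth_iota // add0n => /(_ isT).
  elim: w kw wn => [|w IH]; first by rewrite leqn0 => /eqP->.
  rewrite leq_eqVlt => /predU1P[-> //|kw] wn Ck; apply: contraT => nC.
  have := stC w _ (mvar_mons wn) wn nC; rewrite nth_mvar eqxx => /(_ isT).
  have -> : mshift w (mvar n w.+1) = mvar n w; last by rewrite /= (IH kw (ltnW wn) Ck).
  have := mshift_mvar (size_nseq n 0) wn.
  have e v : v < n -> madd (mvar n v) (nseq n 0) = mvar n v.
    move=> lt; apply: (@eq_from_nth _ 0); first by rewrite size_madd ?size_mvar ?size_nseq.
    by move=> x _; rewrite nth_madd ?size_mvar ?size_nseq // nth_nseq if_same addn0.
  by rewrite !e // ltnW.
have k0 : 0 < k.
  by rewrite lt0n; apply: contra Ci => /eqP k0; apply: kN; rewrite k0.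
have eC : {in mons n 1, C =1 avoids k}.
  move=> _ /mons1P[w wn ->]; rewrite /avoids sumn_take_nth.
  have [kw|wk] := leqP k w.
    rewrite kN ?kw // big1 // => v _; rewrite nth_mvar.
    by case: eqVneq => // wv; move: (ltn_ord v); rewrite -wv ltnNge kw.
  by rewrite (negbTE (kP w wk)) (bigD1 (Ordinal wk)) //= nth_mvar eqxx.
have le_star : count (free_mon n 1 C C') (mons n d.+1) <= star n d k C'.
  apply: sub_count => M /allP fM; apply/allP => p pn.
  by rewrite -eC //; exact: fM.
apply: leq_trans le_star (leq_trans (star_le1 kn k0 cB') _).
have pm : n - k <= m.
  apply: leq_trans cB; rewrite (eq_in_count eC) count_avoids // size_mons addn1.
  by rewrite bin1.
move: hr; rewrite [size (mons n 1)]size_mons addn1 bin1 /= => hr.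
have [p0|p0] := posnP (n - k).
  by rewrite p0 size_mons bin_small // add0n leq_mul2r (leq_trans kn (ltnW nr)) orbT.
have hn := mul_mons_deg n d; have hp := mul_mons_deg (n - k) d.
(* Multiplied by [n - k] and divided by [d + 1], this is the required bound, by [mul_mons_deg]. *)
have key : 'C((n - k) + d, d) <= d.+1 * (r - k).
  have n0 : 0 < n by lia.
  have ub : 'C(n + d, d) < d.+1 * r.+1.
    by rewrite -(ltn_pmul2l n0) hn mulnCA ltn_pmul2l // mulnC.
  have gap : 'C(n - k + d, d) + d.+1 * (n.-1 - (n - k)) <= 'C(n.-1 + d, d).
    by apply: bin_gap; lia.
  have rec : 'C(n + d, d) = 'C(n.-1 + d, d) + 'C(n.-1 + d, d.-1).
    by case: (n) n0 => // n' _; case: (d) d2 => // d' _; rewrite addSn binS.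
  (* Removing one variable costs ['C(n - 1 + d, d - 1)], and the other [k - 1] cost [d + 1] each.
     The estimate closes if the first cost is at least [2 * d + 1], which fails only for [d = 3] and
     [n = 2]. *)
  have [big|small] := leqP (d + d).+1 'C(n.-1 + d, d.-1).
    have rE : r = (r - k) + (n.-1 - (n - k)) + 1 by lia.
    move: ub gap rec big; rewrite {1}rE.
    move: (r - k) (n.-1 - (n - k)) => x y; move: 'C(_, _) 'C(_, _) 'C(_, _) 'C(_, _); lia.
  have d3 : d = 3.
    have : 'C(d.+1, d.-1) <= 'C(n.-1 + d, d.-1) by rewrite leq_bin2l; lia.
    rewrite -(@bin_sub d.+1 d.-1); last lia.
    have -> : d.+1 - d.-1 = 2 by lia.
    case: (d) d2 small => [|[|[|[|d']]]] // _ small h.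
    have := leq_trans h small; have := binS d'.+4 1; have := binS d'.+3 1; have := binS d'.+2 1.
    by rewrite !bin1; lia.
  have n2 : n = 2.
    have [|n3] := leqP n 2; first lia.
    move: small; rewrite d3 -[3.-1]/2 => small.
    have : 'C(5, 2) <= 'C(n.-1 + 3, 2) by rewrite leq_bin2l; lia.
    by rewrite -['C(5, 2)]/10; lia.
  have k1 : k = 1 by lia.
  by rewrite d3 n2 k1 -['C(_, _)]/4; lia.
have : size (mons (n - k) d.+1) <= (r - k) * (n - k) by nia.
have -> : r * m = (r - k) * m + k * m by rewrite -mulnDl subnK //; lia.
by rewrite leq_add2r => /leq_trans; apply; rewrite leq_mul2l pm orbT.
Qed.

(** * Indexing monomials *)

Fixpoint mlt (q m : seq nat) : bool :=
  match q, m with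
  | a :: q', b :: m' => (a < b) || (a == b) && mlt q' m'
  | _, _ => false
  end.

Lemma mlt_irr q : mlt q q = false.
Proof. by elim: q => //= a q ->; rewrite ltnn eqxx. Qed.

Lemma mlt_trans : transitive mlt.
Proof.
elim=> [|b m IH] [|a q] [|c p] //= /orP[ab|/andP[/eqP-> qm]] /orP[bc|/andP[/eqP<- mp]].
- by rewrite (ltn_trans ab bc).
- by rewrite ab.
- by rewrite bc.
- by rewrite eqxx (IH _ _ qm mp) orbT.
Qed.

Lemma mlt_madd2r q q' m : size q = size m -> size q' = size m ->
  mlt (madd q' m) (madd q m) = mlt q' q.
Proof.
elim: q q' m => [|a q IH] [|a' q'] [|b m] //= [sq] [sq'].
by rewrite ltn_add2r eqn_add2r IH.
Qed.

Lemma mons_pairwise n e : pairwise mlt (mons n e).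
Proof.
elim: n e => [|n IHn] e; first by case: e.
elim: e => [|e IHe]; first by rewrite mons_deg0.
rewrite monsS pairwise_cat !pairwise_map; apply/and3P; split.
- rewrite allrel_mapl allrel_mapr; apply/allrelP => x y _ yn.
  by case: y yn => [|b y] //; rewrite mem_mons.
- by apply: sub_pairwise (IHn e.+1) => x y /= ->.
apply: (sub_in_pairwise (P := mem (mons n.+1 e)) _ (allss _) IHe) => x y xn yn.
by case: x y xn yn => [|a x] [|b y]; rewrite ?mem_mons.
Qed.

Section MonomialIndex.
Variables (n : nat).
Local Notation N e := (size (mons n e)).

Definition mon e (i : 'I_(N e)) : seq nat := nth [::] (mons n e) i.

Lemma mon_mem e (i : 'I_(N e)) : mon i \in mons n e.
Proof. exact: mem_nth. Qed.

Lemma size_mon e (i : 'I_(N e)) : size (mon i) = n.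
Proof. by have := mon_mem i; rewrite mem_mons => /andP[/eqP]. Qed.

Lemma mon_inj e : injective (@mon e).
Proof.
move=> i i' /eqP; rewrite /mon nth_uniq ?mons_uniq // => /eqP; exact: val_inj.
Qed.

Lemma monP e m : m \in mons n e -> exists i : 'I_(N e), mon i = m.
Proof.
move=> mn; have lt : index m (mons n e) < N e by rewrite index_mem.
by exists (Ordinal lt); rewrite /mon nth_index.
Qed.

Lemma lt_mon e (i i' : 'I_(N e)) : (i < i') = mlt (mon i) (mon i').
Proof.
have h (x y : 'I_(N e)) : x < y -> mlt (mon x) (mon y).
  by move=> xy; have /(pairwiseP [::]) h := mons_pairwise n e; apply: h => //; rewrite inE.
apply/idP/idP => [/h//|lt]; rewrite ltnNge; apply/negP; rewrite leq_eqVlt.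
case/predU1P => [/val_inj e1|/h gt]; first by rewrite e1 mlt_irr in lt.
by have := mlt_trans lt gt; rewrite mlt_irr.
Qed.

Lemma card_count_mon e (P : pred (seq nat)) :
  #|[pred i : 'I_(N e) | P (mon i)]| = count P (mons n e).
Proof.
rewrite -sum_nat_count (big_nth [::]) big_mkord -sum1_card big_mkcond.
by apply: eq_bigr => i _.
Qed.

Lemma mprod_subproof j d (q : 'I_(N j)) (mu : 'I_(N d)) :
  index (madd (mon q) (mon mu)) (mons n (j + d)) < N (j + d).
Proof. by rewrite index_mem madd_mons ?mon_mem. Qed.

Definition mprod j d (q : 'I_(N j)) (mu : 'I_(N d)) : 'I_(N (j + d)) :=
  Ordinal (mprod_subproof q mu).

Lemma mon_mprod j d (q : 'I_(N j)) (mu : 'I_(N d)) :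
  mon (mprod q mu) = madd (mon q) (mon mu).
Proof. by rewrite /mon nth_index // madd_mons ?mon_mem. Qed.

(** Lexicographic order is compatible with multiplication. This is the property behind the
    comparison of leading monomials. *)
Lemma mprod_lt j d (q q' : 'I_(N j)) (mu mu' : 'I_(N d)) : q' <= q -> mu' <= mu ->
  (q' != q) || (mu' != mu) -> mprod q' mu' < mprod q mu.
Proof.
have s := size_mon; rewrite [mprod _ _ < _]lt_mon !mon_mprod.
rewrite leq_eqVlt => /predU1P[/val_inj ->|lq].
  rewrite eqxx leq_eqVlt /= => /predU1P[/val_inj->|lmu _]; first by rewrite eqxx.
  by rewrite !(maddC (mon q)) mlt_madd2r ?s // -lt_mon.
have lt1 : mlt (madd (mon q') (mon mu')) (madd (mon q) (mon mu')).
  by rewrite mlt_madd2r ?s // -lt_mon.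
rewrite leq_eqVlt => /predU1P[/val_inj <- //|lmu] _.
apply: mlt_trans lt1 _; rewrite !(maddC (mon q)) mlt_madd2r ?s // -lt_mon //.
Qed.

Lemma mprod_surj j d (M : 'I_(N (j + d))) :
  exists (q : 'I_(N j)) (mu : 'I_(N d)), mprod q mu = M.
Proof.
have := mon_mem M; rewrite mem_mons => /andP[_ /eqP dM].
have [|q qn lq] := @mons_le n j (mon M) _ (size_mon M); first by rewrite dM leq_addr.
have [iq qE] := monP qn; have [mu muE] := monP (msub_mons qn (mon_mem M) lq).
by exists iq, mu; apply: mon_inj; rewrite mon_mprod qE muE msubK.
Qed.

Definition mon_pred e (B : pred 'I_(N e)) : pred (seq nat) :=
  fun q => [exists i, (mon i == q) && B i].

Lemma mon_predE e (B : pred 'I_(N e)) i : mon_pred B (mon i) = B i.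
Proof.
apply/existsP/idP => [[i' /andP[/eqP/mon_inj->]] //|Bi].
by exists i; rewrite eqxx.
Qed.

Lemma count_mon_pred e (B : pred 'I_(N e)) : count (mon_pred B) (mons n e) = #|B|.
Proof. by rewrite -card_count_mon; apply: eq_card => i; rewrite !inE mon_predE. Qed.

End MonomialIndex.

Import Order.TTheory GRing.Theory Num.Theory.
Local Open Scope ring_scope.

(** * Leading positions and catalecticants *)

Section Leading.
Variables (F : fieldType) (p N : nat).
Implicit Types U : 'M[F]_(p, N).

(** Restriction to the coordinates in [Z] is injective on the row space of [U]. *)
Lemma rank_le_card U (Z : pred 'I_N) :
  (forall u : 'rV_N, (u <= U)%MS -> (forall M, Z M -> u 0 M = 0) -> u = 0) ->
  (\rank U <= #|Z|)%N.
Proof.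
move=> hU; rewrite leqNgt; apply/negP => lt.
pose S := \matrix_(i < \rank U, t < #|Z|) row_base U i (enum_val t).
have : kermx S != 0.
  rewrite kermx_eq0 /row_free; apply/eqP => rS.
  by have := rank_leq_col S; rewrite rS leqNgt lt.
case/rowV0Pn => v /sub_kermxP vS /negP[]; apply/eqP.
have : v *m row_base U = 0.
  apply: hU; first by rewrite (submx_trans (submxMl _ _)) // eq_row_base.
  move=> M ZM; have := congr1 (fun w : 'rV_#|Z| => w 0 (enum_rank_in ZM M)) vS.
  rewrite !mxE => {2}<-; apply: eq_bigr => i _.
  by rewrite [S _ _]mxE enum_rankK_in.
by move/eqP; rewrite mulmx_free_eq0 ?row_base_free // => /eqP.
Qed.

(** The position [M] is the last non-zero one of some vector of [U]. Intersecting with the vectors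
    supported up to [M] makes this a boolean; [lead_intro] and [lead_elim] give the usual form. *)
Definition lead U (M : 'I_N) : bool :=
  (U :&: diag_mx (\row_(i < N) (i <= M)%N%:R))%MS *m delta_mx M (0 : 'I_1) != 0.

Lemma mul_delta_col (n : nat) (A : 'M[F]_(n, N)) M i :
  (A *m delta_mx M (0 : 'I_1)) i 0 = A i M.
Proof.
rewrite mxE (bigD1 M) //= big1 ?addr0 => [|j /negbTE jM]; rewrite mxE ?eqxx ?mulr1 //.
by rewrite jM mulr0.
Qed.

Lemma lead_intro U (u : 'rV_N) (M : 'I_N) : (u <= U)%MS -> u 0 M != 0 ->
  (forall M' : 'I_N, (M < M')%N -> u 0 M' = 0) -> lead U M.
Proof.
move=> uU uM u0; rewrite /lead; apply: contra uM => /eqP L0.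
have /submxP[D uE] : (u <= U :&: diag_mx (\row_(i < N) (i <= M)%N%:R))%MS.
  rewrite sub_capmx uU; apply/submxP; exists u; apply/rowP => j.
  rewrite mul_mx_diag !mxE; case: leqP => jM; rewrite ?mulr1 // mulr0.
  exact: u0.
by rewrite -(mul_delta_col u) {1}uE -mulmxA L0 mulmx0 mxE.
Qed.

Lemma lead_elim U (M : 'I_N) : lead U M -> exists u : 'rV_N,
  [/\ (u <= U)%MS, u 0 M != 0 & forall M' : 'I_N, (M < M')%N -> u 0 M' = 0].
Proof.
rewrite /lead; set A := (U :&: _)%MS => /eqP nz.
have [i Ai] : exists i, A i M != 0.
  apply/existsP; apply: contra_notT nz; rewrite negb_exists => /forallP A0.
  by apply/colP => i; rewrite mul_delta_col mxE; apply/eqP; have := A0 i; rewrite negbK.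
exists (row i A); split; last 1 first.
- move=> M' lt; have /submxP[D ->] : (row i A <= diag_mx (\row_(i < N) (i <= M)%N%:R))%MS.
    by rewrite (submx_trans (row_sub i A)) // capmxSr.
  by rewrite mul_mx_diag !mxE leqNgt lt mulr0.
- by rewrite (submx_trans (row_sub i A)) // capmxSl.
- by rewrite mxE.
Qed.

(** The last non-zero position of a non-zero vector of [U] is a leading position, so no such vector
    vanishes at all of them. *)
Lemma rank_le_lead U : (\rank U <= #|lead U|)%N.
Proof.
apply: rank_le_card => u uU u0; apply/eqP; apply: contraT => unz.
have [i0 ui0] : exists i, u 0 i != 0.
  apply/existsP; apply: contraR unz; rewrite negb_exists => /forallP h.
  by apply/eqP/rowP => i; rewrite mxE; apply/eqP; have := h i; rewrite negbK.
have [M uM maxM] := @arg_maxnP _ i0 (fun i => u 0 i != 0) val ui0.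
rewrite -(negbTE uM); apply/eqP; apply: u0; apply: (lead_intro uU uM) => M' lt.
by apply: contraTeq lt => /maxM; rewrite -leqNgt.
Qed.

End Leading.

Section Product.
Variables (F : fieldType) (a b c : nat) (pr : 'I_a -> 'I_b -> 'I_c).
Hypothesis pr_lt : forall (q q' : 'I_a) (mu mu' : 'I_b), (q' <= q)%N -> (mu' <= mu)%N ->
  (q' != q) || (mu' != mu) -> (pr q' mu' < pr q mu)%N.

Definition free_pr (B : pred 'I_a) (B' : pred 'I_b) : pred 'I_c :=
  fun M => [forall q, forall mu, (pr q mu == M) ==> B q || B' mu].

Variables (C : 'M[F]_(a, b)) (e : nat) (E : 'M[F]_(e, c)).
Hypothesis ETan : forall i (g : 'rV_a) (w : 'rV_b), g *m C = 0 -> w *m C^T = 0 ->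
  \sum_q \sum_mu g 0 q * w 0 mu * E i (pr q mu) = 0.

Lemma lead_compl (m n : nat) (G : 'M[F]_(m, n)) :
  (#|predC (lead (kermx G))| <= \rank G)%N.
Proof.
have := rank_le_lead (kermx G); rewrite mxrank_ker.
have := cardC (lead (kermx G)); rewrite card_ord.
have := rank_leq_row G; move: #|_| #|_| (\rank _) => x y z; lia.
Qed.

(* By induction on [M], a vector in the span of [E] that vanishes at the free
   positions vanishes at [M = pr q mu]: pair it with [g] led by [q] and [w] led by
   [mu]. *)
Lemma catalecticant_bound :
  (\rank E <= #|free_pr (predC (lead (kermx C))) (predC (lead (kermx C^T)))|)%N.
Proof.
apply: rank_le_card => u /submxP[d uE] u0.
have uT (g : 'rV_a) (w : 'rV_b) : g *m C = 0 -> w *m C^T = 0 ->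
    \sum_q \sum_mu g 0 q * w 0 mu * u 0 (pr q mu) = 0.
  move=> gC wC.
  transitivity (\sum_i d 0 i * \sum_q \sum_mu g 0 q * w 0 mu * E i (pr q mu)); last first.
    by rewrite big1 // => i _; rewrite ETan ?mulr0.
  under [RHS]eq_bigr => i _ do rewrite mulr_sumr.
  rewrite [RHS]exchange_big; apply: eq_bigr => q _ /=.
  under [RHS]eq_bigr => i _ do rewrite mulr_sumr.
  rewrite [RHS]exchange_big; apply: eq_bigr => mu _ /=.
  rewrite uE mxE mulr_sumr; apply: eq_bigr => i _.
  by rewrite mulrCA.
suff h (x : nat) (M : 'I_c) : (M < x)%N -> u 0 M = 0.
  by apply/rowP => M; rewrite mxE; apply: (h c).
elim: x M => // x IH M; rewrite ltnS => Mx.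
case: (boolP (free_pr (predC (lead (kermx C))) (predC (lead (kermx C^T))) M)) => [/u0//|].
case/forallPn => q /forallPn[mu]; rewrite negb_imply negb_or !negbK => /andP[/eqP prM].
case/andP => /lead_elim[g [/sub_kermxP gC gq glt]] /lead_elim[w [/sub_kermxP wC wmu wlt]].
have := uT g w gC wC; rewrite (bigD1 q) //= (bigD1 mu) //= prM.
rewrite big1 ?addr0 => [|mu' nmu]; last first.
  have [lt|le] := ltnP mu mu'; first by rewrite (wlt _ lt) mulr0 mul0r.
  rewrite (IH (pr q mu')) ?mulr0 //; apply: leq_trans Mx; rewrite -prM.
  by apply: pr_lt => //; rewrite nmu orbT.
rewrite big1 ?addr0 => [/eqP|q' nq]; last first.
  rewrite big1 // => mu' _.
  have [lt|le] := ltnP q q'; first by rewrite (glt _ lt) !mul0r.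
  have [lt|le'] := ltnP mu mu'; first by rewrite (wlt _ lt) mulr0 mul0r.
  rewrite (IH (pr q' mu')) ?mulr0 //; apply: leq_trans Mx; rewrite -prM.
  by apply: pr_lt => //; rewrite nq.
by rewrite !mulf_eq0 (negbTE gq) (negbTE wmu) /= => /eqP.
Qed.

End Product.

(** * Multiplication by a generic system of forms *)

Section ClearDenominators.
Variable R : idomainType.
Local Notation "x %:F" := (FracField.tofrac x : {fraction R}).

(** Denominators are cleared because the derivations used below act on [P], not on its field of
    fractions. *)
Lemma fraction_scale (y : {fraction R}) :
  exists a : R, a != 0 /\ exists p : R, a%:F * y = p%:F.
Proof.
elim/quotW: y => x; exists x.2; split; first exact: denom_ratioP.
exists x.1; unlock FracField.tofrac; rewrite -[LHS]FracField.pi_mul.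
apply/eqmodP; rewrite /= FracField.equivfE /FracField.mulf /=.
by rewrite !numden_Ratio ?(oner_neq0, mul1r, mulr1) ?denom_ratioP // mulrC.
Qed.

Lemma fraction_scale_fun (T : finType) (y : T -> {fraction R}) :
  exists a : R, a != 0 /\ exists p : T -> R, forall t, a%:F * y t = (p t)%:F.
Proof.
have [a ha] := fin_all_exists (fun t => fraction_scale (y t)).
have [p hp] := fin_all_exists (fun t => (ha t).2).
exists (\prod_t a t); split; first by apply/prodf_neq0 => t _; exact: (ha t).1.
exists (fun t => p t * \prod_(t' | t' != t) a t') => t.
by rewrite (bigD1 t) //= !tofracM mulrAC hp.
Qed.

End ClearDenominators.

Section MulMatrix.
Variables (r a b c : nat) (pr : 'I_a -> 'I_b -> 'I_c).

(* The matrix of [(h_i)_i |-> \sum_i h_i * f_i], where the [f_i] are the rows of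
   [X] and the product of basis vectors is given by [pr]. *)
Definition mulmat (R : nzRingType) (X : 'M[R]_(r, b)) : 'M[R]_(r * a, c) :=
  \matrix_(x, M) mxvec (\matrix_(i < r, q < a) \sum_(mu < b | pr q mu == M) X i mu) 0 x.

Lemma map_mulmat (R S : nzRingType) (f : {rmorphism R -> S}) (X : 'M[R]_(r, b)) :
  map_mx f (mulmat X) = mulmat (map_mx f X).
Proof.
apply/matrixP => x M; rewrite !mxE; case/mxvec_indexP: x => i q; rewrite !mxvecE !mxE.
by rewrite rmorph_sum; apply: eq_bigr => mu _; rewrite mxE.
Qed.

Variables (R : comNzRingType) (X : 'M[R]_(r, b)).

Lemma mul_mulmat (g : 'rV_(r * a)) M :
  (g *m mulmat X) 0 M =
  \sum_i \sum_q \sum_(mu | pr q mu == M) g 0 (mxvec_index i q) * X i mu.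
Proof.
rewrite mxE (reindex _ (curry_mxvec_bij _ _)) /=.
rewrite (eq_bigr (fun p => \sum_(mu | pr p.2 mu == M) g 0 (mxvec_index p.1 p.2) * X p.1 mu)).
  by rewrite pair_big.
by case=> i q _; rewrite /= mxE mxvecE mxE mulr_sumr.
Qed.

Lemma mulmat_mul (F : 'cV_c) i q :
  (mulmat X *m F) (mxvec_index i q) 0 = \sum_mu X i mu * F (pr q mu) 0.
Proof.
rewrite mxE [RHS](partition_big (pr q) predT) //=; apply: eq_bigr => M _.
rewrite mxE mxvecE mxE mulr_suml; apply: eq_bigr => mu /eqP -> //.
Qed.

End MulMatrix.

Section Core.
Variables (P : idomainType) (r a b c : nat) (pr : 'I_a -> 'I_b -> 'I_c).
Hypothesis pr_lt : forall (q q' : 'I_a) (mu mu' : 'I_b), (q' <= q)%N -> (mu' <= mu)%N ->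
  (q' != q) || (mu' != mu) -> (pr q' mu' < pr q mu)%N.
Hypothesis pr_surj : forall M, exists q mu, pr q mu = M.
Variables (X : 'M[P]_(r, b)) (D : 'I_r -> 'I_b -> {additive P -> P}).
Hypothesis DM : forall i mu p q, D i mu (p * q) = D i mu p * q + p * D i mu q.
Hypothesis DX : forall i mu i' mu',
  D i mu (X i' mu') = ((i == i') && (mu == mu'))%:R.
Variables (F : 'cV[P]_c) (g : 'rV[P]_(r * a)).
Hypotheses (F0 : F != 0) (g0 : g != 0).
Hypotheses (XF : mulmat pr X *m F = 0) (gX : g *m mulmat pr X = 0).

Local Notation K := {fraction P}.
Local Notation fr := (@FracField.tofrac P).
Let dF i mu : 'cV[P]_c := \col_M D i mu (F M 0).
Let C : 'M[P]_(a, b) := \matrix_(q, mu) F (pr q mu) 0.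
Let CK : 'M[K]_(a, b) := map_mx fr C.

(** The derivative of [mulmat pr X *m F = 0] along the variable [(i, mu)]: by [DX] only the rows of
    block [i] see the derivative of the matrix, which contributes the entry of [C]. *)
Let XdF i mu i' q :
  \sum_mu' X i' mu' * D i mu (F (pr q mu') 0) = - (C q mu *+ (i == i')).
Proof.
have := congr1 (fun A : 'cV_(r * a) => D i mu (A (mxvec_index i' q) 0)) XF.
rewrite mulmat_mul mxE raddf0 raddf_sum /=.
under eq_bigr => mu' _ do rewrite DM DX.
rewrite big_split /= => /eqP; rewrite addrC addr_eq0 => /eqP ->; congr (- _).
case: eqVneq => [_|_]; last by rewrite big1 // => mu' _; rewrite mul0r.
rewrite (bigD1 mu) //= eqxx mul1r big1 ?addr0 ?mxE // => mu' /negbTE.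
by rewrite eq_sym => ->; rewrite mul0r.
Qed.

(** Pairing [XdF] with [g] kills the left side, since [g] annihilates the matrix. *)
Let gC i mu : \sum_q g 0 (mxvec_index i q) * C q mu = 0.
Proof.
have h : \sum_M (g *m mulmat pr X) 0 M * D i mu (F M 0) = 0.
  by rewrite gX big1 // => M _; rewrite mxE mul0r.
have : \sum_i' \sum_q g 0 (mxvec_index i' q) *
    \sum_mu' X i' mu' * D i mu (F (pr q mu') 0) = 0.
  rewrite -[RHS]h; under [RHS]eq_bigr => M _ do rewrite mul_mulmat mulr_suml.
  rewrite [RHS]exchange_big; apply: eq_bigr => i' _ /=.
  under [RHS]eq_bigr => M _ do rewrite mulr_suml.
  rewrite [RHS]exchange_big; apply: eq_bigr => q _ /=.
  rewrite mulr_sumr [LHS](partition_big (pr q) predT) //=; apply: eq_bigr => M _.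
  by rewrite mulr_suml; apply: eq_bigr => mu' /eqP ->; rewrite mulrA.
under eq_bigr => i' _ do under eq_bigr => q _ do rewrite XdF mulrN.
rewrite (bigD1 i) //= [X in _ + X]big1 ?addr0 => [|i' /negbTE ni]; last first.
  by rewrite big1 // => q _; rewrite eq_sym ni mulr0n mulr0 oppr0.
under eq_bigr => q _ do rewrite eqxx mulr1n.
by rewrite sumrN => /eqP; rewrite oppr_eq0 => /eqP.
Qed.

Let rank_lt : (\rank CK < a)%N.
Proof.
have [x gx] : exists x, g 0 x != 0.
  apply/existsP; apply: contraR g0; rewrite negb_exists => /forallP h.
  by apply/eqP/rowP => x; rewrite mxE; apply/eqP; have := h x; rewrite negbK.
case/mxvec_indexP: x gx => i q gx.
rewrite ltn_neqAle rank_leq_row andbT; apply/negP => rk.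
pose v : 'rV[K]_a := \row_q fr (g 0 (mxvec_index i q)).
have : v *m CK = 0.
  apply/rowP => mu; rewrite !mxE -[RHS](rmorph0 fr) -(gC i mu) rmorph_sum.
  by apply: eq_bigr => q' _; rewrite !mxE rmorphM.
move/eqP; rewrite mulmx_free_eq0 // => /eqP/rowP/(_ q)/eqP.
by rewrite !mxE tofrac_eq0 (negbTE gx).
Qed.

Let rank_gt0 : (0 < \rank CK)%N.
Proof.
rewrite lt0n mxrank_eq0; apply: contra F0 => /eqP C0; apply/eqP/colP => M.
have [q [mu <-]] := pr_surj M; apply/eqP.
have := congr1 (fun A : 'M[K]_(a, b) => A q mu) C0.
by rewrite !mxE => /eqP; rewrite tofrac_eq0.
Qed.

(** [f] selects [m] independent columns of [C]. Only the derivatives of [F] along the variables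
    [(i, f t)] are put into [E0], so that its rows can be independent. *)
Let f := maxrankfun CK^T.
Let m := \rank CK^T.
Let E0 : 'M[K]_(r * m, c) :=
  \matrix_(x, M) mxvec (\matrix_(i < r, t < m) fr (D i (f t) (F M 0))) 0 x.
Let FK : 'rV[K]_c := \row_M fr (F M 0).
Let E := col_mx E0 FK.

(** For the row [F] this is [C w = 0]. For a derivative, scale both kernel vectors to have entries
    in [P], differentiate [ga' C = 0] and pair with [w']: the term with the derivative of [ga']
    contains [C w' = 0]. *)
Let tangent i (ga : 'rV[K]_a) (w : 'rV[K]_b) : ga *m CK = 0 -> w *m CK^T = 0 ->
  \sum_q \sum_mu ga 0 q * w 0 mu * E i (pr q mu) = 0.
Proof.
move=> gaC wC; have Cw q : \sum_mu CK q mu * w 0 mu = 0.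
  have := congr1 (fun A : 'rV_a => A 0 q) wC; rewrite !mxE => h; rewrite -[RHS]h.
  by apply: eq_bigr => mu _; rewrite [CK^T _ _]mxE mulrC.
rewrite /E -[i]splitK; case: (split i) => {i} [x|x] /=; last first.
  rewrite big1 // => q _; under eq_bigr => mu _ do rewrite col_mxEd mxE -mulrA.
  rewrite -mulr_sumr -[X in _ * X](_ : 0 = _) ?mulr0 // -[LHS](Cw q).
  by apply: eq_bigr => mu _; rewrite !mxE mulrC.
case/mxvec_indexP: x => i t.
have [s [s0 [ga' hga]]] := fraction_scale_fun (fun q => ga 0 q).
have [s' [s'0 [w' hw]]] := fraction_scale_fun (fun mu => w 0 mu).
have Cw' q : \sum_mu C q mu * w' mu = 0.
  apply/eqP; rewrite -tofrac_eq0 rmorph_sum; apply/eqP.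
  transitivity (fr s' * \sum_mu CK q mu * w 0 mu); last by rewrite Cw mulr0.
  rewrite mulr_sumr; apply: eq_bigr => mu _.
  by rewrite rmorphM /= -hw [CK _ _]mxE mulrCA.
have gaC' mu : \sum_q ga' q * C q mu = 0.
  apply/eqP; rewrite -tofrac_eq0 rmorph_sum; apply/eqP.
  have := congr1 (fun A : 'rV_b => fr s * A 0 mu) gaC; rewrite !mxE mulr0 => h.
  rewrite -[RHS]h mulr_sumr; apply: eq_bigr => q _.
  by rewrite rmorphM /= -hga [CK _ _]mxE mulrA.
apply/eqP; have ss0 : fr s * fr s' != 0 by rewrite mulf_neq0 ?tofrac_eq0.
rewrite -(mulrI_eq0 _ (mulfI ss0)) mulr_sumr; apply/eqP.
transitivity (fr (\sum_q \sum_mu ga' q * w' mu * D i (f t) (C q mu))).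
  rewrite rmorph_sum; apply: eq_bigr => q _; rewrite rmorph_sum mulr_sumr.
  apply: eq_bigr => mu _; rewrite !rmorphM /= -hga -hw col_mxEu mxE mxvecE !mxE.
  by ring.
rewrite -[RHS](rmorph0 fr); congr (fr _).
transitivity (\sum_mu w' mu * D i (f t) (\sum_q ga' q * C q mu)); last first.
  by rewrite big1 // => mu _; rewrite gaC' raddf0 mulr0.
under [RHS]eq_bigr => mu _ do rewrite raddf_sum mulr_sumr.
rewrite [RHS]exchange_big /=; apply/eqP; rewrite -subr_eq0 -sumrB; apply/eqP.
rewrite big1 // => q _; rewrite -sumrB.
transitivity (- D i (f t) (ga' q) * \sum_mu C q mu * w' mu); last by rewrite Cw' mulr0.
rewrite mulr_sumr; apply: eq_bigr => mu _; rewrite DM.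
by ring.
Qed.

(** Multiply a relation by block [i] of the matrix: [F] is killed, and by [XdF] only the derivatives
    with first index [i] survive, giving a relation between the chosen columns of [C]. These are
    independent, so only a multiple of [F] is left, and [F] is non-zero. *)
Let E_free : row_free E.
Proof.
rewrite -kermx_eq0; apply/rowV0P => u /sub_kermxP.
rewrite -[u]hsubmxK mul_row_col => uE.
set u1 := lsubmx u in uE *; set u2 := rsubmx u in uE *.
have XFK i q : \sum_mu fr (X i mu) * FK 0 (pr q mu) = 0.
  have := congr1 (fun A : 'cV_(r * a) => fr (A (mxvec_index i q) 0)) XF.
  rewrite mulmat_mul mxE rmorph0 rmorph_sum => h; rewrite -[RHS]h.
  by apply: eq_bigr => mu _; rewrite [FK _ _]mxE rmorphM.
have u10 : u1 = 0.
  apply: (can_inj vec_mxK); rewrite linear0.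
  apply/row_matrixP => i; rewrite row0; apply/eqP.
  have fC : row_free (rowsub f CK^T) by exact: maxrowsub_free.
  rewrite -(mulmx_free_eq0 _ fC); apply/eqP/rowP => q; rewrite !mxE.
  have : \sum_mu fr (X i mu) * (u1 *m E0 + u2 *m FK) 0 (pr q mu) = 0.
    by rewrite uE big1 // => mu _; rewrite mxE mulr0.
  under eq_bigr => mu _ do rewrite mxE mulrDr.
  rewrite big_split /= [X in _ + X](_ : _ = 0) ?addr0; last first.
    transitivity (u2 0 0 * \sum_mu fr (X i mu) * FK 0 (pr q mu)); last by rewrite XFK mulr0.
    by rewrite mulr_sumr; apply: eq_bigr => mu _; rewrite [X in _ * X]mxE big_ord1 mulrCA.
  have -> : \sum_mu fr (X i mu) * (u1 *m E0) 0 (pr q mu) =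
     - \sum_t u1 0 (mxvec_index i t) * CK q (f t).
    transitivity (\sum_x u1 0 x * \sum_mu fr (X i mu) * E0 x (pr q mu)).
      under [RHS]eq_bigr => x _ do rewrite mulr_sumr.
      rewrite [RHS]exchange_big; apply: eq_bigr => mu _; rewrite mxE mulr_sumr.
      by apply: eq_bigr => x _; rewrite mulrCA.
    rewrite (reindex _ (curry_mxvec_bij _ _)) /=.
    rewrite (eq_bigr (fun p => u1 0 (mxvec_index p.1 p.2) * - (CK q (f p.2) *+ (p.1 == i)))).
      rewrite -(pair_big predT predT
        (fun i' t => u1 0 (mxvec_index i' t) * - (CK q (f t) *+ (i' == i)))) /=.
      rewrite (bigD1 i) //= [X in _ + X]big1 ?addr0 => [|i' /negbTE ->].
        by rewrite -sumrN; apply: eq_bigr => t _; rewrite eqxx mulr1n mulrN.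
      by rewrite big1 // => t _; rewrite mulr0n oppr0 mulr0.
    case=> i' t _ /=; congr (_ * _).
    have := congr1 fr (XdF i' (f t) i q); rewrite rmorph_sum rmorphN rmorphMn.
    rewrite [CK _ _]mxE => <-; apply: eq_bigr => mu _.
    by rewrite mxE mxvecE mxE rmorphM.
  move/eqP; rewrite oppr_eq0 => /eqP h; rewrite -[RHS]h.
  by apply: eq_bigr => t _; rewrite !mxE.
have u20 : u2 = 0.
  move: uE; rewrite u10 mul0mx add0r => uE.
  have [M FM] : exists M, F M 0 != 0.
    apply/existsP; apply: contraR F0; rewrite negb_exists => /forallP h.
    by apply/eqP/colP => M; rewrite mxE; apply/eqP; have := h M; rewrite negbK.
  apply/rowP => x; rewrite ord1 mxE; apply/eqP.
  have := congr1 (fun A : 'rV_c => A 0 M) uE; rewrite !mxE big_ord1 mxE => /eqP.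
  by rewrite mulf_eq0 [FK _ _]mxE tofrac_eq0 (negbTE FM) orbF.
by rewrite u10 u20 row_mx0.
Qed.

Theorem generic_max_rank_core : exists m (B : pred 'I_a) (B' : pred 'I_b),
  [/\ (0 < m < a)%N, (#|B| <= m)%N, (#|B'| <= m)%N & (r * m < #|free_pr pr B B'|)%N].
Proof.
exists (\rank CK), (predC (lead (kermx CK))), (predC (lead (kermx CK^T))).
rewrite rank_gt0 rank_lt lead_compl -{1}mxrank_tr lead_compl; split=> //.
(* [E] has [r * m + 1] rows and full row rank, whence the strict inequality. *)
have := catalecticant_bound pr_lt tangent; move/eqP: E_free => ->.
by rewrite /m mxrank_tr addn1.
Qed.

End Core.

(** * Specialization *)

Lemma infinite_uniq_seq (T : eqType) (n : nat) : infinite_type T ->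
  exists s : seq T, uniq s /\ size s = n.
Proof.
move=> infT; elim: n => [|n [s [us ss]]]; first by exists [::].
have [x xs] : exists x, x \notin s.
  apply: NNPP => nx; apply: infT; exists s => x; apply: contraT => xs.
  by case: nx; exists x.
by exists (x :: s); rewrite /= xs ss.
Qed.

Lemma poly_nonroot (k : fieldType) (p : {poly k}) : infinite_type k -> p != 0 ->
  exists x, p.[x] != 0.
Proof.
move=> infk p0; have [s [us ss]] := infinite_uniq_seq (size p) infk.
have /allPn[x _ xr] : ~~ all (root p) s.
  by apply/negP => al; have := max_poly_roots p0 al us; rewrite ss ltnn.
by exists x.
Qed.

(** Induction on the number of variables. The coefficient [q] of [x_0 ^ e], where [e] is the
    exponent of [x_0] in the leading monomial, is a non-zero polynomial in the other variables. At a
    point where it does not vanish, [p] becomes a non-zero polynomial [Q] in [x_0]. *)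
Lemma mpoly_nonroot (k : fieldType) (n : nat) (p : {mpoly k[n]}) :
  infinite_type k -> p != 0 -> exists v, p.@[v] != 0.
Proof.
move=> infk; elim: n p => [|n IH] p p0.
  exists (fun=> 0); apply: contra p0 => /eqP h; apply/eqP/mpolyP => m.
  rewrite mcoeff0 -h mevalE.
  case: (boolP (m \in msupp p)) => [mp|]; last first.
    move=> mp; rewrite big1_seq ?memN_msupp_eq0 // => m' /andP[_].
    have -> : m' = m by apply/mnmP => -[].
    by rewrite (negbTE mp).
  rewrite (bigD1_seq m) ?msupp_uniq //= big_ord0 mulr1 big1 ?addr0 // => m' /negP[].
  by apply/eqP/mnmP => -[].
pose res (m : 'X_{1..n.+1}) : 'X_{1..n} := [multinom m (lift ord0 i) | i < n].
pose e := mlead p ord0; have lp : mlead p \in msupp p by exact: mlead_supp.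
pose q : {mpoly k[n]} := \sum_(m <- msupp p | m ord0 == e) p@_m *: 'X_[res m].
have [v qv] : exists v, q.@[v] != 0.
  apply: IH; apply/negP => /eqP/(congr1 (mcoeff (res (mlead p)))).
  rewrite mcoeff0 raddf_sum /= -big_filter (bigD1_seq (mlead p)) /=; last 2 first.
  - by rewrite mem_filter eqxx.
  - by rewrite filter_uniq ?msupp_uniq.
  rewrite mcoeffZ mcoeffX eqxx mulr1 big1_seq ?addr0.
    by move/eqP; rewrite mcoeff_eq0 lp.
  move=> m /andP[mn]; rewrite mem_filter => /andP[/eqP me _].
  rewrite mcoeffZ mcoeffX; case: eqP => [h|]; last by rewrite mulr0.
  case/eqP: mn; apply/mnmP => i; case: (unliftP ord0 i) => [j|] -> //.
  by have := congr1 (fun x : 'X_{1..n} => x j) h; rewrite !mnmE.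
pose Q : {poly k} := \sum_(m <- msupp p) (p@_m * \prod_i v i ^+ res m i)%:P * 'X^(m ord0).
have [x Qx] : exists x, Q.[x] != 0.
  apply: poly_nonroot => //; apply/negP => /eqP/(congr1 (coefp e)) /=.
  rewrite coef0 coef_sum => h; case/eqP: qv; rewrite -[RHS]h.
  rewrite raddf_sum /= big_mkcond; apply: eq_bigr => m _.
  rewrite coefCM coefXn eq_sym; case: eqP => _; last by rewrite mulr0.
  by rewrite mevalZ mevalX mulr1.
exists (fun i => oapp v x (unlift ord0 i)); rewrite mevalE; apply: contra Qx => /eqP h.
rewrite -[X in _ == X]h horner_sum; apply/eqP; apply: eq_bigr => m _.
rewrite hornerM hornerC hornerXn -mulrA; congr (_ * _).
rewrite big_ord_recl unlift_none /= mulrC; congr (_ * _).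
by apply: eq_bigr => i _; rewrite liftK /= mnmE.
Qed.

(** Maximal rank off the zero set of an explicit non-zero polynomial; several such conditions are
    met together by multiplying these polynomials. *)
Definition generic_max_rank (k : fieldType) s m n (A : 'M[{mpoly k[s]}]_(m, n)) :=
  exists p : {mpoly k[s]}, p != 0 /\
    forall v, p.@[v] != 0 -> \rank (map_mx (meval v) A) = minn m n.

Lemma row_full_rank (K : fieldType) m n (A : 'M[K]_(m, n)) : row_full A ->
  \rank A = minn m n.
Proof.
by move=> /eqP rA; have := rank_leq_row A; rewrite rA => /minn_idPr.
Qed.

Lemma row_free_rank (K : fieldType) m n (A : 'M[K]_(m, n)) : row_free A ->
  \rank A = minn m n.
Proof.
by move=> /eqP rA; have := rank_leq_col A; rewrite rA => /minn_idPl.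
Qed.

Lemma det_rowsub_full (K : fieldType) m n (A : 'M[K]_(m, n)) (f : 'I_n -> 'I_m) :
  \det (rowsub f A) != 0 -> row_full A.
Proof.
rewrite -unitfE -unitmxE -row_full_unit => /eqP rf; rewrite /row_full eqn_leq rank_leq_col.
by rewrite -{1}rf mxrankS // rowsubE submxMl.
Qed.

Lemma generic_row_full (k : fieldType) s m n (A : 'M[{mpoly k[s]}]_(m, n)) f :
  \det (rowsub f A) != 0 -> generic_max_rank A.
Proof.
move=> detA; exists (\det (rowsub f A)); split=> // v.
rewrite -det_map_mx map_mxsub => /det_rowsub_full; exact: row_full_rank.
Qed.

Lemma generic_max_rank_tr (k : fieldType) s m n (A : 'M[{mpoly k[s]}]_(m, n)) :
  generic_max_rank A^T -> generic_max_rank A.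
Proof.
move=> [p [p0 hp]]; exists p; split=> // v /hp.
by rewrite -map_trmx mxrank_tr minnC.
Qed.

(** Maximal rank over the field of fractions provides a non-zero maximal minor, which serves as the
    polynomial. *)
Lemma generic_max_rank_frac (k : fieldType) s m n (A : 'M[{mpoly k[s]}]_(m, n)) :
  let AK := map_mx (@FracField.tofrac {mpoly k[s]}) A in
  row_free AK || row_full AK -> generic_max_rank A.
Proof.
have full m' n' (B : 'M[{mpoly k[s]}]_(m', n')) :
    row_full (map_mx (@FracField.tofrac {mpoly k[s]}) B) -> generic_max_rank B.
  move=> rf; have := fullrowsub_unit rf; rewrite unitmxE unitfE -map_mxsub det_map_mx.
  by rewrite tofrac_eq0; apply: generic_row_full.
move=> AK /orP[rf|]; last exact: full.
by apply/generic_max_rank_tr/full; rewrite -map_trmx /row_full mxrank_tr.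
Qed.

(** A maximal minor that is non-zero at one point is a non-zero polynomial. *)
Lemma generic_max_rank_point (k : fieldType) s m n (A : 'M[{mpoly k[s]}]_(m, n)) v :
  \rank (map_mx (meval v) A) = minn m n -> generic_max_rank A.
Proof.
have full m' n' (B : 'M[{mpoly k[s]}]_(m', n')) :
    row_full (map_mx (meval v) B) -> generic_max_rank B.
  move=> rf; apply: (@generic_row_full _ _ _ _ _ (fullrankfun rf)).
  have := fullrowsub_unit rf; rewrite unitmxE unitfE -map_mxsub det_map_mx.
  by apply: contra => /eqP ->; rewrite rmorph0.
move=> rA; have [le|le] := leqP m n.
  apply/generic_max_rank_tr/full; rewrite -map_trmx /row_full mxrank_tr rA.
  by rewrite (minn_idPl le).
by apply: full; rewrite /row_full rA (minn_idPr (ltnW le)).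
Qed.

Definition generic_coefs (k : fieldType) r b : 'M[{mpoly k[r * b]}]_(r, b) :=
  \matrix_(i, mu) 'X_(mxvec_index i mu).

Lemma eq_mxvec_index m n (i i' : 'I_m) (j j' : 'I_n) :
  (mxvec_index i j == mxvec_index i' j') = (i == i') && (j == j').
Proof.
apply/eqP/andP => [h|[/eqP-> /eqP->] //].
have [g gK _] := curry_mxvec_bij m n.
have := gK (i, j) isT; rewrite /= h (gK (i', j') isT) => -[-> ->].
by rewrite !eqxx.
Qed.

(** If the rank were not maximal, both kernels would be non-zero over the field of fractions. Scaled
    to polynomial vectors, they contradict the count through [generic_max_rank_core], with the
    partial derivatives as derivations. *)
Lemma generic_max_rank_mulmat (k : fieldType) r a b c (pr : 'I_a -> 'I_b -> 'I_c) :
  (forall (q q' : 'I_a) (mu mu' : 'I_b), (q' <= q)%N -> (mu' <= mu)%N ->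
     (q' != q) || (mu' != mu) -> (pr q' mu' < pr q mu)%N) ->
  (forall M, exists q mu, pr q mu = M) ->
  (forall m (B : pred 'I_a) (B' : pred 'I_b), (0 < m < a)%N ->
     (#|B| <= m)%N -> (#|B'| <= m)%N -> (#|free_pr pr B B'| <= r * m)%N) ->
  generic_max_rank (mulmat pr (generic_coefs k r b)).
Proof.
move=> pr_lt pr_surj comb; apply: generic_max_rank_frac; apply: contraT.
set A := map_mx _ _; rewrite negb_or => /andP[nfree nfull].
have /rowV0Pn[g /sub_kermxP gA g0] : kermx A != 0 by rewrite kermx_eq0.
have /rowV0Pn[F /sub_kermxP FA F0] : kermx A^T != 0.
  by rewrite kermx_eq0 /row_free mxrank_tr.
have [s [s0 [g' hg]]] := fraction_scale_fun (fun x => g 0 x).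
have [s' [s'0 [F' hF]]] := fraction_scale_fun (fun x => F 0 x).
pose G := \row_x g' x; pose H := \col_x F' x.
have HE : map_mx (@FracField.tofrac _) H = FracField.tofrac s' *: F^T.
  by apply/colP => x; rewrite !mxE hF.
have GE : map_mx (@FracField.tofrac _) G = FracField.tofrac s *: g.
  by apply/rowP => x; rewrite !mxE hg.
have inj m n (B : 'M[{mpoly k[r * b]}]_(m, n)) : map_mx (@FracField.tofrac _) B = 0 -> B = 0.
  move=> B0; apply/matrixP => i j; rewrite mxE; apply/eqP.
  by have /matrixP/(_ i j)/eqP := B0; rewrite !mxE tofrac_eq0.
have H0 : H != 0.
  apply: contra F0 => /eqP H0; move: HE; rewrite H0 map_mx0 => /esym/eqP.
  by rewrite scaler_eq0 tofrac_eq0 (negbTE s'0) trmx_eq0.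
have G0 : G != 0.
  apply: contra g0 => /eqP G0; move: GE; rewrite G0 map_mx0 => /esym/eqP.
  by rewrite scaler_eq0 tofrac_eq0 (negbTE s0).
have GA0 : G *m mulmat pr (generic_coefs k r b) = 0.
  by apply: inj; rewrite map_mxM GE -scalemxAl gA scaler0.
have AH0 : mulmat pr (generic_coefs k r b) *m H = 0.
  apply: inj; rewrite map_mxM HE -scalemxAr -[map_mx _ _]/A.
  by rewrite -[A]trmxK -trmx_mul FA trmx0 scaler0.
pose D (i : 'I_r) (mu : 'I_b) : {additive {mpoly k[r * b]} -> {mpoly k[r * b]}} :=
  mderiv (mxvec_index i mu).
have DM i mu p q : D i mu (p * q) = D i mu p * q + p * D i mu q by exact: mderivM.
have DX i mu i' mu' : D i mu (generic_coefs k r b i' mu') = ((i == i') && (mu == mu'))%:R.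
  rewrite mxE /D /= mderivX mnm1E eq_mxvec_index [i' == i]eq_sym [mu' == mu]eq_sym.
  case: andP => [[/eqP-> /eqP->]|_]; last by rewrite scale0r.
  by rewrite -[X in (X - _)%MM]add0m addmK mpolyX0 scale1r.
have [m [B [B' [hm cB cB']]]] := generic_max_rank_core pr_lt pr_surj DM DX H0 G0 AH0 GA0.
by rewrite ltnNge comb.
Qed.

Lemma card_free_pr n j d (B : pred 'I_(size (mons n j))) (B' : pred 'I_(size (mons n d))) :
  (#|free_pr (@mprod n j d) B B'| <=
     count (free_mon n j (mon_pred B) (mon_pred B')) (mons n (j + d)))%N.
Proof.
rewrite -card_count_mon; apply/subset_leq_card/subsetP => M /forallP fM.
rewrite inE; apply/allP => _ /monP[q <-]; apply/implyP => lq.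
have [mu muE] := monP (msub_mons (mon_mem q) (mon_mem M) lq).
rewrite -muE !mon_predE; have /forallP/(_ mu)/implyP := fM q; apply.
by apply/eqP/mon_inj; rewrite mon_mprod muE msubK.
Qed.

Section MultiplicationMatrix.
Variables (k : fieldType) (n d : nat).
Hypothesis d2 : (2 < d)%N.
Local Notation N e := (size (mons n e)).

Definition generic_mulmat r j : 'M[{mpoly k[r * N d]}]_(r * N j, N (j + d)) :=
  mulmat (@mprod n j d) (generic_coefs k r (N d)).

Lemma generic_mulmat_large r j : (j <= 2)%N -> (n < r)%N -> (N (j + d) < r.+1 * N j)%N ->
  generic_max_rank (generic_mulmat r j).
Proof.
move=> j2 nr hr; apply: generic_max_rank_mulmat => [*|M|m B B' /andP[m0 ma] cB cB'].
- exact: mprod_lt.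
- exact: mprod_surj.
apply: leq_trans (card_free_pr _ _) _.
have [q qn Bq] : exists2 q, q \in mons n j & ~~ mon_pred B q.
  apply/allPn; rewrite all_count count_mon_pred.
  by apply: contraL ma => /eqP <-; rewrite -leqNgt.
rewrite -!count_mon_pred in cB cB'.
case: j j2 B hr ma cB qn Bq => [|[|[|j]]] // _ B hr ma cB qn Bq.
- by move: ma m0; rewrite mons_deg0 /= ltnS leqNgt => /negbTE ->.
- exact: (free_le1 d2 nr hr m0 qn Bq cB cB').
exact: (free_le2 d2 nr hr m0 qn Bq cB cB').
Qed.

Lemma generic_mulmat_eval r j v : map_mx (meval v) (generic_mulmat r j) =
  mulmat (@mprod n j d) (\matrix_(i, mu) v (mxvec_index i mu)).
Proof.
by rewrite map_mulmat; congr mulmat; apply/matrixP => i mu; rewrite !mxE /= mevalXU.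
Qed.

Lemma generic_mulmat_point r j (X : 'M[k]_(r, N d)) :
  \rank (mulmat (@mprod n j d) X) = minn (r * N j) (N (j + d)) ->
  generic_max_rank (generic_mulmat r j).
Proof.
move=> rX; apply: (@generic_max_rank_point _ _ _ _ _ (fun x => mxvec X 0 x)).
rewrite generic_mulmat_eval -{}rX; congr (\rank (mulmat _ _)).
by apply/matrixP => i mu; rewrite mxE mxvecE.
Qed.

Lemma rowsub_row_free (K : fieldType) m m' p (A : 'M[K]_(m, p)) (f : 'I_m' -> 'I_m) :
  injective f -> row_free A -> row_free (rowsub f A).
Proof.
move=> finj /row_freeP[B AB]; apply/row_freeP; exists (B *m (rowsub f 1%:M)^T).
rewrite mulmxA mul_rowsub_mx AB; apply/matrixP => i i'; rewrite !mxE (bigD1 (f i')) //=.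
rewrite big1 ?addr0 => [|x /negbTE nx]; rewrite !mxE; last first.
  by rewrite [f i' == x]eq_sym nx mulr0.
by rewrite eqxx mulr1 (inj_eq finj).
Qed.

(** Specialize the [r'] forms so that the rows of their matrix are independent; the matrix of the
    first [r] forms consists of some of these rows. *)
Lemma generic_mulmat_sub r r' j : infinite_type k -> (r <= r')%N -> (r' * N j <= N (j + d))%N ->
  generic_max_rank (generic_mulmat r' j) -> generic_max_rank (generic_mulmat r j).
Proof.
move=> infk le_r le_N [p [p0 hp]]; have [v /hp] := mpoly_nonroot infk p0.
rewrite generic_mulmat_eval (minn_idPl le_N); set X := \matrix_(_, _) _ => rX.
have free : row_free (mulmat (@mprod n j d) X) by rewrite /row_free rX.
apply: (@generic_mulmat_point _ _ (rowsub (widen_ord le_r) X)); apply: row_free_rank.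
pose f x := mxvec (\matrix_(i, q) mxvec_index (widen_ord le_r i) q) 0 x : 'I_(r' * N j).
have fE i q : f (mxvec_index i q) = mxvec_index (widen_ord le_r i) q by rewrite /f mxvecE mxE.
have -> : mulmat (@mprod n j d) (rowsub (widen_ord le_r) X) =
    rowsub f (mulmat (@mprod n j d) X).
  apply/matrixP => x M; case/mxvec_indexP: x => i q.
  rewrite mxE mxvecE mxE [RHS]mxE fE mxE mxvecE mxE.
  by apply: eq_bigr => mu _; rewrite mxE.
apply: rowsub_row_free free => x x'.
case/mxvec_indexP: x => i q; case/mxvec_indexP: x' => i' q'; rewrite !fE => /eqP.
rewrite eq_mxvec_index -val_eqE /= => /andP[/eqP/val_inj -> /eqP ->] //.
Qed.

(** For the powers [x_i ^ d], the products with monomials of degree [j <= 2 < d] are distinct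
    monomials: an equality for two different powers would force the exponent of [x_i] in a cofactor
    to be at least [d]. *)
Lemma generic_mulmat_small r j : (j <= 2)%N -> (r <= n)%N -> generic_max_rank (generic_mulmat r j).
Proof.
move=> j2 rn; pose pw i := mkseq (fun w => (w == i) * d)%N n.
have nth_pw i w : nth 0%N (pw i) w = ((w < n) && (w == i) * d)%N.
  have [lt|ge] := ltnP w n; first by rewrite nth_mkseq.
  by rewrite nth_default ?size_mkseq.
have [mu muE] : exists mu : 'I_r -> 'I_(N d), forall i, mon (mu i) = pw i.
  apply: (@fin_all_exists _ _ (fun (i : 'I_r) (m : 'I_(N d)) => mon m = pw i)) => i.
  apply: monP; rewrite mem_mons size_mkseq eqxx /=.
  have := sumn_take_nth n (pw i); rewrite take_oversize ?size_mkseq // => ->.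
  have iin := leq_trans (ltn_ord i) rn.
  rewrite (bigD1 (Ordinal iin)) //= nth_pw iin eqxx mul1n big1 ?addn0 // => w.
  by rewrite -val_eqE /= nth_pw => /negbTE ->; rewrite andbF.
have inj i i' (q q' : 'I_(N j)) : mprod q (mu i) = mprod q' (mu i') -> i = i' /\ q = q'.
  move=> /(congr1 (@mon n _)); rewrite !mon_mprod !muE => e.
  have {}ei : i = i'.
    apply/eqP; apply: contraT => ni; have iin := leq_trans (ltn_ord i) rn.
    have := congr1 (fun s => nth 0%N s i) e.
    rewrite !nth_madd ?size_mon ?size_mkseq // !nth_pw iin eqxx.
    have -> : (nat_of_ord i == i') = false by apply: negbTE; rewrite val_eqE.
    have := leq_nth_sumn (mon q') i; have := mon_mem q'; rewrite mem_mons => /andP[_ /eqP->].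
    lia.
  split=> //; apply: mon_inj; move: e; rewrite ei !(maddC _ (pw _)).
  by move/(congr1 (msub^~ (pw i'))); rewrite !maddK ?size_mon ?size_mkseq.
apply: (@generic_mulmat_point _ _ (\matrix_(i, m) (m == mu i)%:R)); apply: row_free_rank.
rewrite -kermx_eq0; apply/rowV0P => u /sub_kermxP uA; apply/rowP => x; rewrite mxE.
case/mxvec_indexP: x => i q; have := congr1 (fun A : 'rV_(N (j + d)) => A 0 (mprod q (mu i))) uA.
rewrite mul_mulmat mxE (bigD1 i) //= [X in _ + X]big1 ?addr0 => [|i' ni]; last first.
  rewrite big1 // => q' _; rewrite big1 // => m /eqP e; rewrite mxE.
  case: eqP => [me|_]; last by rewrite mulr0.
  by move: e; rewrite me => /inj[ii]; rewrite ii eqxx in ni.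
rewrite (bigD1 q) //= [X in _ + X]big1 ?addr0 => [|q' nq]; last first.
  rewrite big1 // => m /eqP e; rewrite mxE; case: eqP => [me|_]; last by rewrite mulr0.
  by move: e; rewrite me => /inj[_ qq]; rewrite qq eqxx in nq.
rewrite (bigD1 (mu i)) //= mxE eqxx mulr1 big1 ?addr0 // => m /andP[_ /negbTE nm].
by rewrite mxE nm mulr0.
Qed.

Lemma generic_mulmat_max_rank r j : infinite_type k -> (0 < n)%N -> (j <= 2)%N ->
  generic_max_rank (generic_mulmat r j).
Proof.
move=> infk n0 j2; have [rn|nr] := leqP r n; first exact: generic_mulmat_small.
have [lt|ge] := ltnP (N (j + d)) (r.+1 * N j); first exact: generic_mulmat_large.
have Nj : (0 < N j)%N by rewrite size_mons bin_gt0; lia.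
(* The quotient, rounded down, is the largest number of forms whose multiples can be independent in
   this degree; it satisfies the hypothesis of [generic_mulmat_large]. *)
have r1 : (r.+1 <= N (j + d) %/ N j)%N by rewrite leq_divRL.
apply: (@generic_mulmat_sub _ (N (j + d) %/ N j) _ infk (ltnW r1) (leq_divM _ _)).
by apply: generic_mulmat_large => //; [exact: leq_trans nr (ltnW r1)|rewrite ltn_ceil].
Qed.

End MultiplicationMatrix.

(** * Hilbert functions *)

Section Multinomials.
Variable n : nat.

Definition mnm_of (s : seq nat) : 'X_{1..n} := [multinom nth 0%N s i | i < n].

Definition seq_of (m : 'X_{1..n}) : seq nat := [tuple m i | i < n].

Lemma size_seq_of m : size (seq_of m) = n.
Proof. exact: size_tuple. Qed.

Lemma seq_ofK : cancel seq_of mnm_of.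
Proof.
by move=> m; apply/mnmP => i; rewrite mnmE -tnth_nth tnth_mktuple.
Qed.

Lemma mnm_ofK s : size s = n -> seq_of (mnm_of s) = s.
Proof.
move=> ss; apply: (@eq_from_nth _ 0%N); rewrite size_seq_of ?ss // => i lt.
by rewrite -[i]/(nat_of_ord (Ordinal lt)) -tnth_nth tnth_mktuple mnmE.
Qed.

Lemma mdeg_mnm_of s : size s = n -> mdeg (mnm_of s) = sumn s.
Proof.
move=> ss; rewrite mdegE -[in RHS](take_oversize (eq_leq ss)) sumn_take_nth.
by apply: eq_bigr => i _; rewrite mnmE.
Qed.

Lemma seq_of_mons m : seq_of m \in mons n (mdeg m).
Proof.
by rewrite mem_mons size_seq_of eqxx -mdeg_mnm_of ?size_seq_of // seq_ofK eqxx.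
Qed.

Lemma mnm_of_madd s t : size s = size t -> mnm_of (madd s t) = (mnm_of s + mnm_of t)%MM.
Proof. by move=> st; apply/mnmP => i; rewrite mnmDE !mnmE nth_madd. Qed.

Definition mnm_mon e (i : 'I_(size (mons n e))) : 'X_{1..n} := mnm_of (mon i).

Lemma mdeg_mnm_mon e (i : 'I_(size (mons n e))) : mdeg (mnm_mon i) = e.
Proof.
rewrite mdeg_mnm_of ?size_mon //.
by have := mon_mem i; rewrite mem_mons => /andP[_ /eqP].
Qed.

Lemma mnm_mon_inj e : injective (@mnm_mon e).
Proof.
by move=> i j /(congr1 seq_of); rewrite !mnm_ofK ?size_mon //; exact: mon_inj.
Qed.

Lemma mnm_monP e m : mdeg m = e -> exists i : 'I_(size (mons n e)), mnm_mon i = m.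
Proof.
move=> <-; have [i iE] := monP (seq_of_mons m).
by exists i; rewrite /mnm_mon iE seq_ofK.
Qed.

Lemma mnm_mon_mprod j d (q : 'I_(size (mons n j))) (mu : 'I_(size (mons n d))) :
  mnm_mon (mprod q mu) = (mnm_mon q + mnm_mon mu)%MM.
Proof. by rewrite /mnm_mon mon_mprod mnm_of_madd ?size_mon. Qed.

Variable k : fieldType.

Definition form_of e (u : 'rV[k]_(size (mons n e))) : {mpoly k[n]} :=
  \sum_M u 0 M *: 'X_[mnm_mon M].

Lemma form_of_homog e u : @form_of e u \is e.-homog.
Proof.
by apply: rpred_sum => M _; rewrite rpredZ // dhomogX /= mdeg_mnm_mon.
Qed.

Lemma mcoeff_form_of e u M : (@form_of e u)@_(mnm_mon M) = u 0 M.
Proof.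
rewrite raddf_sum (bigD1 M) //= big1 ?addr0 => [|M' nM]; rewrite mcoeffZ mcoeffX.
  by rewrite eqxx mulr1.
by rewrite (inj_eq (@mnm_mon_inj e)) (negbTE nM) mulr0.
Qed.

Lemma homog_form_of e g : g \is e.-homog -> g = form_of (\row_M g@_(@mnm_mon e M)).
Proof.
move=> ge; apply/mpolyP => m; have [/mnm_monP[M <-]|ne] := eqVneq (mdeg m) e.
  by rewrite mcoeff_form_of mxE.
by rewrite !(dhomog_nemf_coeff _ ne) // form_of_homog.
Qed.

Lemma form_of_linear e a (u v : 'rV[k]_(size (mons n e))) :
  form_of (a *: u + v) = a *: form_of u + form_of v.
Proof.
rewrite /form_of scaler_sumr -big_split; apply: eq_bigr => M _ /=.
by rewrite !mxE scalerDl scalerA.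
Qed.

Lemma form_of_mul e p (c : 'rV[k]_p) (B : 'M[k]_(p, size (mons n e))) :
  form_of (c *m B) = \sum_(j < p) c 0 j *: form_of (row j B).
Proof.
rewrite /form_of; under [RHS]eq_bigr => j _ do rewrite scaler_sumr.
rewrite exchange_big; apply: eq_bigr => M _ /=.
rewrite mxE scaler_suml; apply: eq_bigr => j _.
by rewrite scalerA mxE.
Qed.

Lemma form_ofB e (u v : 'rV[k]_(size (mons n e))) :
  form_of (u - v) = form_of u - form_of v.
Proof. by rewrite -scaleN1r addrC form_of_linear scaleN1r addrC. Qed.

(** A basis of a complement of the row space of [A] supplies the forms whose classes are a basis. *)
Lemma dim_quot_form_of r (f : 'I_r -> {mpoly k[n]}) e p (A : 'M[k]_(p, size (mons n e))) :
  (forall u, ideal_gen f (form_of u) <-> (u <= A)%MS) ->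
  dim_quot_deg (ideal_gen f) e (size (mons n e) - \rank A).
Proof.
move=> IA; rewrite -mxrank_compl; set B := row_base A^C%MS.
exists (fun j => form_of (row j B)); split => [j|c|g /homog_form_of ->].
- exact: form_of_homog.
- have -> : \sum_j c j *: form_of (row j B) = form_of ((\row_j c j) *m B).
    by rewrite form_of_mul; apply: eq_bigr => j _; rewrite mxE.
  move/IA => cA j.
  have : ((\row_j c j) *m B <= A :&: A^C)%MS.
    by rewrite sub_capmx cA (submx_trans (submxMl _ _)) // eq_row_base.
  rewrite capmx_compl submx0 mulmx_free_eq0 ?row_base_free // => /eqP/rowP/(_ j).
  by rewrite !mxE.
set u := \row__ _; have : (u <= A + A^C)%MS by rewrite submx_full // addsmx_compl_full.
case/sub_addsmxP => -[a w] /= uE.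
have /submxP[c cE] : (w *m A^C%MS <= B)%MS by rewrite eq_row_base submxMl.
exists (fun j => c 0 j); rewrite -form_of_mul -form_ofB; apply/IA.
by rewrite uE cE addrK submxMl.
Qed.

Lemma mcoeffMX_ndvd (h : {mpoly k[n]}) m M : (forall m', M != (m' + m)%MM) ->
  (h * 'X_[m])@_M = 0.
Proof.
move=> nd; rewrite [h]mpolyE mulr_suml raddf_sum big1 // => i _.
by rewrite /= -scalerAl mcoeffZ -mpolyXD mcoeffX eq_sym (negbTE (nd i)) mulr0.
Qed.

Variables (r d : nat) (X : 'M[k]_(r, size (mons n d))).

Definition forms (i : 'I_r) := form_of (row i X).

Lemma mcoeff_mul_form (h : {mpoly k[n]}) i j (M : 'I_(size (mons n (j + d)))) :
  (h * forms i)@_(mnm_mon M) =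
  \sum_q \sum_(mu | mprod q mu == M) h@_(mnm_mon q) * X i mu.
Proof.
rewrite mulr_sumr raddf_sum /= (exchange_big_dep predT) //=.
apply: eq_bigr => mu _; rewrite mxE -scalerAr mcoeffZ.
rewrite -mulr_suml mulrC; congr (_ * _).
case: (pickP (fun q => mprod q mu == M)) => [q /eqP qM|nq].
  rewrite (big_pred1 q) => [|q' /=].
    by rewrite -qM mnm_mon_mprod addmC mcoeffMX.
  apply/eqP/eqP => [|-> //]; rewrite -qM => /(congr1 (@mnm_mon _)).
  rewrite !mnm_mon_mprod => /addIm; exact: mnm_mon_inj.
rewrite big_pred0 // mcoeffMX_ndvd // => m'; apply/negP => /eqP h1.
have /mnm_monP[q qE] : mdeg m' = j.
  apply: (@addIn d); rewrite -{1}(mdeg_mnm_mon mu) -mdegD -h1.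
  exact: mdeg_mnm_mon.
have /negP[] := nq q; apply/eqP/mnm_mon_inj.
by rewrite mnm_mon_mprod qE.
Qed.

(** The coefficients [h i] need not be homogeneous, but the coefficients of the product in degree
    [j + d] involve only their parts of degree [j]. *)
Lemma ideal_forms j (u : 'rV_(size (mons n (j + d)))) :
  ideal_gen forms (form_of u) <-> (u <= mulmat (@mprod n j d) X)%MS.
Proof.
split=> [[h hE]|/submxP[g ->]].
  apply/submxP; exists (mxvec (\matrix_(i, q) (h i)@_(mnm_mon q))).
  apply/rowP => M; rewrite mul_mulmat -mcoeff_form_of hE raddf_sum /=.
  apply: eq_bigr => i _; rewrite mcoeff_mul_form; apply: eq_bigr => q _.
  by apply: eq_bigr => mu _; rewrite mxvecE mxE.
exists (fun i => form_of (\row_q g 0 (mxvec_index i q))).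
have hom : \sum_i form_of (\row_q g 0 (mxvec_index i q)) * forms i \is (j + d).-homog.
  by apply: rpred_sum => i _; apply: dhomogM; exact: form_of_homog.
rewrite [RHS](homog_form_of hom); congr form_of; apply/rowP => M.
rewrite mul_mulmat [RHS]mxE raddf_sum /=; apply: eq_bigr => i _.
rewrite mcoeff_mul_form; apply: eq_bigr => q _; apply: eq_bigr => mu _.
by rewrite mcoeff_form_of mxE.
Qed.

Lemma ideal_forms_low e (u : 'rV_(size (mons n e))) : (e < d)%N ->
  ideal_gen forms (form_of u) <-> (u <= (0 : 'M_(size (mons n e))))%MS.
Proof.
move=> ed; split=> [[h hE]|]; last first.
  rewrite submx0 => /eqP ->; exists (fun=> 0); rewrite big1 => [|i _]; last by rewrite mul0r.
  by rewrite /form_of big1 // => M _; rewrite mxE scale0r.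
rewrite submx0; apply/eqP/rowP => M; rewrite mxE -mcoeff_form_of hE raddf_sum big1 // => i _.
rewrite /= mulr_sumr raddf_sum big1 // => mu _; rewrite -scalerAr /= mcoeffZ.
rewrite mcoeffMX_ndvd ?mulr0 // => m'; apply/negP => /eqP/(congr1 mdeg).
rewrite mdegD !mdeg_mnm_mon => h1; move: ed; rewrite h1; lia.
Qed.

End Multinomials.

(** * Coefficients of the series and their truncation *)

Lemma series_div_unique (p q : {poly int}) (a : nat -> int) L : q`_0 = 1 ->
  (forall i, (i < L)%N -> \sum_(j < i.+1) q`_(i - j) * a j = p`_i) ->
  forall i, (i < L)%N -> series_div p q i = a i.
Proof.
move=> q0 ha i; elim/ltn_ind: i => i IH iL.
have := series_divP p q0 i; rewrite -(ha i iL) !big_ord_recr /= subnn q0 !mul1r.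
rewrite (eq_bigr (fun j : 'I_i => q`_(i - j) * a j)) => [/addrI //|j _].
by rewrite IH // (ltn_trans (ltn_ord j)).
Qed.

Section Series.
Variables n d r L : nat.
Hypotheses (d0 : (0 < d)%N) (Ld : (L <= 2 * d)%N).

(** The series [(1 - t)^-m] cut off at degree [L], a polynomial to which ring identities apply. *)
Definition mons_poly m : {poly int} := \poly_(i < L) (size (mons m i))%:Z.

Lemma mons_polyE m i : (i < L)%N -> (mons_poly m)`_i = (size (mons m i))%:Z.
Proof. by move=> iL; rewrite coef_poly iL. Qed.

Lemma coef_mul_congr (p q q' : {poly int}) i : (forall j, (j <= i)%N -> q`_j = q'`_j) ->
  (p * q)`_i = (p * q')`_i.
Proof. by move=> h; rewrite !coefMr; apply: eq_bigr => j _; rewrite h // leq_ord. Qed.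

Lemma coef_mons_poly m i : (i < L)%N -> ((1 - 'X) ^+ m * mons_poly m)`_i = (i == 0%N)%:Z.
Proof.
elim: m i => [|m IH] i iL; first by rewrite expr0 mul1r mons_polyE //; case: (i).
rewrite exprSr -mulrA -(IH i iL); apply: coef_mul_congr => j ji.
have jL := leq_ltn_trans ji iL.
rewrite mulrBl mul1r coefB coefXM !mons_polyE ?(leq_ltn_trans (leq_pred j)) //.
case: j ji jL => [|j] _ jL /=; first by rewrite !mons_deg0 subr0.
rewrite monsS size_cat !size_map PoszD.
by rewrite addrK.
Qed.

(** Below degree [L <= 2 * d] only the constant term and the term [- r * t^d] are visible. *)
Lemma coef_1subXn_expr i : (i < L)%N ->
  ((1 - 'X^d : {poly int}) ^+ r)`_i = (i == 0%N)%:Z - (r * (i == d))%:Z.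
Proof.
move=> iL; elim: (r) i iL => [|s IH] i iL.
  by rewrite expr0 coef1 mul0n subr0 natz.
rewrite exprS mulrBl mul1r coefB coefXnM IH //; case: ltnP => di.
  by have -> : (i == d) = false; [lia|rewrite !muln0 !subr0].
rewrite IH; last lia.
have -> : (i - d == d)%N = false by lia.
rewrite muln0 !subr0; case: (eqVneq i d) => [->|ne].
  by rewrite subnn !muln1; have -> : (d == 0%N) = false; lia.
have -> : (i - d == 0)%N = false by lia.
by rewrite !muln0 !subr0.
Qed.

Lemma froberg_coef i : (i < L)%N ->
  series_div ((1 - 'X^d) ^+ r) ((1 - 'X) ^+ n) i =
  (size (mons n i))%:Z - (if (i < d)%N then 0 else (r * size (mons n (i - d)))%:Z).
Proof.
pose a i := (mons_poly n - 'X^d * (r%:Z *: mons_poly n))`_i.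
have aE j : (j < L)%N -> a j = (size (mons n j))%:Z -
    (if (j < d)%N then 0 else (r * size (mons n (j - d)))%:Z).
  move=> jL; rewrite /a coefB mons_polyE // coefXnM; case: ltnP => // dj.
  by rewrite coefZ mons_polyE ?PoszM //; lia.
move=> iL; rewrite -aE //; apply: (series_div_unique (L := L)) iL => [|j jL].
  exact: coef0_expr_1subX.
rewrite -coefMr mulrBr coefB coef_mons_poly // mulrCA -scalerAr coefXnM coefZ.
rewrite coef_1subXn_expr //; congr (_ - _); case: ltnP => dj.
  by have -> : (j == d) = false; [lia|rewrite muln0].
rewrite coef_mons_poly; last lia.
by rewrite PoszM subn_eq0; congr (_ * _%:Z); case: eqVneq => [->|]; [rewrite leqnn|lia].
Qed.

End Series.

(** The growth ratio [(n + e) / (e + 1)] of the dimensions does not increase with [e] for [n >= 1].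
    Thus a non-positive coefficient is followed by non-positive ones in the range considered, and
    truncation agrees with taking positive parts. *)
Lemma mons_saturated n d r j : (0 < n)%N ->
  (size (mons n (j + d)) <= r * size (mons n j))%N ->
  (size (mons n (j.+1 + d)) <= r * size (mons n j.+1))%N.
Proof.
move=> n0 h; have h1 := mons_ratio n j; have h2 := mons_ratio n (j + d).
rewrite addSn; have jj : (0 < j.+1 * (j + d).+1)%N by [].
rewrite -(leq_pmul2l jj) -mulnA -h2.
rewrite [leqRHS](_ : _ = ((j + d).+1 * (r * (j.+1 * size (mons n j.+1))))%N); last by nia.
rewrite -h1; move: (size (mons n (j + d))) (size (mons n j)) h => a b h.
have : (j.+1 * ((n + (j + d)) * a) <= j.+1 * ((n + (j + d)) * (r * b)))%N.
  by rewrite !leq_mul2l h !orbT.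
move/leq_trans; apply.
rewrite mulnA.
rewrite (_ : ((j + d).+1 * (r * ((n + j) * b)) = ((j + d).+1 * (n + j)) * (r * b))%N); last by nia.
by rewrite leq_mul2r; apply/orP; right; nia.
Qed.

Theorem theorem1 (k : fieldType) (hk : infinite_type k)
  (n : nat) (hn : (1 <= n)%N) (d : nat) (hd : (2 < d)%N)
  (r : nat) (hr : (0 < r)%N) :
  exists f : 'I_r -> {mpoly k[n]},
    (forall j, f j \is d.-homog) /\
    forall i : nat, (i <= d + 2)%N ->
      exists m : nat,
        dim_quot_deg (ideal_gen f) i m /\ m%:Z = froberg_series n d r i.
Proof.
have good j : (j <= 2)%N -> generic_max_rank (generic_mulmat k n d r j).
  exact: generic_mulmat_max_rank.
have [p0 [p00 hp0]] := good 0%N isT; have [p1 [p10 hp1]] := good 1%N isT.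
have [p2 [p20 hp2]] := good 2 isT.
(* One specialization serves all three degrees [j = 0, 1, 2]. *)
have [v] : exists v, (p0 * p1 * p2).@[v] != 0.
  by apply: mpoly_nonroot; rewrite ?mulf_neq0.
rewrite !mevalM !mulf_eq0 !negb_or => /andP[/andP[/hp0 h0 /hp1 h1] /hp2 h2].
pose X : 'M[k]_(r, size (mons n d)) := \matrix_(i, mu) v (mxvec_index i mu).
have rk j : (j <= 2)%N -> \rank (mulmat (@mprod n j d) X) =
    minn (r * size (mons n j)) (size (mons n (j + d))).
  by case: j => [|[|[|j]]] // _; rewrite -generic_mulmat_eval.
have pos i : (0 < size (mons n i))%N by rewrite size_mons bin_gt0; lia.
(* This is where [d > 2] enters the series: degrees up to [d + 2] stay below [2 * d]. *)
pose L := (d + 3)%N; have Ld : (L <= 2 * d)%N by rewrite /L; lia.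
have coef i : (i <= d + 2)%N -> series_div ((1 - 'X^d) ^+ r) ((1 - 'X) ^+ n) i =
    (size (mons n i))%:Z - (if (i < d)%N then 0 else (r * size (mons n (i - d)))%:Z).
  by move=> id; apply: (froberg_coef n r (L := L)); rewrite /L; lia.
exists (forms X); split=> [j|i id]; first exact: form_of_homog.
have [lt|le] := ltnP i d.
  exists (size (mons n i)); split.
    have := dim_quot_form_of (fun u => @ideal_forms_low _ _ _ _ X i u lt).
    by rewrite mxrank0 subn0.
  rewrite /froberg_series /trunc_pos ifT; first by rewrite coef // lt subr0.
  apply/forallP => j; have ji := ltn_ord j.
  by rewrite coef ?ifT ?subr0 ?ltz_nat //; lia.
have [j jE] : exists j, i = (j + d)%N by exists (i - d)%N; rewrite subnK.
have j2 : (j <= 2)%N by lia.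
(* The rank is the minimum of the two dimensions, so this is the positive part of the
   coefficient. *)
exists (size (mons n i) - minn (r * size (mons n j)) (size (mons n i)))%N; split.
  have := dim_quot_form_of (@ideal_forms _ _ _ _ X j).
  by rewrite rk // -jE.
have ai l : (l <= 2)%N -> series_div ((1 - 'X^d) ^+ r) ((1 - 'X) ^+ n) (l + d) =
    (size (mons n (l + d)))%:Z - (r * size (mons n l))%:Z.
  by move=> l2; rewrite coef; [rewrite ltnNge leq_addl addnK|lia].
have sat l l' : (l <= l')%N -> (size (mons n (l + d)) <= r * size (mons n l))%N ->
    (size (mons n (l' + d)) <= r * size (mons n l'))%N.
  move=> ll h; elim: l' ll => [|l' IH]; first by rewrite leqn0 => /eqP <-.
  rewrite leq_eqVlt => /predU1P[<- //|/IH]; exact: mons_saturated.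
rewrite /froberg_series /trunc_pos; case: ifP => [/forallP pa|/negbT/forallPn[x nx]].
  have := pa ord_max; rewrite /= jE ai //; lia.
(* Some coefficient at [x <= i] is non-positive. It cannot be below degree [d], so saturation
   carries it up to [i], where both sides are then zero. *)
have xi := ltn_ord x.
have [xd|dx] := ltnP x d.
  by move: nx; rewrite coef ?xd ?subr0 ?ltz_nat ?pos //; lia.
have [l xE] : exists l, val x = (l + d)%N by exists (x - d)%N; rewrite subnK.
have xi' : (val x <= i)%N by [].
have l2 : (l <= 2)%N by lia.
have : (size (mons n i) <= r * size (mons n j))%N.
  rewrite jE; apply: (sat l); first by lia.
  by move: nx; rewrite /= xE ai //; lia.
lia.
Qed.
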